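(* There are $\mathfrak{c}$-many mutually inequivalent planar embeddings of the Knaster accordion $K$, each of whose images has the same accessible points as in the standard embedding of $K$. That is, there is a collection $\Psi$ of planar embeddings of $K$ with $|\Psi|=\mathfrak{c}$ such that any two distinct members of $\Psi$ are inequivalent and, for every $\psi\in\Psi$ and every $x\in K$, the point $\psi(x)$ is an accessible point of $\psi(K)$ if and only if $x$ is an accessible point of $K$ (where $K\subset\mathbb{R}^2$ is in its standard embedding).
   Context: $\mathfrak{c}$ denotes the cardinality of the set of real numbers. The Knaster $V\Lambda$-continuum (Knaster accordion) $K\subset[0,1]\times[0,1]\subset\mathbb{R}^2$ is constructed as follows. A ''$V$'' (resp. ''$\Lambda$'') is an arc that is the union of two straight segments, with a common end (its vertex) on the line $y=0$ (resp. $y=1$), and whose two endpoints lie on the line $y=1$ (resp. $y=0$). Step 1: draw the $V$ with vertex $(1/2,0)$ and endpoints $(1/3,1)$ and $(2/3,1)$. Step $n\ge 2$: let $\Delta_n$ be the set of the $2^{n-1}$ quadrilaterals contained in $[0,1]\times[0,1]$, with bottom side on $y=0$ and top side on $y=1$, whose left and right sides are each one of $\{0\}\times[0,1]$, $\{1\}\times[0,1]$, or a maximal straight segment of a $V$ or $\Lambda$ drawn in a preceding step (the two sides not belonging to the same $V$ or $\Lambda$), and whose interiors contain no points of the $V$'s and $\Lambda$'s drawn in preceding steps. If $n$ is even, in each member of $\Delta_n$ draw a $\Lambda$ whose vertex is the midpoint of the top side and whose two endpoints trisect the bottom side; if $n$ is odd, in each member of $\Delta_n$ draw a $V$ whose vertex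 is the midpoint of the bottom side and whose two endpoints trisect the top side. $K$ is the closure of the union of all $V$'s and $\Lambda$'s drawn in all steps. The standard embedding of $K$ is the inclusion of this set in $\mathbb{R}^2$. A planar embedding of a continuum $X$ is a homeomorphism of $X$ onto a subset of the plane $\mathbb{R}^2$. Two planar embeddings $\varphi,\psi$ of $X$ are equivalent if there is a homeomorphism of the plane onto itself mapping $\varphi(X)$ onto $\psi(X)$; otherwise they are inequivalent. For a continuum $Y\subset\mathbb{R}^2$, a point $y\in Y$ is an accessible point of $Y$ (accessible from the complement of $Y$) if there is an arc $A\subset\mathbb{R}^2$ with $A\cap Y=\{y\}$. *)

(* Defs.v *)
From HB Require Import structures.
From mathcomp Require Import all_boot all_order all_algebra.
From mathcomp Require Import all_classical all_reals all_analysis.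

Set Implicit Arguments.
Unset Strict Implicit.
Unset Printing Implicit Defensive.

Import Order.TTheory GRing.Theory Num.Theory.
Import numFieldNormedType.Exports.
Local Open Scope classical_set_scope.
Local Open Scope ring_scope.

(* The plane is [(R * R)%type] with the product topology. *)

Section Homeomorphisms.
Context {T U : topologicalType}.

(* Only the values of [f] on [A] matter. *)
Definition homeomorphism_on (A : set T) (f : T -> U) (B : set U) : Prop :=
  {within A, continuous f} /\ f @` A = B /\
  exists g : U -> T, {within B, continuous g} /\ {in A, cancel f g}.

End Homeomorphisms.

Section PlanarEmbeddings.
Context {R : realType} {T : topologicalType}.

Definition is_planar_embedding (X : set T) (phi : T -> R * R) : Prop :=
  exists B : set (R * R), homeomorphism_on X phi B.

Definition equivalent_embeddings (X : set T) (phi psi : T -> R * R) : Prop :=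
  exists h : R * R -> R * R,
    homeomorphism_on [set: R * R] h [set: R * R] /\
    h @` (phi @` X) = psi @` X.

End PlanarEmbeddings.

Section Accessibility.
Context {R : realType}.

Definition is_arc (A : set (R * R)) : Prop :=
  exists f : R -> R * R, homeomorphism_on (`[0, 1] : set R) f A.

Definition accessible (Y : set (R * R)) (y : R * R) : Prop :=
  Y y /\ exists A : set (R * R), is_arc A /\ A `&` Y = [set y].

End Accessibility.

Section KnasterAccordion.
Context {R : realType}.

(* The straight segment from [(bot, 0)] to [(top, 1)]. *)
Record side : Type := Side { bot : R; top : R }.

Definition side_at (s : side) (y : R) : R := (1 - y) * bot s + y * top s.

Definition side_set (s : side) : set (R * R) :=
  [set p : R * R | 0 <= p.2 <= 1 /\ p.1 = side_at s p.2].

(* [Vee v e e'] has vertex [(v, 0)] and endpoints [(e, 1)] and [(e', 1)];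
   [Lam v e e'] has vertex [(v, 1)] and endpoints [(e, 0)] and [(e', 0)]. *)
Inductive zigzag : Type := Vee of R & R & R | Lam of R & R & R.

Definition legs (a : zigzag) : set side :=
  match a with
  | Vee v e e' => [set Side v e; Side v e']
  | Lam v e e' => [set Side e v; Side e' v]
  end.

Definition zigzag_set (a : zigzag) : set (R * R) :=
  \bigcup_(s in legs a) side_set s.

(* The quadrilateral with left side [l] and right side [r]. *)
Definition quad_set (l r : side) : set (R * R) :=
  [set p : R * R | 0 <= p.2 <= 1 /\ side_at l p.2 <= p.1 <= side_at r p.2].

Definition unit_square : set (R * R) :=
  [set p : R * R | 0 <= p.1 <= 1 /\ 0 <= p.2 <= 1].

Definition admissible_side (D : set zigzag) (s : side) : Prop :=
  s = Side 0 0 \/ s = Side 1 1 \/ exists2 a, D a & legs a s.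

(* The pairs (left side, right side) of the quadrilaterals in which to draw
   next, where [D] is the set of V's and Lambda's already drawn.  The strict
   inequalities say that the bottom and top sides are nondegenerate. *)
Definition Delta (D : set zigzag) : set (side * side) :=
  [set q | let: (l, r) := q in
    (bot l < bot r /\ top l < top r) /\
    quad_set l r `<=` unit_square /\
    admissible_side D l /\ admissible_side D r /\
    ~ (exists a, [/\ D a, legs a l & legs a r]) /\
    (forall a, D a -> (quad_set l r)° `&` zigzag_set a = set0)].

Definition midpoint (a b : R) : R := (a + b) / 2.
Definition third1 (a b : R) : R := a + (b - a) / 3.
Definition third2 (a b : R) : R := a + 2 * (b - a) / 3.

Definition Vee_in (q : side * side) : zigzag :=
  let: (l, r) := q in
  Vee (midpoint (bot l) (bot r))
      (third1 (top l) (top r)) (third2 (top l) (top r)).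

Definition Lam_in (q : side * side) : zigzag :=
  let: (l, r) := q in
  Lam (midpoint (top l) (top r))
      (third1 (bot l) (bot r)) (third2 (bot l) (bot r)).

(* The V's and Lambda's drawn in steps 1, ..., n. *)
Fixpoint drawn (n : nat) : set zigzag :=
  match n with
  | 0 => set0
  | 1 => [set Vee (1 / 2) (1 / 3) (2 / 3)]
  | m.+1 => drawn m `|`
            (if odd m.+1 then Vee_in else Lam_in) @` Delta (drawn m)
  end.

Definition knaster_accordion : set (R * R) :=
  closure (\bigcup_n \bigcup_(a in drawn n) zigzag_set a).

End KnasterAccordion.

Arguments knaster_accordion R : clear implicits.

(* Main.v *)
Require Import Defs.
From HB Require Import structures.
From mathcomp Require Import all_boot all_order all_algebra.
From mathcomp Require Import all_classical all_reals all_analysis.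
From mathcomp Require Import ring lra zify.

Set Implicit Arguments.
Unset Strict Implicit.
Unset Printing Implicit Defensive.

Import Order.TTheory GRing.Theory Num.Theory.
Import numFieldNormedType.Exports.
Local Open Scope classical_set_scope.
Local Open Scope ring_scope.

(** Why the accordion has continuum many inequivalent embeddings with the same
accessible points.

The accordion is a Cantor family of straight segments from the bottom to the
top of the square, in which the two sides of every removed triangle are glued
at one end, the vertex of a V or of a Lambda.  These vertices are exactly its
cut points ([cut_accordionP]).  Following the rightmost quadrilateral of every
step gives vertices [bend 0], [bend 1], and so on, alternately on the bottom
and on the top, that tend to the right side of the square.  What lies between
[bend k.-1] and [bend k] is an accordion inside a quadrilateral [cell k],
attached to the rest at two opposite corners only.  It can therefore be cut
out, reflected, and put back with the two corners at their places.  The map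
[mirror] does so inside the cell and moves heights by at most [scale k], which
tends to 0, so that any set of pairwise nonadjacent cells can be mirrored
simultaneously ([glue_continuous]); this is the embedding [embedding M].  All
boundary points of a mirrored cell are still reached from the two triangles at
its sides ([mirror_free_right], [mirror_free_left]), and elsewhere the picture
has only been changed by a local homeomorphism; hence the accessible points
are the same ([access_iff]).

What has changed is the relative position of two legs with a common vertex.
Ordinarily they face each other across their triangle, and arbitrarily close
to the vertex there are arcs outside of the accordion from one leg to the
other ([joined_unflipped]).  If exactly one of the two cells at [bend j] is
mirrored, the two legs can only be reached from opposite sides of the arc that
they form, and there are no such arcs ([not_joined_flipped]).  All barriers
are graphs over the height, and the intermediate value theorem shows that a
path cannot pass them ([approach], [crossing]).

A homeomorphism of the plane between two images induces a homeomorphism of the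
accordion, which preserves everything expressed by connected subsets: which
points separate which ([linked]), the cut points, and the two legs at a vertex
([layer], [layer_vertex]).  So it carries the flipped bends of one embedding
to those of the other.  Separation remembers their order, whence the m-th
flipped bend goes to the m-th one ([rigid]), and all V-vertices go to vertices
of one and the same kind ([heights_image]).  Thus the sequence of kinds of the
flipped bends is an invariant.  Mirroring the cell of index [4i+1] or [4i+2]
according to the i-th bit of a code makes every binary sequence appear in it,
and real numbers are coded by their cuts of rational numbers. *)

(** * The tree of quadrilaterals *)

Section Tree.
Context {R : realType}.
Local Notation side := (@side R).
Implicit Types (b : bool) (q : side * side) (w : seq bool) (s : side) (y : R) (p : R * R).

Definition point_at s y : R * R := (side_at s y, y).

(** [b] tells the kind of zigzag that is drawn: [false] for a V, [true] for a
Lambda.  Its vertex is at height [b%:R]. *)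
Definition left_leg b q : side :=
  if b then Side (third1 (bot q.1) (bot q.2)) (midpoint (top q.1) (top q.2))
  else Side (midpoint (bot q.1) (bot q.2)) (third1 (top q.1) (top q.2)).

Definition right_leg b q : side :=
  if b then Side (third2 (bot q.1) (bot q.2)) (midpoint (top q.1) (top q.2))
  else Side (midpoint (bot q.1) (bot q.2)) (third2 (top q.1) (top q.2)).

Definition zigzag_of b q : zigzag := if b then Lam_in q else Vee_in q.

Definition child b q (c : bool) : side * side :=
  if c then (right_leg b q, q.2) else (q.1, left_leg b q).

(** Words describe the way down the tree: [false] chooses the part to the left of
the zigzag, [true] the part to its right, and the kinds alternate. *)
Fixpoint subquad b q w : side * side :=
  if w is c :: w' then subquad (~~ b) (child b q c) w' else q.

Definition kind b w : bool := b (+) odd (size w).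

Definition open_triangle b q : set (R * R) :=
  [set p | side_at (left_leg b q) p.2 < p.1 < side_at (right_leg b q) p.2].

Definition nondegenerate q : Prop := bot q.1 < bot q.2 /\ top q.1 < top q.2.

(** A description by complements: a point of the quadrilateral belongs to the
accordion unless it lies strictly between the legs of some zigzag.  Unlike the
definition by a closure it is inherited by the quadrilaterals of the tree. *)
Definition accordion b q : set (R * R) :=
  [set p | quad_set q.1 q.2 p /\ forall w, ~ open_triangle (kind b w) (subquad b q w) p].

Lemma legs_zigzag_of b q : legs (zigzag_of b q) = [set left_leg b q; right_leg b q].
Proof. by case: b; case: q. Qed.

Lemma kind_cat b w v : kind b (w ++ v) = kind (kind b w) v.
Proof. by rewrite /kind size_cat oddD addbA. Qed.

Lemma kind_cons b c w : kind b (c :: w) = kind (~~ b) w.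
Proof. by rewrite /kind /= addbN addNb. Qed.

Lemma subquad_cat b q w v : subquad b q (w ++ v) = subquad (kind b w) (subquad b q w) v.
Proof.
elim: w b q => [|c w IH] b q /=; first by rewrite /kind addbF.
by rewrite IH kind_cons.
Qed.

Lemma subquad_rcons b q w c : subquad b q (rcons w c) = child (kind b w) (subquad b q w) c.
Proof. by rewrite -cats1 subquad_cat. Qed.

Definition width q y : R := side_at q.2 y - side_at q.1 y.

Lemma width_gt0 q y : nondegenerate q -> 0 <= y <= 1 -> 0 < width q y.
Proof.
case: q => -[bl tl] [br tr] [] /= h1 h2 /andP [y0 y1].
rewrite /width /side_at /=.
have [->|yn] := eqVneq y 0; first lra.
have y0' : 0 < y by rewrite lt_neqAle eq_sym yn.
have : 0 < y * (tr - tl) by apply: mulr_gt0 => //; lra.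
have : 0 <= (1 - y) * (br - bl) by apply: mulr_ge0; lra.
lra.
Qed.

(** The legs cut the bottom and the top into halves or thirds, hence at each height
both remaining parts are at most half as wide as the quadrilateral. *)
Lemma leg_gaps b q y : nondegenerate q -> 0 <= y <= 1 ->
  [/\ side_at q.1 y < side_at (left_leg b q) y,
      side_at (left_leg b q) y <= side_at (right_leg b q) y,
      side_at (right_leg b q) y < side_at q.2 y,
      side_at (left_leg b q) y - side_at q.1 y <= width q y / 2
    & side_at q.2 y - side_at (right_leg b q) y <= width q y / 2].
Proof.
move=> wq hy; move: (width_gt0 wq hy).
case: q wq => -[bl tl] [br tr] [] /= h1 h2; move: hy => /andP [y0 y1].
have B : 0 <= y * (tr - tl) by apply: mulr_ge0 => //; lra.
have A : 0 <= (1 - y) * (br - bl) by apply: mulr_ge0; lra.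
rewrite /width /side_at /left_leg /right_leg; case: b;
  rewrite /= /third1 /third2 /midpoint => W; split; lra.
Qed.

Lemma leg_lt b q y : nondegenerate q -> 0 <= y <= 1 -> y != b%:R ->
  side_at (left_leg b q) y < side_at (right_leg b q) y.
Proof.
case: q => -[bl tl] [br tr] [] /= h1 h2 /andP [y0 y1] yb.
rewrite /side_at /left_leg /right_leg; case: b yb;
  rewrite /= /third1 /third2 /midpoint => yb.
- have : 0 < (1 - y) * (br - bl).
    apply: mulr_gt0; last lra.
    by rewrite subr_gt0 lt_neqAle yb.
  lra.
- have : 0 < y * (tr - tl).
    apply: mulr_gt0; last lra.
    by rewrite lt_neqAle eq_sym yb.
  lra.
Qed.

Lemma leg_eq b q : side_at (left_leg b q) b%:R = side_at (right_leg b q) b%:R.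
Proof.
by case: q => -[bl tl] [br tr]; case: b; rewrite /side_at /=; lra.
Qed.

Lemma nondegenerate_child b q c : nondegenerate q -> nondegenerate (child b q c).
Proof.
case: q => -[bl tl] [br tr] [] /= h1 h2.
by case: b; case: c; split; rewrite /= /third1 /third2 /midpoint; lra.
Qed.

Lemma nondegenerate_subquad b q w : nondegenerate q -> nondegenerate (subquad b q w).
Proof. by elim: w b q => [|c w IH] b q //= h; apply/IH/nondegenerate_child. Qed.

Lemma child_le b q c y : nondegenerate q -> 0 <= y <= 1 ->
  side_at q.1 y <= side_at (child b q c).1 y /\
  side_at (child b q c).2 y <= side_at q.2 y.
Proof.
move=> wq hy; have [h1 h2 h3 _ _] := leg_gaps b wq hy.
by case: c => /=; split=> //; lra.
Qed.

Lemma subquad_le b q w y : nondegenerate q -> 0 <= y <= 1 ->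
  side_at q.1 y <= side_at (subquad b q w).1 y /\
  side_at (subquad b q w).2 y <= side_at q.2 y.
Proof.
move=> wq hy; elim: w b q wq => [|c w IH] b q wq //=.
have [h1 h2] := child_le b c wq hy.
have [h3 h4] := IH (~~ b) _ (nondegenerate_child b c wq).
by split; lra.
Qed.

Lemma width_subquad b q w y : nondegenerate q -> 0 <= y <= 1 ->
  width (subquad b q w) y <= width q y / 2 ^+ size w.
Proof.
move=> wq hy; elim: w b q wq => [|c w IH] b q wq /=; first by rewrite expr0 divr1.
apply: le_trans (IH _ _ (nondegenerate_child b c wq)) _.
rewrite exprS invfM mulrA ler_wpM2r ?invr_ge0 ?exprn_ge0 //.
have [h1 h2 h3 h4 h5] := leg_gaps b wq hy.
by move: h4 h5; rewrite /width; case: c => /=; lra.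
Qed.

Lemma quad_child b q c p : nondegenerate q -> quad_set (child b q c).1 (child b q c).2 p ->
  quad_set q.1 q.2 p.
Proof.
move=> wq [hy /andP [h1 h2]]; split=> //.
have [h3 h4] := child_le b c wq hy.
by apply/andP; split; lra.
Qed.

Lemma quad_subquad b q w p : nondegenerate q -> quad_set (subquad b q w).1 (subquad b q w).2 p ->
  quad_set q.1 q.2 p.
Proof.
elim: w b q => [|c w IH] b q wq //= h.
exact: (quad_child wq (IH _ _ (nondegenerate_child b c wq) h)).
Qed.

Lemma accordion_split b q p : nondegenerate q ->
  accordion b q p <-> accordion (~~ b) (child b q false) p \/ accordion (~~ b) (child b q true) p.
Proof.
move=> wq; split.
- case=> -[hy /andP [h1 h2]] ht.
  have := ht [::]; rewrite /kind addbF /= /open_triangle /= => /negP; rewrite negb_and -!leNgt.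
  case/orP=> h; [left|right]; split=> [|w]; try by split=> //; apply/andP.
  + by have := ht (false :: w); rewrite kind_cons.
  + by have := ht (true :: w); rewrite kind_cons.
- case=> -[hq ht]; have := quad_child wq hq => hq'; split=> // w;
  have hy := hq.1; have [h1 h2 h3 _ _] := leg_gaps b wq hy;
  case: hq => _ /= /andP [h4 h5].
  + case: w => [|[] w]; rewrite ?kind_cons; last exact: ht.
      by rewrite /kind addbF /= /open_triangle /= => /andP [h6 h7]; lra.
    rewrite /= /open_triangle /= => /andP [h6 h7].
    have [/= h8 h9] := subquad_le (~~ b) w (nondegenerate_child b true wq) hy.
    have [h10 h11 h12 _ _] := leg_gaps (kind (~~ b) w)
      (nondegenerate_subquad (~~ b) w (nondegenerate_child b true wq)) hy.
    lra.
  + case: w => [|[] w]; rewrite ?kind_cons; first 1 last.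
    * exact: ht.
    * rewrite /= /open_triangle /= => /andP [h6 h7].
      have [/= h8 h9] := subquad_le (~~ b) w (nondegenerate_child b false wq) hy.
      have [h10 h11 h12 _ _] := leg_gaps (kind (~~ b) w)
        (nondegenerate_subquad (~~ b) w (nondegenerate_child b false wq)) hy.
      lra.
    * by rewrite /kind addbF /= /open_triangle /= => /andP [h6 h7]; lra.
Qed.

Lemma accordion_sub b q w p : nondegenerate q -> accordion (kind b w) (subquad b q w) p -> accordion b q p.
Proof.
elim: w b q => [|c w IH] b q wq /=; first by rewrite /kind addbF.
rewrite kind_cons => /IH h; apply/(accordion_split _ _ wq).
by case: c h => h; [right|left]; apply: h; apply: nondegenerate_child.
Qed.

Lemma acc_left b q y : nondegenerate q -> 0 <= y <= 1 -> accordion b q (point_at q.1 y).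
Proof.
move=> wq hy; have W := width_gt0 wq hy; split.
  by split=> //=; apply/andP; move: W; rewrite /width; split; lra.
move=> w /= /andP [h1 _].
have [h2 _] := subquad_le b w wq hy.
have [h3 _ _ _ _] := leg_gaps (kind b w) (nondegenerate_subquad b w wq) hy.
move: h1 => /=; lra.
Qed.

Lemma acc_right b q y : nondegenerate q -> 0 <= y <= 1 -> accordion b q (point_at q.2 y).
Proof.
move=> wq hy; have W := width_gt0 wq hy; split.
  by split=> //=; apply/andP; move: W; rewrite /width; split; lra.
move=> w /= /andP [_ h1].
have [_ h2] := subquad_le b w wq hy.
have [_ _ h3 _ _] := leg_gaps (kind b w) (nondegenerate_subquad b w wq) hy.
move: h1 => /=; lra.
Qed.

Lemma acc_sub_left b q w y : nondegenerate q -> 0 <= y <= 1 -> accordion b q (point_at (subquad b q w).1 y).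
Proof. by move=> wq hy; apply/(accordion_sub (w := w))/acc_left/hy/nondegenerate_subquad. Qed.

Lemma acc_sub_right b q w y : nondegenerate q -> 0 <= y <= 1 -> accordion b q (point_at (subquad b q w).2 y).
Proof. by move=> wq hy; apply/(accordion_sub (w := w))/acc_right/hy/nondegenerate_subquad. Qed.

Lemma acc_left_leg b q w y : nondegenerate q -> 0 <= y <= 1 ->
  accordion b q (point_at (left_leg (kind b w) (subquad b q w)) y).
Proof.
by move=> wq hy; have := acc_sub_right b (rcons w false) wq hy; rewrite subquad_rcons.
Qed.

Lemma acc_right_leg b q w y : nondegenerate q -> 0 <= y <= 1 ->
  accordion b q (point_at (right_leg (kind b w) (subquad b q w)) y).
Proof.
by move=> wq hy; have := acc_sub_left b (rcons w true) wq hy; rewrite subquad_rcons.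
Qed.

(** This gives approximations: at depth [n] the quadrilaterals are narrow. *)
Lemma accordion_depth b q n p : nondegenerate q -> accordion b q p ->
  exists2 w, size w = n & accordion (kind b w) (subquad b q w) p.
Proof.
elim: n b q => [|n IH] b q wq h; first by exists [::] => //; rewrite /kind addbF.
by case/(accordion_split _ _ wq): h => h;
  have [w sw hw] := IH _ _ (nondegenerate_child b _ wq) h;
  [exists (false :: w)|exists (true :: w)]; rewrite /= ?sw ?kind_cons.
Qed.

Lemma pow2_unbounded (x : R) : exists n : nat, x < 2 ^+ n.
Proof.
exists (Num.trunc `|x|).+1; apply: le_lt_trans (ler_norm _) _.
apply: lt_trans (truncnS_gt `|x|) _.
by rewrite -natrX ltr_nat ltn_expl.
Qed.

Lemma width_eventually b q (e : R) : nondegenerate q -> 0 < e ->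
  exists n : nat, forall w y, (n <= size w)%N -> 0 <= y <= 1 ->
    width (subquad b q w) y < e.
Proof.
move=> wq e0.
pose W := width q 0 + width q 1.
have hW y : 0 <= y <= 1 -> width q y <= W.
  move=> hy; rewrite /W; have := width_gt0 wq hy.
  have : 0 < width q 0 by apply: width_gt0 => //; rewrite lexx ler01.
  have : 0 < width q 1 by apply: width_gt0 => //; rewrite lexx ler01.
  case: q {wq W} => -[bl tl] [br tr]; rewrite /width /side_at /=.
  move: hy => /andP [y0 y1] h1 h2 _.
  have : 0 <= y * (br - bl) by apply: mulr_ge0; lra.
  have : 0 <= (1 - y) * (tr - tl) by apply: mulr_ge0; lra.
  lra.
have [n hn] := pow2_unbounded (W / e).
exists n => w y sw hy; apply: le_lt_trans (width_subquad b w wq hy) _.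
rewrite ltr_pdivrMr ?exprn_gt0 //.
apply: le_lt_trans (hW _ hy) _.
rewrite mulrC -ltr_pdivrMr //; apply: lt_le_trans hn _.
by rewrite ler_weXn2l // ler1n.
Qed.

End Tree.

(** * The inductive construction and the tree *)

Section Construction.
Context {R : realType}.
Local Notation side := (@side R).
Implicit Types (b : bool) (q : side * side) (w u : seq bool) (s : side) (y : R) (p : R * R).

Definition unit_quad : side * side := (Side 0 0, Side 1 1).

Lemma nondegenerate_unit_quad : nondegenerate unit_quad.
Proof. by split; rewrite /= ltr01. Qed.

Lemma side_ext s t : side_at s 0 = side_at t 0 -> side_at s 1 = side_at t 1 -> s = t.
Proof.
case: s => a c; case: t => a' c'; rewrite /side_at /= => h1 h2.
by congr Side; lra.
Qed.

Lemma continuous_side_at s : continuous (side_at s).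
Proof.
move=> y; rewrite /side_at.
apply: cvgD; apply: cvgM; try exact: cvg_cst; last exact: cvg_id.
by apply: cvgB; [exact: cvg_cst|exact: cvg_id].
Qed.

Lemma continuous_offset s : continuous (fun p : R * R => p.1 - side_at s p.2).
Proof.
move=> p; apply: cvgB; first exact: cvg_fst.
apply: (continuous_comp (f := snd) (g := side_at s)); first exact: cvg_snd.
exact: continuous_side_at.
Qed.

Lemma open_right_of s : open [set p : R * R | side_at s p.2 < p.1].
Proof.
have -> : [set p : R * R | side_at s p.2 < p.1] =
    (fun p : R * R => p.1 - side_at s p.2) @^-1` [set x | 0 < x].
  by apply/seteqP; split=> p /=; rewrite subr_gt0.
by apply: open_comp (open_gt (y := 0)) => p _; exact: continuous_offset.
Qed.

Lemma open_left_of s : open [set p : R * R | p.1 < side_at s p.2].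
Proof.
have -> : [set p : R * R | p.1 < side_at s p.2] =
    (fun p : R * R => p.1 - side_at s p.2) @^-1` [set x | x < 0].
  by apply/seteqP; split=> p /=; rewrite subr_lt0.
by apply: open_comp (open_lt (y := 0)) => p _; exact: continuous_offset.
Qed.

Lemma open_height (A : set R) : open A -> open [set p : R * R | A p.2].
Proof. by move=> oA; apply: (open_comp (f := snd)) oA => p _; exact: cvg_snd. Qed.

Lemma closed_height (A : set R) : closed A -> closed [set p : R * R | A p.2].
Proof. by move=> cA; apply: (closed_comp (f := snd)) cA => p _; exact: cvg_snd. Qed.

Lemma interior_quad l r x y : 0 < y < 1 -> side_at l y < x < side_at r y ->
  (quad_set l r)° (x, y).
Proof.
move=> /andP [y0 y1] /andP [h1 h2].
pose A := [set p : R * R | side_at l p.2 < p.1] `&` [set p : R * R | p.1 < side_at r p.2]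
  `&` ([set p : R * R | 0 < p.2] `&` [set p : R * R | p.2 < 1]).
have oA : open A.
  apply: openI; first by apply: openI; [exact: open_right_of|exact: open_left_of].
  by apply: openI; [exact: (open_height (@open_gt _ 0))|exact: (open_height (@open_lt _ 1))].
have : nbhs (x, y) A by apply: open_nbhs_nbhs; split.
by apply: filterS => p [[/= h3 h4] [h5 h6]]; split; apply/andP; split; exact: ltW.
Qed.

(** A point of a side is not interior, because one can leave horizontally. *)
Lemma interior_quad_strict l r p : (quad_set l r)° p ->
  side_at l p.2 < p.1 < side_at r p.2.
Proof.
move=> /nbhs_ballP [e /= e0 he].
have hp x : `|x - p.1| < e -> side_at l p.2 <= x <= side_at r p.2.
  move=> hx; have /he [] // : ball p e (x, p.2).
  split => /=; first by rewrite -ball_normE /= distrC.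
  exact: ballxx.
have h1 : `|(p.1 - e / 2) - p.1| < e.
  by rewrite addrAC subrr add0r normrN gtr0_norm; lra.
have h2 : `|(p.1 + e / 2) - p.1| < e.
  by rewrite addrAC subrr add0r gtr0_norm; lra.
by move: (hp _ h1) (hp _ h2) => /andP [h3 h4] /andP [h5 h6]; apply/andP; split; lra.
Qed.

Lemma sub_right_side b q w :
  (subquad b q w).2 = q.2 \/
  exists2 u, (size u < size w)%N & (subquad b q w).2 = left_leg (kind b u) (subquad b q u).
Proof.
elim/last_ind: w => [|w c IH]; first by left.
rewrite subquad_rcons; case: c => /=.
- case: IH => [->|[u su ->]]; first by left.
  by right; exists u => //; rewrite size_rcons ltnS ltnW.
- by right; exists w; rewrite // size_rcons.
Qed.

Lemma sub_left_side b q w :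
  (subquad b q w).1 = q.1 \/
  exists2 u, (size u < size w)%N & (subquad b q w).1 = right_leg (kind b u) (subquad b q u).
Proof.
elim/last_ind: w => [|w c IH]; first by left.
rewrite subquad_rcons; case: c => /=.
- by right; exists w; rewrite // size_rcons.
- case: IH => [->|[u su ->]]; first by left.
  by right; exists u => //; rewrite size_rcons ltnS ltnW.
Qed.

Lemma subquad_nseq_false b q n : (subquad b q (nseq n false)).1 = q.1.
Proof. by elim: n b q => [|n IH] b q //=; rewrite IH. Qed.

Lemma subquad_nseq_true b q n : (subquad b q (nseq n true)).2 = q.2.
Proof. by elim: n b q => [|n IH] b q //=; rewrite IH. Qed.

(** The quadrilaterals of one depth are separated by the legs drawn before; this
makes the sides comparable, although they are not given in any order. *)
Lemma leg_outside b q w u s : nondegenerate q -> (size u < size w)%N ->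
  legs (zigzag_of (kind b u) (subquad b q u)) s ->
  (forall y, 0 <= y <= 1 -> side_at s y <= side_at (subquad b q w).1 y) \/
  (forall y, 0 <= y <= 1 -> side_at (subquad b q w).2 y <= side_at s y).
Proof.
move=> wq; elim: w u b q wq => [|c w IH] // u b q wq su.
rewrite legs_zigzag_of => hs.
have hs' : s = left_leg (kind b u) (subquad b q u) \/ s = right_leg (kind b u) (subquad b q u).
  by case: hs => ->; [left|right].
have in_sub y : 0 <= y <= 1 ->
  side_at (subquad b q u).1 y <= side_at s y <= side_at (subquad b q u).2 y.
  move=> hy; have [h1 h2 h3 _ _] := leg_gaps (kind b u) (nondegenerate_subquad b u wq) hy.
  by case: hs' => ->; apply/andP; split; lra.
case: u su hs hs' in_sub => [|d u] su hs hs' in_sub.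
  case: c su => su /=; [left|right] => y hy;
    have [h1 h2 h3 _ _] := leg_gaps b wq hy;
    have := fun c => subquad_le (~~ b) w (nondegenerate_child b c wq) hy.
  - move=> /(_ true) [/= h4 h5]; move: hs'.
    by rewrite /kind addbF /= => -[] ->; lra.
  - move=> /(_ false) [/= h4 h5]; move: hs'.
    by rewrite /kind addbF /= => -[] ->; lra.
have [dc|dc] := eqVneq d c.
  subst d; move: hs; rewrite kind_cons /= => hs.
  by apply: (IH u) => //; [exact: nondegenerate_child|rewrite legs_zigzag_of].
case: c d dc {hs hs'} su in_sub => -[] // _ su in_sub; [left|right] => y hy;
  have [h1 h2 h3 _ _] := leg_gaps b wq hy;
  have /andP [h6 h7] := in_sub y hy;
  move: h6 h7 => /= h6 h7.
- have [/= h4 h5] := subquad_le (~~ b) w (nondegenerate_child b true wq) hy.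
  have [/= h8 h9] := subquad_le (~~ b) u (nondegenerate_child b false wq) hy.
  lra.
- have [/= h4 h5] := subquad_le (~~ b) w (nondegenerate_child b false wq) hy.
  have [/= h8 h9] := subquad_le (~~ b) u (nondegenerate_child b true wq) hy.
  lra.
Qed.

Definition drawn_before n : set (@zigzag R) :=
  [set zigzag_of (kind false w) (subquad false unit_quad w) | w in [set w | (size w < n)%N]].

Lemma left_leg_drawn n u : (size u < n)%N ->
  exists2 a, drawn_before n a & legs a (left_leg (kind false u) (subquad false unit_quad u)).
Proof.
move=> su; exists (zigzag_of (kind false u) (subquad false unit_quad u)); first by exists u.
by rewrite legs_zigzag_of; left.
Qed.

Lemma right_leg_drawn n u : (size u < n)%N ->
  exists2 a, drawn_before n a & legs a (right_leg (kind false u) (subquad false unit_quad u)).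
Proof.
move=> su; exists (zigzag_of (kind false u) (subquad false unit_quad u)); first by exists u.
by rewrite legs_zigzag_of; right.
Qed.

Lemma unit_quad_square p : quad_set unit_quad.1 unit_quad.2 p -> unit_square p.
Proof.
by move=> [hy]; rewrite /side_at /= !(mulr0, mulr1, addr0) subrK; split.
Qed.

Lemma quad_at l r y : side_at l y <= side_at r y -> 0 <= y <= 1 ->
  quad_set l r (point_at r y).
Proof. by move=> h hy; split => //=; rewrite h lexx. Qed.

Lemma half_neq_bool b : (1 / 2 : R) != b%:R.
Proof.
have [h0 h1] : 0 < (1 / 2 : R) /\ (1 / 2 : R) < 1 by split; lra.
by case: b; [rewrite lt_eqF|rewrite gt_eqF].
Qed.

(** The sides that can bound a free quadrilateral are compared with the sides of the
tree.  A left side that is a left leg is impossible, since the right leg of the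
same zigzag would cross the quadrilateral; otherwise the right side must be the
next side of the tree, which would cross the quadrilateral if it were not. *)
Lemma Delta_drawn n :
  Delta (drawn_before n) =
  [set subquad false unit_quad w | w in [set w | size w = n]].
Proof.
have wq := nondegenerate_unit_quad.
have y01 : 0 <= (0 : R) <= 1 by apply/andP; split; lra.
have y11 : 0 <= (1 : R) <= 1 by apply/andP; split; lra.
have yh1 : 0 < (1 / 2 : R) < 1 by apply/andP; split; lra.
have yh : 0 <= (1 / 2 : R) <= 1 by apply/andP; split; lra.
have s0 s : side_at s 0 = bot s by rewrite /side_at subr0 mul1r mul0r addr0.
have s1 s : side_at s 1 = top s by rewrite /side_at subrr mul1r mul0r add0r.
have sh s : side_at s (1 / 2) = (bot s + top s) / 2 by rewrite /side_at; lra.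
apply/seteqP; split=> [[l r]|_ [w sw <-]].
- move=> [[hb ht] [hsq [al [ar [_ hfree]]]]].
  have nocross s : (exists2 a, drawn_before n a & legs a s) ->
      side_at l (1 / 2) < side_at s (1 / 2) < side_at r (1 / 2) -> False.
    move=> [a Da as_] hs.
    have : ((quad_set l r)° `&` zigzag_set a) (point_at s (1 / 2)).
      by split; [exact: interior_quad|exists s].
    by rewrite hfree.
  have rle : bot r <= 1 /\ top r <= 1.
    have h0 : side_at l 0 <= side_at r 0 by rewrite !s0 ltW.
    have h1 : side_at l 1 <= side_at r 1 by rewrite !s1 ltW.
    have /hsq [/= /andP [_ +] _] := quad_at h0 y01.
    have /hsq [/= /andP [_ +] _] := quad_at h1 y11.
    by rewrite s0 s1.
  have leftside w : size w = n -> l = (subquad false unit_quad w).1 ->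
      exists2 w, size w = n & subquad false unit_quad w = (l, r).
    move=> sw lw; exists w => //.
    have hle y : 0 <= y <= 1 -> side_at (subquad false unit_quad w).2 y <= side_at r y.
      case: ar => [r0|[r1|[a [u su <-] ur]]].
      - have := subquad_le false w wq y01; rewrite -lw !s0 /= => -[h _].
        by move: hb; rewrite r0 /=; lra.
      - by move=> hy; rewrite r1; exact: (subquad_le false w wq hy).2.
      - have := leg_outside wq _ ur => /(_ w); rewrite sw => /(_ su) [h|]; last exact.
        by have := h 0 y01; rewrite -lw !s0; lra.
    have rw : r = (subquad false unit_quad w).2; last by rewrite lw rw; case: (subquad _ _ _).
    case: (sub_right_side false unit_quad w) => [h|[u su h]].
      have := hle 0 y01; have := hle 1 y11; rewrite h !s0 !s1 /= => h1 h0.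
      by case: r rle h0 h1 {hb ht hsq ar hfree nocross hle} => /= br tr [? ?] ? ?;
        congr Side; lra.
    have W := width_gt0 (nondegenerate_subquad false w wq) yh.
    have lt_l : side_at l (1 / 2) < side_at (subquad false unit_quad w).2 (1 / 2).
      by move: W; rewrite /width -lw; lra.
    have := hle 0 y01; have := hle 1 y11; rewrite !s0 !s1 => h1 h0.
    have hnl : ~ side_at (subquad false unit_quad w).2 (1 / 2) < side_at r (1 / 2).
      move=> hlt; apply: (nocross (subquad false unit_quad w).2); last by rewrite lt_l.
      by rewrite h; apply: left_leg_drawn; rewrite -sw.
    by apply: side_ext; rewrite ?s0 ?s1; move: hnl; rewrite !sh; lra.
  case: al => [l0|[l1|[a [u /= su <-]]]].
  + apply: (leftside (nseq n false)); first by rewrite size_nseq.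
    by rewrite subquad_nseq_false l0.
  + by move: hb rle.1; rewrite l1 /=; lra.
  + rewrite legs_zigzag_of => -[] lu; last first.
      apply: (leftside (u ++ true :: nseq (n - (size u).+1) false)).
        by rewrite size_cat /= size_nseq -addSnnS subnKC.
      by rewrite subquad_cat /= subquad_nseq_false.
    exfalso.
    pose w2 := u ++ true :: nseq (n - (size u).+1) false.
    have sw2 : size w2 = n by rewrite size_cat /= size_nseq -addSnnS subnKC.
    have lw2 : (subquad false unit_quad w2).1 = right_leg (kind false u) (subquad false unit_quad u).
      by rewrite subquad_cat /= subquad_nseq_false.
    set bu := kind false u in lu lw2.
    have yb : 0 <= (bu%:R : R) <= 1 by case: bu {lu lw2}.
    have lr y : 0 <= y <= 1 -> side_at l y < side_at r y.
      move=> /andP [y0 y1]; rewrite /side_at.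
      have [->|yn] := eqVneq y 0; first lra.
      have : 0 < y * (top r - top l).
        by apply: mulr_gt0; [rewrite lt_neqAle eq_sym yn|lra].
      have : 0 <= (1 - y) * (bot r - bot l) by apply: mulr_ge0; lra.
      lra.
    have leg_lt2 : side_at l (1 / 2) < side_at (subquad false unit_quad w2).1 (1 / 2).
      rewrite lw2 lu; apply: leg_lt; [exact: nondegenerate_subquad|exact: yh|].
      exact: half_neq_bool.
    have hle : side_at (subquad false unit_quad w2).2 (1 / 2) <= side_at r (1 / 2) ->
        False.
      move=> h; apply: (nocross (subquad false unit_quad w2).1).
        by rewrite lw2; apply: right_leg_drawn.
      rewrite leg_lt2 /=.
      by have := width_gt0 (nondegenerate_subquad false w2 wq) yh; rewrite /width; lra.
    have hge : (forall y, 0 <= y <= 1 ->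
        side_at r y <= side_at (subquad false unit_quad w2).1 y) -> False.
      move=> /(_ _ yb); have := lr _ yb; rewrite lw2 lu leg_eq; lra.
    case: ar => [r0|[r1|[a' [u' su' <-] ur]]].
    * have := (subquad_le false u wq y01).1; have [+ _ _ _ _] := leg_gaps bu (nondegenerate_subquad false u wq) y01.
      by move: hb; rewrite lu r0 -!s0 /= !s0 /=; lra.
    * by apply: hle; rewrite r1; exact: (subquad_le false w2 wq yh).2.
    * have := leg_outside wq _ ur => /(_ w2); rewrite sw2 => /(_ su') [|h].
        exact: hge.
      by apply: hle; apply: h.
- have wfw := nondegenerate_subquad false w wq.
  rewrite [X in Delta _ X](surjective_pairing (subquad false unit_quad w)).
  split; first exact: wfw.
  split; first by move=> p /(quad_subquad wq) /unit_quad_square.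
  split.
    case: (sub_left_side false unit_quad w) => [->|[u su ->]]; first by left.
    by right; right; apply: right_leg_drawn; rewrite -sw.
  split.
    case: (sub_right_side false unit_quad w) => [->|[u su ->]]; first by right; left.
    by right; right; apply: left_leg_drawn; rewrite -sw.
  split.
    case: wfw => hb ht [a [_ la ra]]; case: a la ra => v e e' /= [] h1 [] h2;
    by move: hb ht; rewrite h1 h2 /= ?ltxx.
  move=> _ [u /= su <-]; apply/seteqP; split=> // p [/interior_quad_strict ip].
  move=> [s ss [hp ps]]; have := leg_outside wq _ ss => /(_ w).
  rewrite sw => /(_ su); rewrite ps in ip.
  by case=> /(_ _ hp) h; move: ip => /andP [] ? ?; lra.
Qed.

Lemma drawnE n : drawn n = drawn_before n :> set (@zigzag R).
Proof.
elim: n => [|n IH]; first by apply/seteqP; split=> // a [w].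
case: n IH => [|n] IH.
  apply/seteqP; split=> a /=.
  - move=> ->; exists [::] => //=.
    by rewrite /third1 /third2 /midpoint; congr Vee; lra.
  - case=> -[|//] _ <- /=.
    by rewrite /third1 /third2 /midpoint; congr Vee; lra.
have stepE w : size w = n.+1 ->
    zigzag_of (kind false w) = (if odd n.+2 then Vee_in else Lam_in) :> (side * side -> _).
  by move=> sw; apply: funext => q; rewrite /zigzag_of /kind sw /=; case: (odd n).
rewrite [LHS](_ : _ = drawn n.+1 `|` (if odd n.+2 then Vee_in else Lam_in) @`
  Delta (drawn n.+1)) // IH Delta_drawn.
apply/seteqP; split=> a.
- case=> [[w sw <-]|[_ [w sw <-] <-]]; first by exists w => //; apply: ltnW.
  by rewrite -(stepE w sw); exists w => //=; rewrite sw.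
- move=> [w /= sw <-]; rewrite ltnS leq_eqVlt in sw.
  case/orP: sw => [/eqP sw|sw]; last by left; exists w.
  right; exists (subquad false unit_quad w); first by exists w.
  by rewrite -(stepE w sw).
Qed.

Lemma closed_accordion b q : closed (accordion b q).
Proof.
have -> : accordion b q =
  ([set p : R * R | 0 <= p.2] `&` [set p : R * R | p.2 <= 1]) `&`
  (~` [set p : R * R | p.1 < side_at q.1 p.2] `&`
   ~` [set p : R * R | side_at q.2 p.2 < p.1]) `&`
  \bigcap_w ~` (open_triangle (kind b w) (subquad b q w)).
  apply/seteqP; split=> p.
    move=> [[/andP [y0 y1] /andP [h1 h2]] ht]; split=> [|w _]; last exact: ht.
    by split; split=> //=; apply/negP; rewrite -leNgt.
  move=> [[[y0 y1] [/= /negP h1 /negP h2]] ht]; split=> [|w]; last exact: ht.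
  by rewrite -!leNgt in h1 h2; split; apply/andP.
apply: closedI; first apply: closedI.
- by apply: closedI; [exact: (closed_height (@closed_ge _ 0))|exact: (closed_height (@closed_le _ 1))].
- by apply: closedI; apply: open_closedC; [exact: open_left_of|exact: open_right_of].
- apply: closed_bigI => w _; apply: open_closedC.
  rewrite (_ : open_triangle _ _ = [set p : R * R | side_at (left_leg (kind b w) (subquad b q w)) p.2 < p.1]
   `&` [set p : R * R | p.1 < side_at (right_leg (kind b w) (subquad b q w)) p.2]).
    by apply: openI; [exact: open_right_of|exact: open_left_of].
  by apply/seteqP; split=> p /andP.
Qed.

Lemma ball_plane p p' (e : R) : ball p e p' <-> `|p.1 - p'.1| < e /\ `|p.2 - p'.2| < e.
Proof. by split. Qed.

(** The right hand side is closed, and by [accordion_depth] each of its points is close to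
legs of arbitrarily late steps. *)
Lemma knaster_accordionE : knaster_accordion R = accordion false unit_quad.
Proof.
have wq := nondegenerate_unit_quad.
apply/seteqP; split.
- rewrite (closure_id (accordion false unit_quad)).1; last exact: closed_accordion.
  apply: closure_subset => p [n _ [a]]; rewrite drawnE => -[w _ <-] [s].
  rewrite legs_zigzag_of => hs [hy ps]; rewrite (_ : p = point_at s p.2); last first.
    by rewrite /point_at -ps -surjective_pairing.
  by case: hs => ->; [exact: acc_left_leg|exact: acc_right_leg].
- move=> p hp U /nbhs_ballP [e /= e0 hU].
  have hy := hp.1.1.
  have [n hn] := width_eventually false wq e0.
  have [w sw hw] := accordion_depth n wq hp.
  have := hn w p.2; rewrite sw leqnn => /(_ isT hy) W.
  set l := left_leg (kind false w) (subquad false unit_quad w).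
  exists (point_at l p.2); split.
    exists (size w).+1 => //; exists (zigzag_of (kind false w) (subquad false unit_quad w)).
      by rewrite drawnE; exists w => /=.
    by exists l; [rewrite legs_zigzag_of; left|split].
  apply: hU; apply/ball_plane; split => /=; last by rewrite subrr normr0.
  have [h1 h2 h3 h4 h5] := leg_gaps (kind false w) (nondegenerate_subquad false w wq) hy.
  have [_ /andP [h6 h7]] := hw.1.
  by move: W; rewrite /width ltr_norml => W; apply/andP; split; rewrite /l; lra.
Qed.

End Construction.

(** * Connectedness of the accordion *)

Section Connectedness.
Context {R : realType}.
Local Notation side := (@side R).
Implicit Types (b : bool) (q : side * side) (w u : seq bool) (s t : side) (y : R) (p : R * R).

Definition vertex b q : R * R := point_at (left_leg b q) b%:R.

Lemma vertexE b q : vertex b q = point_at (right_leg b q) b%:R.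
Proof. by rewrite /vertex /point_at leg_eq. Qed.

Lemma bool01 b : 0 <= (b%:R : R) <= 1.
Proof. by case: b; rewrite /= ?lexx ler01. Qed.

Lemma closed_near (A : set (R * R)) p : closed A ->
  (forall e : R, 0 < e -> exists p', [/\ A p', `|p.1 - p'.1| < e & `|p.2 - p'.2| < e]) ->
  A p.
Proof.
move=> cA hA; apply: cA => U /nbhs_ballP [e /= e0 hU].
have [p' [Ap' h1 h2]] := hA e e0; exists p'; split=> //.
by apply/hU/ball_plane.
Qed.

Lemma continuous_pt s : continuous (point_at s).
Proof.
move=> y; apply: (@cvg_pair _ _ _ (nbhs y) (nbhs (side_at s y)) (nbhs y)).
  exact: continuous_side_at.
exact: cvg_id.
Qed.

Lemma side_connected s : connected (point_at s @` `[0, 1]).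
Proof.
apply: connected_continuous_connected; first exact: segment_connected.
by apply: continuous_subspaceT; exact: continuous_pt.
Qed.

(** Each side of a quadrilateral is a uniform limit of legs drawn inside, from one
side only. *)
Lemma side_approx b q w (c : bool) (e : R) : nondegenerate q -> 0 < e ->
  exists t, forall y, 0 <= y <= 1 ->
    accordion (kind b w) (subquad b q w) (point_at t y) /\
    (if c then side_at (subquad b q w).2 y - e < side_at t y < side_at (subquad b q w).2 y
     else side_at (subquad b q w).1 y < side_at t y < side_at (subquad b q w).1 y + e).
Proof.
move=> wq e0; set q' := subquad b q w; set b' := kind b w.
have wq' : nondegenerate q' by exact: nondegenerate_subquad.
have [n hn] := width_eventually b' wq' e0.
exists (if c then (subquad b' q' (nseq n true)).1 else (subquad b' q' (nseq n false)).2).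
move=> y hy; case: c.
- split; first exact: acc_sub_left.
  have := hn (nseq n true) y; rewrite size_nseq => /(_ (leqnn _) hy).
  have := width_gt0 (nondegenerate_subquad b' (nseq n true) wq') hy.
  by rewrite /width subquad_nseq_true => h1 h2; apply/andP; split; lra.
- split; first exact: acc_sub_right.
  have := hn (nseq n false) y; rewrite size_nseq => /(_ (leqnn _) hy).
  have := width_gt0 (nondegenerate_subquad b' (nseq n false) wq') hy.
  by rewrite /width subquad_nseq_false => h1 h2; apply/andP; split; lra.
Qed.

(** If the two sides of a quadrilateral have different colors, so have those of one
of its two parts, because the two legs of a zigzag have equal colors.  The
quadrilaterals obtained in this way shrink to a segment, which contradicts the
local constancy of the coloring at its point of height [y]. *)
Lemma nested_color b q (k : side -> bool) y : nondegenerate q -> 0 <= y <= 1 ->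
  (forall w, k (left_leg (kind b w) (subquad b q w)) = k (right_leg (kind b w) (subquad b q w))) ->
  (forall z, accordion b q (z, y) -> exists2 e : R, 0 < e & forall w,
     `|side_at (subquad b q w).1 y - z| < e -> `|side_at (subquad b q w).2 y - z| < e ->
     k (subquad b q w).1 = k (subquad b q w).2) ->
  forall w, k (subquad b q w).1 = k (subquad b q w).2.
Proof.
move=> wq hy kleg kloc w0; apply: contrapT => /eqP bad.
pose next w := rcons w (k (subquad b q w).1 == k (left_leg (kind b w) (subquad b q w))).
pose W n := iter n next w0.
pose l n := side_at (subquad b q (W n)).1 y; pose r n := side_at (subquad b q (W n)).2 y.
have badW n : k (subquad b q (W n)).1 != k (subquad b q (W n)).2.
  elim: n => [|n IH] //=; rewrite -/(W n) subquad_rcons.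
  have [h|//] := eqVneq (k (subquad b q (W n)).1) (k (left_leg (kind b (W n)) (subquad b q (W n)))).
  by rewrite /= -kleg -h.
have sizeW n : (n <= size (W n))%N.
  by elim: n => [|n IH] //=; rewrite size_rcons ltnS.
have step n : l n <= l n.+1 /\ r n.+1 <= r n.
  rewrite /l /r /= subquad_rcons; apply: child_le hy; exact: nondegenerate_subquad.
have lr n : l n < r n.
  by have := width_gt0 (nondegenerate_subquad b (W n) wq) hy; rewrite /width subr_gt0.
have lmono m n : (m <= n)%N -> l m <= l n.
  by move=> /subnKC <-; elim: (n - m)%N => [|k' IH]; rewrite ?addn0 // addnS;
    apply: le_trans IH (step _).1.
have rmono m n : (m <= n)%N -> r n <= r m.
  by move=> /subnKC <-; elim: (n - m)%N => [|k' IH]; rewrite ?addn0 // addnS;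
    apply: le_trans (step _).2 IH.
have lrmn m n : l m <= r n.
  have h1 := lmono _ _ (leq_maxl m n); have h2 := rmono _ _ (leq_maxr m n).
  by apply: le_trans h1 _; apply: le_trans h2; exact: ltW.
pose z := sup (range l).
have hs : has_sup (range l).
  by split; [exists (l 0%N); exists 0%N|exists (r 0%N) => _ [n _ <-]].
have lz n : l n <= z by apply: (sup_upper_bound hs); exists n.
have zr n : z <= r n.
  by apply: sup_le_ub; [exists (l 0%N); exists 0%N|move=> _ [m _ <-]].
have small e : 0 < e -> exists n, r n - l n < e.
  move=> e0; have [n hn] := width_eventually b wq e0.
  by exists n; exact: hn (sizeW n) hy.
have accz : accordion b q (z, y).
  apply: (@closed_near (accordion b q)) => [|e /small [n hn]]; first exact: closed_accordion.
  exists (point_at (subquad b q (W n)).1 y); split => /=.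
  - exact: acc_sub_left.
  - rewrite -/(l n) ger0_norm ?subr_ge0 //; have := zr n; lra.
  - by rewrite subrr normr0; have := lr n; lra.
have [e e0 he] := kloc z accz; have [n hn] := small e e0.
have := he (W n); rewrite -/(l n) -/(r n) => heq.
have := badW n; rewrite heq ?eqxx //.
- by rewrite distrC ger0_norm ?subr_ge0 //; have := zr n; lra.
- by rewrite ger0_norm ?subr_ge0 //; have := lz n; lra.
Qed.

Lemma nested_color_all b q (k : side -> bool) y : nondegenerate q -> 0 <= y <= 1 ->
  (forall w, k (left_leg (kind b w) (subquad b q w)) = k (right_leg (kind b w) (subquad b q w))) ->
  (forall z, accordion b q (z, y) -> exists2 e : R, 0 < e & forall w,
     `|side_at (subquad b q w).1 y - z| < e -> `|side_at (subquad b q w).2 y - z| < e ->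
     k (subquad b q w).1 = k (subquad b q w).2) ->
  forall w, k (subquad b q w).1 = k q.1 /\ k (subquad b q w).2 = k q.1.
Proof.
move=> wq hy kleg kloc; have H := nested_color wq hy kleg kloc.
elim/last_ind => [|w c [IH1 IH2]]; first by have := H [::].
have := H (rcons w c); rewrite subquad_rcons; case: c => /=.
- by rewrite IH2 => ->.
- by rewrite IH1 => <-.
Qed.

(** A clopen subset of the accordion without [p] contains each side, except [p],
entirely or not at all: either the side is connected, or it contains [p] and is
the limit of sides that do not.  So it colors the sides, and [nested_color_all]
applies at a height different from that of [p], the legs of one zigzag being
connected by their vertex.  At last the sides are dense. *)
Lemma accordion_connected b q p : nondegenerate q ->
  (forall w, p <> vertex (kind b w) (subquad b q w)) -> connected (accordion b q `\` [set p]).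
Proof.
move=> wq hp B [a Ba] [C oC BC] [D cD BD].
set X := accordion b q `\` [set p] in BC BD *.
have BX : B `<=` X by rewrite BC => x [].
have near_in x : B x -> exists2 e : R, 0 < e & forall x', X x' ->
    `|x.1 - x'.1| < e -> `|x.2 - x'.2| < e -> B x'.
  rewrite {1}BC => -[Xx Cx].
  have /nbhs_ballP [e /= e0 he] := open_nbhs_nbhs (conj oC Cx).
  exists e => // x' Xx' h1 h2; rewrite BC; split=> //.
  by apply/he/ball_plane.
have near_out x : X x -> ~ B x -> exists2 e : R, 0 < e & forall x', X x' ->
    `|x.1 - x'.1| < e -> `|x.2 - x'.2| < e -> ~ B x'.
  move=> Xx; rewrite {1}BD => nDx.
  have {}nDx : (~` D) x by move=> Dx; apply: nDx.
  have /nbhs_ballP [e /= e0 he] := open_nbhs_nbhs (conj (closed_openC cD) nDx).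
  exists e => // x' Xx' h1 h2; rewrite BD => -[_ Dx'].
  by apply: (he x') => //; apply/ball_plane.
have whole t : (forall y, 0 <= y <= 1 -> accordion b q (point_at t y) /\ point_at t y <> p) ->
    forall y0 y1, 0 <= y0 <= 1 -> 0 <= y1 <= 1 -> B (point_at t y0) -> B (point_at t y1).
  move=> ht y0 y1 hy0 hy1 B0.
  pose S := point_at t @` `[0, 1].
  have SX : S `<=` X.
    move=> x [y /=]; rewrite in_itv /= => hy <-; have [] := ht y hy.
    by move=> h1 h2; split.
  have E : B `&` S = S.
    apply: (@side_connected t).
    - by exists (point_at t y0); split=> //; exists y0 => //=; rewrite in_itv.
    - exists C => //; rewrite {1}BC; apply/seteqP; split=> x; first by case=> -[].
      by case=> Sx Cx; split=> //; split=> //; exact: SX.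
    - exists D => //; rewrite {1}BD; apply/seteqP; split=> x; first by case=> -[].
      by case=> Sx Dx; split=> //; split=> //; exact: SX.
  have : S (point_at t y1) by exists y1 => //=; rewrite in_itv.
  by rewrite -E => -[].
pose S w (c : bool) := if c then (subquad b q w).2 else (subquad b q w).1.
have accS w c y : 0 <= y <= 1 -> accordion b q (point_at (S w c) y).
  by move=> hy; case: c; [exact: acc_sub_right|exact: acc_sub_left].
have mono w c y0 y1 : 0 <= y0 <= 1 -> 0 <= y1 <= 1 ->
    B (point_at (S w c) y0) -> point_at (S w c) y1 <> p -> B (point_at (S w c) y1).
  move=> hy0 hy1 B0 np1.
  have [[yp [hyp Ep]]|np] := pselect (exists y, 0 <= y <= 1 /\ point_at (S w c) y = p); last first.
    apply: (whole _ _ y0) => // y hy; split; first exact: accS.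
    by move=> E; apply: np; exists y.
  apply: contrapT => nB1.
  have [e0 e0_gt0 h0] := near_in _ B0.
  have [e1 e1_gt0 h1] := near_out _ (conj (accS w c _ hy1) np1) nB1.
  have e01 : 0 < Num.min e0 e1 by rewrite lt_min e0_gt0.
  have [t ht] := side_approx b w c wq e01.
  have {}ht y : 0 <= y <= 1 -> [/\ X (point_at t y), `|side_at (S w c) y - side_at t y| < e0
      & `|side_at (S w c) y - side_at t y| < e1].
    move=> hy; have [at_ lt_] := ht y hy.
    have ne : side_at t y != side_at (S w c) y.
      by rewrite /S; move: lt_; case: (c) => /andP [h2 h3]; [rewrite lt_eqF|rewrite gt_eqF].
    have : `|side_at (S w c) y - side_at t y| < Num.min e0 e1.
      by move: lt_; rewrite ltr_norml /S; case: (c) => /andP [? ?]; apply/andP; split; lra.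
    rewrite lt_min => /andP [? ?]; split=> //; split; first exact: accordion_sub at_.
    move=> E; move: ne; rewrite -Ep in E; case: E => + yE; rewrite yE => ->.
    by rewrite eqxx.
  have [t0X t0 _] := ht y0 hy0; have [t1X _ t1] := ht y1 hy1.
  apply: (h1 (point_at t y1)) => //=; first by rewrite subrr normr0.
  apply: (whole t _ y0) => // [y hy|]; first by have [[? ?] _ _] := ht y hy.
  by apply: h0 => //=; rewrite subrr normr0.
pose k s := `[< exists2 y, 0 <= y <= 1 & B (point_at s y) >].
have kE w c y : 0 <= y <= 1 -> point_at (S w c) y <> p -> k (S w c) <-> B (point_at (S w c) y).
  move=> hy np; split; first by move=> /asboolP [y0 hy0 B0]; exact: mono hy0 hy B0 np.
  by move=> By; apply/asboolP; exists y.
(* at height [y] all points of sides differ from [p] *)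
have [y hy ny] : exists2 y, 0 <= y <= 1 & y != p.2.
  have [E|N] := eqVneq p.2 0; last by exists 0; rewrite ?lexx ?ler01 // eq_sym.
  by exists 1; rewrite ?lexx ?ler01 // E oner_eq0.
have nyp s : point_at s y <> p by move=> E; move: ny; rewrite -E eqxx.
have kleg w : k (left_leg (kind b w) (subquad b q w)) = k (right_leg (kind b w) (subquad b q w)).
  have L : left_leg (kind b w) (subquad b q w) = S (rcons w false) true.
    by rewrite /S subquad_rcons.
  have Rr : right_leg (kind b w) (subquad b q w) = S (rcons w true) false.
    by rewrite /S subquad_rcons.
  have hv := bool01 (kind b w).
  have EL : point_at (S (rcons w false) true) (kind b w)%:R = vertex (kind b w) (subquad b q w).
    by rewrite -L.
  have ER : point_at (S (rcons w true) false) (kind b w)%:R = vertex (kind b w) (subquad b q w).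
    by rewrite -Rr vertexE.
  have nv : vertex (kind b w) (subquad b q w) <> p by move=> E; apply: (hp w).
  have kL := kE (rcons w false) true _ hv; rewrite EL in kL.
  have kR := kE (rcons w true) false _ hv; rewrite ER in kR.
  have {}kL := kL nv; have {}kR := kR nv.
  by rewrite L Rr; apply/idP/idP => [/kL /kR|/kR /kL].
have kloc z : accordion b q (z, y) -> exists2 e : R, 0 < e & forall w,
     `|side_at (subquad b q w).1 y - z| < e -> `|side_at (subquad b q w).2 y - z| < e ->
     k (subquad b q w).1 = k (subquad b q w).2.
  move=> az; have Xz : X (z, y) by split=> // E; move: ny; rewrite -E eqxx.
  have Xw w c : X (point_at (S w c) y) by split; [exact: accS|exact: nyp].
  have [Bz|nBz] := pselect (B (z, y)).
  - have [e e0 he] := near_in _ Bz; exists e => // w h1 h2.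
    have -> : k (subquad b q w).1 = true.
      apply/(kE w false y hy (nyp _))/he => /=; first exact: (Xw w false).
        by rewrite distrC.
      by rewrite subrr normr0.
    apply/esym/(kE w true y hy (nyp _))/he => /=; first exact: (Xw w true).
      by rewrite distrC.
    by rewrite subrr normr0.
  - have [e e0 he] := near_out _ Xz nBz; exists e => // w h1 h2.
    have -> : k (subquad b q w).1 = false.
      apply/negP => /(kE w false y hy (nyp _)); apply: he => /=; first exact: (Xw w false).
        by rewrite distrC.
      by rewrite subrr normr0.
    apply/esym/negP => /(kE w true y hy (nyp _)); apply: he => /=; first exact: (Xw w true).
      by rewrite distrC.
    by rewrite subrr normr0.
have kall := nested_color_all wq hy kleg kloc.
have dense x (e : R) : X x -> 0 < e -> exists w c,
    [/\ X (point_at (S w c) x.2) & `|x.1 - side_at (S w c) x.2| < e].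
  move=> [ax nx] e0; have [n hn] := width_eventually b wq e0.
  have [w sw aw] := accordion_depth n wq ax.
  have hx := ax.1.1; have := hn w x.2; rewrite sw => /(_ (leqnn _) hx) W.
  have W0 := width_gt0 (nondegenerate_subquad b w wq) hx.
  have [_ /andP [h1 h2]] := aw.1.
  have [E|N] := pselect (point_at (S w false) x.2 = p); last first.
    exists w, false; split; first by split=> //; exact: accS.
    by rewrite /S ger0_norm ?subr_ge0 //; move: W; rewrite /width; lra.
  exists w, true; split.
    split=> [|E']; first exact: accS.
    have [] : point_at (S w true) x.2 = point_at (S w false) x.2 by rewrite E' E.
    by move: W0; rewrite /width /S => + e1; rewrite e1 subrr ltxx.
  by rewrite /S ler0_norm ?subr_le0 //; move: W; rewrite /width; lra.
have kSall w c : k (S w c) = k q.1 by rewrite /S; case: c; have [? ?] := kall w.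
have ktrue : k q.1.
  have [e e0 he] := near_in _ Ba; have [w [c [Xs hs]]] := dense _ _ (BX _ Ba) e0.
  rewrite -(kSall w c); apply/(kE w c a.2); first by have [[[]]] := BX _ Ba.
    by case: Xs => _ h E; apply: h.
  by apply: he => //=; rewrite subrr normr0.
apply/seteqP; split=> // x Xx; apply: contrapT => nBx.
have [e e0 he] := near_out _ Xx nBx; have [w [c [Xs hs]]] := dense _ _ Xx e0.
apply: (he (point_at (S w c) x.2)) => //=; first by rewrite subrr normr0.
apply/(kE w c x.2); [by have [[[]]] := Xx|by case: Xs => _ h E; apply: h|].
by rewrite kSall.
Qed.



End Connectedness.

(** * Vertices and their legs in terms of connected sets *)

Section Intrinsic.
Context {R : realType}.
Local Notation side := (@side R).
Implicit Types (b : bool) (q : side * side) (w u : seq bool) (s t : side) (y : R)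
  (p x : R * R) (X : set (R * R)).

(** [p] and [p'] are in one component of the complement of [x], stated in a form that
is obviously carried along by homeomorphisms. *)
Definition linked X x p p' : Prop :=
  exists C : set (R * R), [/\ connected C, C `<=` X, ~ C x, C p & C p'].

(** At a vertex these are the two legs, see [layer_vertex], which are thereby
recovered from the topology. *)
Definition layer X p : set (R * R) :=
  [set p' | X p' /\ forall x, X x -> x <> p' -> x <> p -> linked X x p' p].

Definition cut X x : Prop :=
  exists p p', [/\ X p, X p', p <> x, p' <> x & ~ linked X x p p'].

Lemma linkedC X x p p' : linked X x p p' -> linked X x p' p.
Proof. by move=> [C [? ? ? ? ?]]; exists C. Qed.

Definition median b q : side :=
  Side ((bot (left_leg b q) + bot (right_leg b q)) / 2)
       ((top (left_leg b q) + top (right_leg b q)) / 2).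

Lemma medianE b q y :
  side_at (median b q) y = (side_at (left_leg b q) y + side_at (right_leg b q) y) / 2.
Proof. by rewrite /median /side_at /=; lra. Qed.

(** The line in the middle between the legs meets the accordion at the vertex only, so a
connected subset without the vertex stays on one side of it. *)
Lemma not_linked b q w p p' : nondegenerate q ->
  p.1 < side_at (median (kind b w) (subquad b q w)) p.2 ->
  side_at (median (kind b w) (subquad b q w)) p'.2 < p'.1 ->
  ~ linked (accordion b q) (vertex (kind b w) (subquad b q w)) p p'.
Proof.
move=> wq; set m := median _ _; set v := vertex _ _ => hp hp' [C [cC CX nv Cp Cp']].
pose f := fun x : R * R => x.1 - side_at m x.2.
have cf : connected (f @` C).
  by apply: connected_continuous_connected => //; apply/continuous_subspaceT/continuous_offset.
have [c Cc c0] : (f @` C) 0.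
  move/connected_intervalP: cf => /(_ (f p) (f p')); apply; [by exists p|by exists p'|].
  by rewrite /f; apply/andP; split; lra.
have [[hy _] ht] := CX c Cc.
have c1 : c.1 = side_at m c.2 by move: c0; rewrite /f; lra.
have [E|N] := eqVneq c.2 (kind b w)%:R.
  apply: nv; rewrite (_ : v = c) // /v /vertex /point_at -E (surjective_pairing c); congr pair => //=.
  by rewrite c1 medianE; have := leg_eq (kind b w) (subquad b q w); rewrite -E; lra.
have := leg_lt (nondegenerate_subquad b w wq) hy N => lt.
by apply: (ht w); rewrite /open_triangle /= c1 medianE; apply/andP; split; lra.
Qed.

Lemma side_not_vertex b q u y (c : bool) : nondegenerate q -> 0 <= y <= 1 ->
  point_at (if c then q.2 else q.1) y <> vertex (kind b u) (subquad b q u).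
Proof.
move=> wq hy E; have Ey : y = (kind b u)%:R by case: E.
have [h1 h2] := subquad_le b u wq hy.
have [h3 h4 h5 _ _] := leg_gaps (kind b u) (nondegenerate_subquad b u wq) hy.
by case: E => + _; rewrite -Ey; case: c => E; rewrite E in h1 h2; lra.
Qed.

Definition zig_points b q : set (R * R) :=
  [set p | exists2 y : R, 0 <= y <= 1 & p = point_at (left_leg b q) y \/ p = point_at (right_leg b q) y].

Lemma acc_zig_points b q w p : nondegenerate q -> zig_points (kind b w) (subquad b q w) p -> accordion b q p.
Proof. by move=> wq [y hy [->|->]]; [exact: acc_left_leg|exact: acc_right_leg]. Qed.

Lemma accordion_vertex b q w : nondegenerate q -> accordion b q (vertex (kind b w) (subquad b q w)).
Proof. by move=> wq; apply: acc_left_leg => //; exact: bool01. Qed.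

(** If [x] lies on the side it is no vertex of the accordion bounded by this side, from
which it can be removed by [accordion_connected]. *)
Lemma linked_side b q u (c : bool) y y' x : nondegenerate q -> 0 <= y <= 1 -> 0 <= y' <= 1 ->
  let s := if c then (subquad b q u).2 else (subquad b q u).1 in
  x <> point_at s y -> x <> point_at s y' -> linked (accordion b q) x (point_at s y) (point_at s y').
Proof.
move=> wq hy hy' s nx nx'.
have sacc z : 0 <= z <= 1 -> accordion (kind b u) (subquad b q u) (point_at s z).
  by move=> hz; rewrite /s; case: c {s nx nx'}; [apply: acc_right|apply: acc_left];
    rewrite ?hz //; exact: nondegenerate_subquad.
have [[z hz E]|nz] := pselect (exists2 z, 0 <= z <= 1 & x = point_at s z).
- exists (accordion (kind b u) (subquad b q u) `\` [set x]); split.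
  + apply: accordion_connected; first exact: nondegenerate_subquad.
    by move=> w; rewrite E; apply: side_not_vertex => //; exact: nondegenerate_subquad.
  + by move=> p [/(accordion_sub wq)].
  + by move=> [_]; apply.
  + by split; [exact: sacc|exact/nesym].
  + by split; [exact: sacc|exact/nesym].
- exists (point_at s @` `[0, 1]); split; first exact: side_connected.
  + by move=> p [z /=]; rewrite in_itv /= => hz <-; exact/(accordion_sub wq)/sacc.
  + by move=> [z /=]; rewrite in_itv /= => hz E; apply: nz; exists z.
  + by exists y => //=; rewrite in_itv.
  + by exists y' => //=; rewrite in_itv.
Qed.

(** A point outside of the legs is separated from the vertex by the vertex of a
small zigzag close to the leg that it sees. *)
Lemma layer_vertex b q w : nondegenerate q ->
  layer (accordion b q) (vertex (kind b w) (subquad b q w)) = zig_points (kind b w) (subquad b q w).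
Proof.
move=> wq; have wqw := nondegenerate_subquad b w wq.
set v := vertex _ _; set b' := kind b w; set q' := subquad b q w.
apply/seteqP; split=> p; last first.
  move=> hp; split; first exact: (acc_zig_points wq hp).
  case: hp => y hy [E|E] x _ nxp nxv; rewrite E.
  - have := @linked_side b q (rcons w false) true y b'%:R x wq hy (bool01 b').
    by rewrite subquad_rcons; apply; rewrite /= -?E.
  - have := @linked_side b q (rcons w true) false y b'%:R x wq hy (bool01 b').
    by rewrite subquad_rcons /= /v vertexE; apply; rewrite -?E // -vertexE.
move=> [ap lp]; apply: contrapT => np; have hy := ap.1.1.
have [lt|gt] : p.1 < side_at (left_leg b' q') p.2 \/ side_at (right_leg b' q') p.2 < p.1.
  have [?|h1] := ltP p.1 (side_at (left_leg b' q') p.2); first by left.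
  have [?|h2] := ltP (side_at (right_leg b' q') p.2) p.1; first by right.
  exfalso; have := ap.2 w; rewrite /open_triangle /= => /negP; rewrite negb_and -!leNgt => /orP [h|h];
  apply: np; exists p.2 => //; [left|right]; rewrite [LHS]surjective_pairing;
  by congr pair => //; apply/eqP; rewrite eq_le; apply/andP; split.
- (* quadrilaterals that shrink to the left leg, from its left *)
  pose u := rcons w false.
  have uE : subquad b q u = (q'.1, left_leg b' q') by rewrite subquad_rcons.
  have [n hn] := @width_eventually _ (kind b u) (subquad b q u)
    (side_at (left_leg b' q') p.2 - p.1) (nondegenerate_subquad b u wq) ltac:(by rewrite subr_gt0).
  have := hn (nseq n true) p.2; rewrite size_nseq => /(_ (leqnn _) hy).
  rewrite /width subquad_nseq_true -subquad_cat uE /=; set u' := u ++ _ => hl.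
  have lt' : p.1 < side_at (subquad b q u').1 p.2 by lra.
  have r' : (subquad b q u').2 = left_leg b' q' by rewrite subquad_cat subquad_nseq_true uE.
  have wu' := nondegenerate_subquad b u' wq.
  have [h1 h2 h3 _ _] := leg_gaps (kind b u') wu' hy.
  have [g1 g2 g3 _ _] := leg_gaps (kind b u') wu' (bool01 b').
  rewrite r' in g3.
  apply: (@not_linked b q u' p v) => //; rewrite ?medianE /=; try lra.
  apply: lp; first exact: accordion_vertex.
  + move=> E; have [E1 E2] : p.1 = (vertex (kind b u') (subquad b q u')).1 /\
      p.2 = (vertex (kind b u') (subquad b q u')).2 by rewrite E.
    by move: E1 E2; rewrite /vertex /= => E1 E2; move: h1 lt'; rewrite E2 -E1 => *; lra.
  + move=> E.
    have := @side_not_vertex (kind b u') (subquad b q u') [::] b'%:R true wu' (bool01 b').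
    by rewrite /kind addbF /= r' => /(_ (esym E)).
- (* quadrilaterals that shrink to the right leg, from its right *)
  pose u := rcons w true.
  have uE : subquad b q u = (right_leg b' q', q'.2) by rewrite subquad_rcons.
  have [n hn] := @width_eventually _ (kind b u) (subquad b q u)
    (p.1 - side_at (right_leg b' q') p.2) (nondegenerate_subquad b u wq) ltac:(by rewrite subr_gt0).
  have := hn (nseq n false) p.2; rewrite size_nseq => /(_ (leqnn _) hy).
  rewrite /width subquad_nseq_false -subquad_cat uE /=; set u' := u ++ _ => hl.
  have gt' : side_at (subquad b q u').2 p.2 < p.1 by lra.
  have l' : (subquad b q u').1 = right_leg b' q' by rewrite subquad_cat subquad_nseq_false uE.
  have wu' := nondegenerate_subquad b u' wq.
  have [h1 h2 h3 _ _] := leg_gaps (kind b u') wu' hy.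
  have [g1 g2 g3 _ _] := leg_gaps (kind b u') wu' (bool01 b').
  rewrite l' in g1.
  have vE : v = point_at (right_leg b' q') b'%:R by rewrite /v vertexE.
  apply: (@not_linked b q u' v p) => //; rewrite ?medianE ?vE /=; try lra.
  apply: linkedC; rewrite -vE; apply: lp; first exact: accordion_vertex.
  + move=> E; have [E1 E2] : p.1 = (vertex (kind b u') (subquad b q u')).1 /\
      p.2 = (vertex (kind b u') (subquad b q u')).2 by rewrite E.
    move: E1 E2; rewrite vertexE /= => E1 E2.
    by move: h3 gt'; rewrite E2 -E1 => *; lra.
  + move=> E; have := @side_not_vertex (kind b u') (subquad b q u') [::] b'%:R false wu' (bool01 b').
    by rewrite /kind addbF /= l' -vE => /(_ (esym E)).
Qed.

Lemma cut_accordionP b q x : nondegenerate q -> accordion b q x ->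
  cut (accordion b q) x <-> exists w, x = vertex (kind b w) (subquad b q w).
Proof.
move=> wq ax; split.
- move=> [p [p' [ap ap' np np' nl]]]; apply: contrapT => nv; apply: nl.
  exists (accordion b q `\` [set x]); split; [|by move=> ? []|by move=> [_]; apply|by []|by []].
  by apply: accordion_connected => // w E; apply: nv; exists w.
- move=> [w ->]; set b' := kind b w; set q' := subquad b q w.
  have hy : 0 <= ((~~ b')%:R : R) <= 1 by exact: bool01.
  have nb : (~~ b')%:R != b'%:R :> R by case: (b'); rewrite /= ?oner_eq0 // eq_sym oner_eq0.
  have lt := leg_lt (nondegenerate_subquad b w wq) hy nb.
  exists (point_at (left_leg b' q') (~~ b')%:R), (point_at (right_leg b' q') (~~ b')%:R); split.
  + exact: acc_left_leg.
  + exact: acc_right_leg.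
  + by case=> _ /eqP; exact/negP.
  + by case=> _ /eqP; exact/negP.
  + by apply: not_linked; rewrite ?medianE //=; lra.
Qed.

End Intrinsic.

(** * Mirroring a quadrilateral with two opposite corners fixed *)

Section Mirror.
Context {R : realType}.
Local Notation side := (@side R).
Implicit Types (e : bool) (q : side * side) (s : side) (x y t d : R) (p : R * R).

Lemma continuous_pair (T : topologicalType) (f g : T -> R) :
  continuous f -> continuous g -> continuous (fun z => (f z, g z)).
Proof.
move=> cf cg z; apply: (@cvg_pair _ _ _ (nbhs z) (nbhs (f z)) (nbhs (g z))).
  exact: cf.
exact: cg.
Qed.

Definition clamp y : R := Num.max 0 (Num.min 1 y).

Lemma clamp01 y : 0 <= clamp y <= 1.
Proof. by rewrite /clamp; apply/andP; split; rewrite ?le_max ?lexx // ge_max ler01 ge_min lexx. Qed.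

Lemma clamp_id y : 0 <= y <= 1 -> clamp y = y.
Proof. by move=> /andP [h0 h1]; rewrite /clamp min_r // max_r. Qed.

Lemma continuous_clamp : continuous clamp.
Proof.
move=> y; apply: (@continuous_max _ _ (fun=> 0) (fun y => Num.min 1 y)).
  exact: cvg_cst.
apply: (@continuous_min _ _ (fun=> 1) id).
  exact: cvg_cst.
exact: cvg_id.
Qed.

(** Heights are clamped to the unit interval, so that the charts of a nondegenerate
quadrilateral are homeomorphisms of the whole plane. *)
Definition chart q p : R * R :=
  ((p.1 - side_at q.1 (clamp p.2)) / width q (clamp p.2), p.2).

Definition unchart q p : R * R :=
  (side_at q.1 (clamp p.2) + p.1 * width q (clamp p.2), p.2).

Arguments chart : simpl never.
Arguments unchart : simpl never.

Lemma width_clamp q y : nondegenerate q -> 0 < width q (clamp y).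
Proof. by move=> wq; apply: width_gt0 wq (clamp01 y). Qed.

Lemma chartK q : nondegenerate q -> cancel (chart q) (unchart q).
Proof.
move=> wq [x y]; rewrite /unchart /chart /= divfK ?subrKC //.
by rewrite gt_eqF // width_clamp.
Qed.

Lemma unchartK q : nondegenerate q -> cancel (unchart q) (chart q).
Proof.
move=> wq [x y]; rewrite /unchart /chart /= addrAC subrr add0r mulfK //.
by rewrite gt_eqF // width_clamp.
Qed.

Lemma continuous_side_clamp s : continuous (fun p : R * R => side_at s (clamp p.2)).
Proof.
move=> p; apply: (@continuous_comp _ _ _ snd (fun y => side_at s (clamp y))).
  exact: cvg_snd.
apply: (@continuous_comp _ _ _ clamp (side_at s)).
  exact: continuous_clamp.
exact: continuous_side_at.
Qed.

Lemma continuous_width_clamp q : continuous (fun p : R * R => width q (clamp p.2)).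
Proof.
by move=> p; apply: cvgB; exact: continuous_side_clamp.
Qed.

Lemma continuous_chart q : nondegenerate q -> continuous (chart q).
Proof.
move=> wq; apply: continuous_pair; last by move=> p; exact: cvg_snd.
move=> p; apply: cvgM.
  by apply: cvgB; [exact: cvg_fst|exact: continuous_side_clamp].
apply: cvgV; last exact: continuous_width_clamp.
by rewrite gt_eqF // width_clamp.
Qed.

Lemma continuous_unchart q : continuous (unchart q).
Proof.
apply: continuous_pair; last by move=> p; exact: cvg_snd.
move=> p; apply: cvgD; first exact: continuous_side_clamp.
by apply: cvgM; [exact: cvg_fst|exact: continuous_width_clamp].
Qed.

Lemma chart2 q p : (chart q p).2 = p.2. Proof. by []. Qed.
Lemma unchart2 q p : (unchart q p).2 = p.2. Proof. by []. Qed.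

Lemma chart_val q p : nondegenerate q -> 0 <= p.2 <= 1 ->
  p.1 = side_at q.1 p.2 + (chart q p).1 * width q p.2.
Proof.
move=> wq hy; have := chartK wq p; rewrite /unchart chart2 clamp_id // => E.
by rewrite -[in LHS]E.
Qed.

Lemma chart_lt0 q p : nondegenerate q -> 0 <= p.2 <= 1 ->
  ((chart q p).1 < 0) = (p.1 < side_at q.1 p.2).
Proof.
move=> wq hy; rewrite [in RHS](chart_val wq hy) gtrDl [RHS]pmulr_llt0 //.
exact: width_gt0.
Qed.

Lemma chart_gt1 q p : nondegenerate q -> 0 <= p.2 <= 1 ->
  (1 < (chart q p).1) = (side_at q.2 p.2 < p.1).
Proof.
move=> wq hy; rewrite -subr_gt0 -[in RHS]subr_gt0 [in RHS](chart_val wq hy).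
rewrite (_ : side_at _ _ + _ - _ = ((chart q p).1 - 1) * width q p.2); last first.
  by rewrite /width; ring.
by rewrite [RHS]pmulr_lgt0 //; exact: width_gt0.
Qed.

Lemma quad_setE q p : nondegenerate q ->
  quad_set q.1 q.2 p <-> 0 <= p.2 <= 1 /\ 0 <= (chart q p).1 <= 1.
Proof.
move=> wq; split=> -[hy /andP [h1 h2]]; split=> //; apply/andP; split.
- by rewrite leNgt chart_lt0 // -leNgt.
- by rewrite leNgt chart_gt1 // -leNgt.
- by rewrite leNgt -chart_lt0 // -leNgt.
- by rewrite leNgt -chart_gt1 // -leNgt.
Qed.

Lemma chart_left q y : 0 <= y <= 1 -> chart q (point_at q.1 y) = (0, y).
Proof. by move=> hy; rewrite /chart /= clamp_id // subrr mul0r. Qed.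

Lemma chart_right q y : nondegenerate q -> 0 <= y <= 1 -> chart q (point_at q.2 y) = (1, y).
Proof.
move=> wq hy; rewrite /chart /= clamp_id // -/(width q y) divff //.
by rewrite gt_eqF // width_gt0.
Qed.

Definition flip e y : R := if e then 1 - y else y.

Lemma flipK e : involutive (flip e).
Proof. by rewrite /flip; case: e => // y; rewrite subKr. Qed.

Lemma flip01 e y : (0 <= flip e y <= 1) = (0 <= y <= 1).
Proof. by rewrite /flip; case: e => //; apply/idP/idP => /andP [? ?]; apply/andP; split; lra. Qed.

Lemma flip01_strict e y : (0 < flip e y < 1) = (0 < y < 1).
Proof. by rewrite /flip; case: e => //; apply/idP/idP => /andP [? ?]; apply/andP; split; lra. Qed.

Lemma flip_negl e y : flip (~~ e) y = 1 - flip e y.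
Proof. by rewrite /flip; case: e => //=; rewrite subKr. Qed.

Lemma clamp_beyond e y : flip e y < 0 -> clamp y = e%:R.
Proof.
rewrite /flip /clamp; case: e => h /=; first by rewrite min_l ?max_r ?ler01 //; lra.
by rewrite max_l // ge_min; apply/orP; right; lra.
Qed.

Lemma continuous_flip e : continuous (flip e).
Proof.
rewrite /flip; case: e => y; last exact: cvg_id.
by apply: cvgB; [exact: cvg_cst|exact: cvg_id].
Qed.

Lemma flip_bit e : flip e e%:R = 0.
Proof. by case: e; rewrite /flip /= ?subrr. Qed.

Lemma flip_negb e : flip e (~~ e)%:R = 1.
Proof. by case: e; rewrite /flip /= ?subr0. Qed.

Lemma flip0 e : flip e 0 = e%:R.
Proof. by case: e; rewrite /flip /= ?subr0. Qed.

Lemma flip1 e : flip e 1 = (~~ e)%:R.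
Proof. by case: e; rewrite /flip /= ?subrr. Qed.

(** The horizontal translation by this amount closes the gap that the tilting of the
square leaves on the left near the bottom and on the right near the top: it is
[t / d - 1] for [t <= d], and [1 - (1 - t) / d] for [t >= 1 - d], if [d <= 1 / 2]. *)
Definition shift_of d t : R := Num.max 0 (1 - (1 - t) / d) - Num.max 0 (1 - t / d).

Lemma continuous_shift_of d : continuous (shift_of d).
Proof.
move=> t; apply: cvgB.
- apply: (@continuous_max _ _ (fun=> 0) (fun t => 1 - (1 - t) / d)); first exact: cvg_cst.
  apply: cvgB; first exact: cvg_cst.
  by apply: cvgM; [apply: cvgB; [exact: cvg_cst|exact: cvg_id]|exact: cvg_cst].
- apply: (@continuous_max _ _ (fun=> 0) (fun t => 1 - t / d)); first exact: cvg_cst.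
  apply: cvgB; first exact: cvg_cst.
  by apply: cvgM; [exact: cvg_id|exact: cvg_cst].
Qed.

(** Tilting the reflected square makes room for its bottom edge on the left side and
for its top edge on the right side. *)
Definition tilt d p : R := (1 - d) * p.2 + d * p.1.

(** A reflection of the unit square into itself which fixes the corners [(0, 0)] and
[(1, 1)], for [e = false], and moves heights by at most [d]: it exchanges the
vertical sides except near their ends, the bottom edge goes to the lowest part of
the left side, and the top edge to the highest part of the right side.  For
[e = true] it is conjugated by the reflection of heights and fixes the other two
corners.  Composed of affine maps and a shear, it is a homeomorphism of the whole
plane. *)
Definition twist e d p : R * R :=
  let h := tilt d (p.1, flip e p.2) in (1 - p.1 + shift_of d h, flip e h).

Definition untwist e d p : R * R :=
  let s := 1 - p.1 + shift_of d (flip e p.2) in (s, flip e ((flip e p.2 - d * s) / (1 - d))).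

Lemma twistK e d : d < 1 -> cancel (twist e d) (untwist e d).
Proof.
move=> d1 [s y]; rewrite /twist /untwist /tilt /= flipK.
set h := _ + _ * s; rewrite (_ : 1 - _ + _ = s); last by ring.
rewrite (_ : (_ - _) / _ = flip e y) ?flipK // /h addrK mulrC mulKf //.
by rewrite subr_eq0 gt_eqF.
Qed.

Lemma untwistK e d : d < 1 -> cancel (untwist e d) (twist e d).
Proof.
move=> d1 [x y]; rewrite /twist /untwist /tilt /= flipK.
set s := 1 - x + _; rewrite (_ : _ * _ + _ = flip e y); last first.
  by rewrite mulrC divfK ?subrK // subr_eq0 gt_eqF.
by rewrite flipK; congr pair; rewrite /s; ring.
Qed.

Lemma continuous_twist e d : continuous (twist e d).
Proof.
have ch : continuous (fun p => tilt d (p.1, flip e p.2)).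
  move=> p; apply: cvgD; apply: cvgM; try exact: cvg_cst; last exact: cvg_fst.
  by apply: (@continuous_comp _ _ _ snd (flip e)); [exact: cvg_snd|exact: continuous_flip].
apply: continuous_pair => p; last first.
  by apply: (@continuous_comp _ _ _ (fun p => tilt d (p.1, flip e p.2)) (flip e)); [exact: ch|exact: continuous_flip].
apply: cvgD; first by apply: cvgB; [exact: cvg_cst|exact: cvg_fst].
by apply: (@continuous_comp _ _ _ (fun p => tilt d (p.1, flip e p.2)) (shift_of d)); [exact: ch|exact: continuous_shift_of].
Qed.

Lemma continuous_untwist e d : continuous (untwist e d).
Proof.
have cf : continuous (fun p : R * R => flip e p.2).
  by move=> p; apply: (@continuous_comp _ _ _ snd (flip e)); [exact: cvg_snd|exact: continuous_flip].
have cs : continuous (fun p : R * R => 1 - p.1 + shift_of d (flip e p.2)).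
  move=> p; apply: cvgD; first by apply: cvgB; [exact: cvg_cst|exact: cvg_fst].
  by apply: (@continuous_comp _ _ _ (fun p : R * R => flip e p.2) (shift_of d)); [exact: cf|exact: continuous_shift_of].
apply: continuous_pair => // p.
apply: (@continuous_comp _ _ _ (fun p : R * R => (flip e p.2 - d * (1 - p.1 + shift_of d (flip e p.2))) / (1 - d)) (flip e)); last exact: continuous_flip.
apply: cvgM; last exact: cvg_cst.
by apply: cvgB; [exact: cf|apply: cvgM; [exact: cvg_cst|exact: cs]].
Qed.

Definition mirror e d q : R * R -> R * R := unchart q \o twist e d \o chart q.
Definition unmirror e d q : R * R -> R * R := unchart q \o untwist e d \o chart q.

Lemma mirrorE e d q p : mirror e d q p = unchart q (twist e d (chart q p)).
Proof. by []. Qed.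

Lemma chart_mirror e d q p : nondegenerate q -> chart q (mirror e d q p) = twist e d (chart q p).
Proof. by move=> wq; rewrite /mirror -[RHS](unchartK wq). Qed.

Lemma mirrorK e d q : nondegenerate q -> d < 1 -> cancel (mirror e d q) (unmirror e d q).
Proof. by move=> wq d1 p; rewrite /mirror /unmirror /= unchartK // twistK // chartK. Qed.

Lemma unmirrorK e d q : nondegenerate q -> d < 1 -> cancel (unmirror e d q) (mirror e d q).
Proof. by move=> wq d1 p; rewrite /mirror /unmirror /= unchartK // untwistK // chartK. Qed.

Lemma continuous_mirror e d q : nondegenerate q -> continuous (mirror e d q).
Proof.
move=> wq p; apply: (@continuous_comp _ _ _ (chart q) (unchart q \o twist e d)).
  exact: continuous_chart.
by apply: continuous_comp; [exact: continuous_twist|exact: continuous_unchart].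
Qed.

Lemma continuous_unmirror e d q : nondegenerate q -> continuous (unmirror e d q).
Proof.
move=> wq p; apply: (@continuous_comp _ _ _ (chart q) (unchart q \o untwist e d)).
  exact: continuous_chart.
by apply: continuous_comp; [exact: continuous_untwist|exact: continuous_unchart].
Qed.

Lemma shift_low d t : 0 < d <= 1 / 2 -> t <= d -> shift_of d t = t / d - 1.
Proof.
move=> /andP [d0 d2] td; rewrite /shift_of max_l; last first.
  rewrite subr_le0 ler_pdivlMr //; lra.
rewrite max_r ?subr_ge0 ?ler_pdivrMr //; lra.
Qed.

Lemma shift_of1 d t : 0 < d -> shift_of d (1 - t) = - shift_of d t.
Proof. by move=> d0; rewrite /shift_of subKr opprB. Qed.

(** The inequalities on [h] say that the point stays between the slanted bottom and
top edges of the tilted square. *)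
Lemma shift_bounds d h (s : R) : 0 < d -> d * s <= h -> d * (1 - s) <= 1 - h ->
  0 <= s <= 1 -> 0 <= 1 - s + shift_of d h <= 1.
Proof.
move=> d0 hs hs' /andP [s0 s1]; rewrite /shift_of.
have u1 : s <= h / d by rewrite ler_pdivlMr // mulrC.
have u2 : 1 - s <= (1 - h) / d by rewrite ler_pdivlMr // mulrC.
by rewrite /Num.max; case: ltP => h1; case: ltP => h2; apply/andP; split; lra.
Qed.

Lemma tilt_bounds d p : 0 <= d -> d <= 1 -> 0 <= p.1 <= 1 -> 0 <= p.2 <= 1 ->
  [/\ d * p.1 <= tilt d p, d * (1 - p.1) <= 1 - tilt d p,
      0 <= tilt d p <= 1 & `|tilt d p - p.2| <= d].
Proof.
move=> d0 d1 /andP [s0 s1] /andP [y0 y1]; rewrite /tilt.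
have h1 : 0 <= d * p.1 by rewrite mulr_ge0.
have h2 : 0 <= (1 - d) * p.2 by rewrite mulr_ge0 ?subr_ge0.
have h3 : 0 <= d * (1 - p.1) by rewrite mulr_ge0 ?subr_ge0.
have h4 : 0 <= (1 - d) * (1 - p.2) by rewrite mulr_ge0 ?subr_ge0.
split; [lra|lra|apply/andP; split; lra|].
rewrite (_ : _ - _ = d * (p.1 - p.2)); last by ring.
rewrite normrM (ger0_norm d0) ler_piMr // ler_norml; apply/andP; split; lra.
Qed.

Lemma norm_flip e x y : `|flip e x - flip e y| = `|x - y|.
Proof.
by rewrite /flip; case: e => //; rewrite distrC; congr `|_|; ring.
Qed.

Lemma mirror_quad e d q p : nondegenerate q -> 0 < d <= 1 / 2 -> quad_set q.1 q.2 p ->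
  quad_set q.1 q.2 (mirror e d q p) /\ `|(mirror e d q p).2 - p.2| <= d.
Proof.
move=> wq /andP [d0 d2] /(quad_setE _ wq) [hy hs].
have hf : 0 <= flip e p.2 <= 1 by rewrite flip01.
have d1 : d <= 1 by lra.
have [t1 t2 t3 t4] := @tilt_bounds d ((chart q p).1, flip e p.2) (ltW d0) d1 hs hf.
have m2 : (mirror e d q p).2 = flip e (tilt d ((chart q p).1, flip e p.2)) by [].
split; last by move: t4; rewrite m2 -(norm_flip e) /= flipK.
apply/(quad_setE _ wq); split; first by rewrite m2 flip01.
rewrite chart_mirror //.
exact: shift_bounds.
Qed.

Lemma mirror_left e d q y : nondegenerate q -> 0 <= y <= 1 ->
  mirror e d q (point_at q.1 y) =
  unchart q (1 + shift_of d ((1 - d) * flip e y), flip e ((1 - d) * flip e y)).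
Proof.
by move=> wq hy; rewrite mirrorE chart_left // /twist /tilt /= mulr0 addr0 subr0.
Qed.

Lemma mirror_right e d q y : nondegenerate q -> 0 <= y <= 1 ->
  mirror e d q (point_at q.2 y) =
  unchart q (shift_of d ((1 - d) * flip e y + d), flip e ((1 - d) * flip e y + d)).
Proof.
by move=> wq hy; rewrite mirrorE chart_right // /twist /tilt /= mulr1 subrr add0r.
Qed.

Lemma mirror_left_corner e d q : nondegenerate q -> 0 < d <= 1 / 2 ->
  mirror e d q (point_at q.1 e%:R) = point_at q.1 e%:R.
Proof.
move=> wq hd; have d0 : 0 < d by case/andP: hd.
rewrite mirror_left ?bool01 // flip_bit mulr0 shift_low ?lexx ?(ltW d0) //.
rewrite mul0r add0r subrr /unchart /= flip0.
by rewrite clamp_id ?bool01 // mul0r addr0.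
Qed.

Lemma mirror_right_corner e d q : nondegenerate q -> 0 < d <= 1 / 2 ->
  mirror e d q (point_at q.2 (~~ e)%:R) = point_at q.2 (~~ e)%:R.
Proof.
move=> wq hd; have d0 : 0 < d by case/andP: hd.
rewrite mirror_right ?bool01 // flip_negb mulr1 subrK.
have -> : shift_of d 1 = 1.
  by have := shift_of1 0 d0; rewrite subr0 (@shift_low d 0) ?lexx ?(ltW d0) // mul0r => ->; ring.
rewrite /unchart /= flip1.
by rewrite clamp_id ?bool01 // mul1r /width addrC subrK.
Qed.

Lemma chart_ltr q x x' y : nondegenerate q -> x < x' -> (chart q (x, y)).1 < (chart q (x', y)).1.
Proof.
by move=> wq h; rewrite /chart /= ltr_pM2r ?invr_gt0 ?width_clamp // ltrD2r.
Qed.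

Lemma mirror2 e d q p : (mirror e d q p).2 = flip e (tilt d ((chart q p).1, flip e p.2)).
Proof. by []. Qed.

Lemma mirror1 e d q p : nondegenerate q ->
  (chart q (mirror e d q p)).1 =
  1 - (chart q p).1 + shift_of d (tilt d ((chart q p).1, flip e p.2)).
Proof. by move=> wq; rewrite chart_mirror. Qed.

(** The first coordinate of the inverse map, on which the side conditions below are
read off. *)
Lemma mirror_source e d q p : nondegenerate q ->
  (chart q p).1 =
  1 - (chart q (mirror e d q p)).1 + shift_of d (flip e (mirror e d q p).2).
Proof. by move=> wq; rewrite mirror1 // mirror2 flipK; ring. Qed.

(** Points further right would have to come from points to the left of the
quadrilateral, or would themselves lie to its right. *)
Lemma mirror_free_right e d q p : nondegenerate q -> 0 < d <= 1 / 2 -> quad_set q.1 q.2 p ->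
  p.1 = side_at q.1 p.2 \/ (flip e p.2 = 1 /\ p.1 < side_at q.2 p.2) ->
  (mirror e d q p).2 != (~~ e)%:R /\
  forall x p', (mirror e d q p).1 < x -> quad_set q.1 q.2 p' ->
    mirror e d q p' <> (x, (mirror e d q p).2).
Proof.
move=> wq hd hp hside; have /(quad_setE _ wq) [hy hs] := hp.
have /andP [d0 d2] := hd. have d1 : d < 1 by lra.
have hf : 0 <= flip e p.2 <= 1 by rewrite flip01.
have m1 := mirror1 e d p wq; have m2 := mirror2 e d q p.
set s := (chart q p).1 in m1 m2 hs; set h := tilt d _ in m1 m2.
have hcase : s = 0 \/ flip e p.2 = 1 /\ s < 1.
  case: hside => [E|[E lt]]; [left|right; split=> //].
    have := chart_left q hy; rewrite /point_at -E -surjective_pairing.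
    by rewrite /s => ->.
  rewrite lt_neqAle; case/andP: hs => _ ->; rewrite andbT; apply/eqP => E1.
  by move: lt; rewrite (chart_val wq hy) -/s E1 /width; lra.
have h1 : h < 1.
  rewrite /h /tilt /=; case: hcase => [->|[-> lt]].
    have : (1 - d) * flip e p.2 <= (1 - d) * 1.
      by apply: ler_wpM2l; [lra|case/andP: hf].
    by rewrite mulr0; lra.
  have : d * s < d * 1 by rewrite ltr_pM2l.
  lra.
split.
  by apply/eqP; rewrite m2 -flip1 => /(can_inj (flipK e)) E; move: h1; rewrite E ltxx.
move=> x p' lt hp' E.
have lt' : (chart q (mirror e d q p)).1 < (chart q (mirror e d q p')).1.
  by have := chart_ltr (mirror e d q p).2 wq lt; rewrite -surjective_pairing -E.
have /(quad_setE _ wq) [_ /andP [s0 _]] := hp'.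
have /(quad_setE _ wq) [_ /andP [_ X1]] := (mirror_quad e wq hd hp').1.
have E2 : (mirror e d q p').2 = flip e h by rewrite E m2.
have := mirror_source e d p' wq; rewrite E2 flipK => S'.
case: hcase => [s00|[f1 lts]]; first by rewrite m1 s00 in lt'; lra.
have hE : 1 - h = d * (1 - s) by rewrite /h /tilt /= f1; ring.
have : shift_of d h = s.
  have -> : h = 1 - d * (1 - s) by rewrite -hE; ring.
  case/andP: hs => s0' s1'.
  rewrite shift_of1 // shift_low //.
    by rewrite [d * _]mulrC mulfK ?gt_eqF //; ring.
  by rewrite ler_piMr; lra.
by move: lt'; rewrite m1; lra.
Qed.

(** Symmetric to [mirror_free_right] under the half turn, which commutes with [twist]. *)
Lemma mirror_free_left e d q p : nondegenerate q -> 0 < d <= 1 / 2 -> quad_set q.1 q.2 p ->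
  p.1 = side_at q.2 p.2 \/ (flip e p.2 = 0 /\ side_at q.1 p.2 < p.1) ->
  (mirror e d q p).2 != e%:R /\
  forall x p', x < (mirror e d q p).1 -> quad_set q.1 q.2 p' ->
    mirror e d q p' <> (x, (mirror e d q p).2).
Proof.
move=> wq hd hp hside; have /(quad_setE _ wq) [hy hs] := hp.
have /andP [d0 d2] := hd. have d1 : d < 1 by lra.
have hf : 0 <= flip e p.2 <= 1 by rewrite flip01.
have m1 := mirror1 e d p wq; have m2 := mirror2 e d q p.
set s := (chart q p).1 in m1 m2 hs; set h := tilt d _ in m1 m2.
have hcase : s = 1 \/ flip e p.2 = 0 /\ 0 < s.
  case: hside => [E|[E lt]]; [left|right; split=> //].
    have := chart_right wq hy; rewrite /point_at -E -surjective_pairing.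
    by rewrite /s => ->.
  rewrite lt_neqAle eq_sym; case/andP: hs => -> _; rewrite andbT; apply/eqP => E1.
  by move: lt; rewrite (chart_val wq hy) -/s E1 /width; lra.
have h1 : 0 < h.
  rewrite /h /tilt /=; case: hcase => [->|[-> lt]].
    have : 0 <= (1 - d) * flip e p.2.
      by apply: mulr_ge0; [lra|case/andP: hf].
    by rewrite mulr1; lra.
  have : 0 < d * s by apply: mulr_gt0.
  lra.
split.
  by apply/eqP; rewrite m2 -flip0 => /(can_inj (flipK e)) E; move: h1; rewrite E ltxx.
move=> x p' lt hp' E.
have lt' : (chart q (mirror e d q p')).1 < (chart q (mirror e d q p)).1.
  by have := chart_ltr (mirror e d q p).2 wq lt; rewrite -surjective_pairing -E.
have /(quad_setE _ wq) [_ /andP [_ s1]] := hp'.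
have /(quad_setE _ wq) [_ /andP [X0 _]] := (mirror_quad e wq hd hp').1.
have E2 : (mirror e d q p').2 = flip e h by rewrite E m2.
have := mirror_source e d p' wq; rewrite E2 flipK => S'.
case: hcase => [s00|[f1 lts]]; first by rewrite m1 s00 in lt'; lra.
have hE : h = d * s by rewrite /h /tilt /= f1; ring.
have : shift_of d h = s - 1.
  case/andP: hs => s0' s1'.
  rewrite shift_low //.
    by rewrite hE [d * _]mulrC mulfK ?gt_eqF.
  by rewrite hE ler_piMr; lra.
by move: lt'; rewrite m1; lra.
Qed.

End Mirror.

(** * The cells along the right edge, and gluing maps of cells *)

Section Spine.
Context {R : realType}.
Local Notation side := (@side R).
Implicit Types (k l n : nat) (y : R) (p z : R * R) (M : pred nat).

Local Notation K := (accordion false (@unit_quad R)).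

Definition spine k : side * side := subquad false unit_quad (nseq k true).

(** The [k]-th cell lies between the bends [k.-1] and [k]. *)
Definition cell k : side * side := child (odd k) (spine k) false.

Definition in_cell k : set (R * R) := quad_set (cell k).1 (cell k).2.

Definition bend k : R * R := vertex (odd k) (spine k).

Lemma kind_spine k : kind false (nseq k true) = odd k.
Proof. by rewrite /kind size_nseq. Qed.

Lemma spineS k : spine k.+1 = child (odd k) (spine k) true.
Proof. by rewrite /spine -addn1 nseqD cats1 subquad_rcons kind_spine. Qed.

Lemma nondegenerate_spine k : nondegenerate (spine k).
Proof. by apply: nondegenerate_subquad; exact: nondegenerate_unit_quad. Qed.

Lemma nondegenerate_cell k : nondegenerate (cell k).
Proof. by apply: nondegenerate_child; exact: nondegenerate_spine. Qed.

Lemma spine2 k : (spine k).2 = Side 1 1.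
Proof. by rewrite /spine subquad_nseq_true. Qed.

Lemma side_at11 y : side_at (Side 1 1) y = 1.
Proof. by rewrite /side_at /= !mulr1 subrK. Qed.

Lemma spine_left_lt k y : 0 <= y <= 1 -> side_at (spine k).1 y < side_at (spine k.+1).1 y.
Proof.
move=> hy; rewrite spineS /=; have [h1 h2 _ _ _] := leg_gaps (odd k) (nondegenerate_spine k) hy.
lra.
Qed.

Lemma spine_left_le k l y : 0 <= y <= 1 -> (k <= l)%N ->
  side_at (spine k).1 y <= side_at (spine l).1 y.
Proof.
move=> hy /subnKC <-; elim: (l - k)%N => [|n IH]; rewrite ?addn0 // addnS.
by apply: le_trans IH _; apply/ltW/spine_left_lt.
Qed.

Lemma cell1 k : (cell k).1 = (spine k).1. Proof. by []. Qed.
Lemma cell2 k : (cell k).2 = left_leg (odd k) (spine k). Proof. by []. Qed.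
Lemma spineS1 k : (spine k.+1).1 = right_leg (odd k) (spine k).
Proof. by rewrite spineS. Qed.

Lemma in_cell_far k l p : (k.+1 < l)%N -> in_cell k p -> ~ in_cell l p.
Proof.
move=> kl [hy /andP [_ h1]] [_ /andP [h2 _]].
have [_ g2 _ _ _] := leg_gaps (odd k) (nondegenerate_spine k) hy.
have := spine_left_lt k.+1 hy; have := spine_left_le hy kl.
by move: h1 h2; rewrite cell1 cell2 (spineS1 k); lra.
Qed.

(** Adjacent cells are not both mirrored, so that mirroring one cell of a bend does
change the position of its legs; the cell [0] is attached at one corner only. *)
Definition sparse M := ~~ M 0%N /\ forall k, M k -> ~~ M k.+1.

Lemma cell_inj M k l p : sparse M -> M k -> M l -> in_cell k p -> in_cell l p -> k = l.
Proof.
move=> [_ hM]; wlog kl : k l / (k <= l)%N => [H|] Mk Ml pk pl.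
  by case/orP: (leq_total k l) => h; [exact: H|apply/esym/H].
move: kl; rewrite leq_eqVlt => /orP [/eqP //|]; rewrite leq_eqVlt => /orP [/eqP E|kl].
  by have := hM k Mk; rewrite E Ml.
by have := in_cell_far kl pk.
Qed.

Lemma cell_tri k l p : 0 <= p.2 <= 1 -> in_cell k p -> ~ open_triangle (odd l) (spine l) p.
Proof.
move=> hy [_ /andP [h1 h2]] /andP [h3 h4]; rewrite cell1 in h1; rewrite cell2 in h2.
have [g1 g2 _ _ _] := leg_gaps (odd k) (nondegenerate_spine k) hy.
have [f1 f2 _ _ _] := leg_gaps (odd l) (nondegenerate_spine l) hy.
have [kl|lk] := leqP k l.
  move: kl; rewrite leq_eqVlt => /orP [/eqP E|kl].
    by rewrite E in h2; lra.
  by have := spine_left_le hy kl; rewrite spineS1; lra.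
by have := spine_left_le hy lk; rewrite spineS1; lra.
Qed.

Lemma acc_tri k p : K p -> ~ open_triangle (odd k) (spine k) p.
Proof. by move=> [_ /(_ (nseq k true))]; rewrite kind_spine. Qed.

Lemma acc_height p : K p -> 0 <= p.2 <= 1. Proof. by move=> [[]]. Qed.

Lemma bendE k : bend k = point_at (cell k).2 (odd k)%:R. Proof. by []. Qed.

Lemma bend_left k : bend k = point_at (cell k.+1).1 (odd k)%:R.
Proof. by rewrite /bend vertexE cell1 spineS1. Qed.

Definition glue (phi : nat -> R * R -> R * R) M p : R * R :=
  if pselect (exists k, M k /\ in_cell k p) is left h then phi (projT1 (cid h)) p else p.

(** Distinct mirrored cells are disjoint, so the cell chosen by [glue] is the only one
that contains [p]. *)
Lemma glue_cell phi M k p : sparse M -> M k -> in_cell k p -> glue phi M p = phi k p.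
Proof.
move=> sM Mk pk; rewrite /glue; case: pselect => [h|]; last by case; exists k.
by case: cid => l [Ml pl] /=; rewrite (cell_inj sM Mk Ml pk pl).
Qed.

Lemma glue_id phi M p : (forall k, M k -> ~ in_cell k p) -> glue phi M p = p.
Proof. by move=> h; rewrite /glue; case: pselect => // -[k [Mk pk]]; case: (h k). Qed.

Lemma glue_cases phi M p : sparse M ->
  (exists k, [/\ M k, in_cell k p & glue phi M p = phi k p]) \/
  ((forall k, M k -> ~ in_cell k p) /\ glue phi M p = p).
Proof.
move=> sM; have [[k [Mk pk]]|h] := pselect (exists k, M k /\ in_cell k p).
  by left; exists k; split=> //; exact: glue_cell.
by right; split=> [k Mk pk|]; [|apply: glue_id => k Mk pk]; apply: h; exists k.
Qed.

(** The bound [scale k <= 1 / 2] is needed by [mirror], and the limit 0 for continuity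
at the right side of the square. *)
Definition scale k : R := 2^-1 ^+ k.+1.

Lemma scale_double k : 2 * scale k = 1 / 2 ^+ k.
Proof. by rewrite /scale exprS mulrA divff // !mul1r exprVn. Qed.

Lemma scale_bound k : 0 < scale k <= 1 / 2.
Proof.
rewrite /scale; apply/andP; split; first by rewrite exprn_gt0 // invr_gt0.
rewrite exprS mul1r ler_piMr ?invr_ge0 // exprn_ile1 ?invr_ge0 // invf_le1 //.
by rewrite ler1n.
Qed.

Lemma cell_near_one k p : in_cell k p -> 1 - 2 * scale k <= p.1 <= 1.
Proof.
move=> [hy /andP [h1 h2]]; rewrite cell1 in h1; rewrite cell2 in h2.
have W := width_subquad false (nseq k true) (@nondegenerate_unit_quad R) hy.
have [_ g2 g3 _ _] := leg_gaps (odd k) (nondegenerate_spine k) hy.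
move: W g3; rewrite size_nseq -/(spine k) /width spine2 !side_at11 => W g3.
have w0 : side_at (@unit_quad R).1 p.2 = 0 by rewrite /side_at /= !mulr0 addr0.
move: W; rewrite w0 subr0 => W.
rewrite scale_double.
by apply/andP; split; lra.
Qed.

Lemma scale_small (e : R) : 0 < e -> exists n, forall k, (n <= k)%N -> 2 * scale k < e.
Proof.
move=> e0; have [n hn] := pow2_unbounded (1 / e).
exists n => k nk; rewrite scale_double.
rewrite ltr_pdivrMr ?exprn_gt0 // mulrC -ltr_pdivrMr //.
by apply: lt_le_trans hn _; rewrite ler_weXn2l // ler1n.
Qed.

Lemma closed_quad (l r : side) : closed (quad_set l r).
Proof.
have -> : quad_set l r =
  ([set p : R * R | 0 <= p.2] `&` [set p : R * R | p.2 <= 1]) `&`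
  (~` [set p : R * R | p.1 < side_at l p.2] `&`
   ~` [set p : R * R | side_at r p.2 < p.1]).
  apply/seteqP; split=> p.
    move=> [/andP [y0 y1] /andP [h1 h2]].
    by split; split=> //=; apply/negP; rewrite -leNgt.
  move=> [[y0 y1] [/= /negP h1 /negP h2]].
  by rewrite -!leNgt in h1 h2; split; apply/andP.
apply: closedI.
- by apply: closedI; [exact: (closed_height (@closed_ge _ 0))|exact: (closed_height (@closed_le _ 1))].
- by apply: closedI; apply: open_closedC; [exact: open_left_of|exact: open_right_of].
Qed.

Section Gluing.
Variables (X : set (R * R)) (M : pred nat) (phi : nat -> R * R -> R * R).
Hypothesis sM : sparse M.
Hypothesis X01 : forall p, X p -> 0 <= p.2 <= 1.
Hypothesis Xtri : forall k p, X p -> ~ open_triangle (odd k) (spine k) p.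
Hypothesis cphi : forall k, continuous (phi k).
Hypothesis phi_left : forall k, M k.+1 -> phi k.+1 (bend k) = bend k.
Hypothesis phi_right : forall k, M k -> phi k (bend k) = bend k.
Hypothesis phi_cell : forall k p, M k -> X p -> in_cell k p ->
  in_cell k (phi k p) /\ `|(phi k p).2 - p.2| <= scale k.

Let cw (f : R * R -> R * R) p := forall U, nbhs (f p) U -> nbhs p [set z | X z -> U (f z)].

Let Mb n : pred nat := fun k => M k && (k < n)%N.

Let sMb n : sparse (Mb n).
Proof.
case: sM => h0 h; split; first by rewrite /Mb (negbTE h0).
by move=> k /andP [Mk _]; rewrite /Mb (negbTE (h k Mk)).
Qed.

Let not_corner n p : M n.+1 -> in_cell n.+1 p -> p <> bend n -> p <> bend n.+1 ->
  nbhs p [set z | X z -> in_cell n.+1 z].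
Proof.
move=> Mn [hy /andP [h1 h2]] nl nr.
have oO := openI (@open_right_of R (left_leg (odd n) (spine n)))
  (@open_left_of R (right_leg (odd n.+1) (spine n.+1))).
have pO : ([set p | side_at (left_leg (odd n) (spine n)) p.2 < p.1] `&`
   [set p | p.1 < side_at (right_leg (odd n.+1) (spine n.+1)) p.2]) p.
  rewrite cell1 spineS1 in h1; rewrite cell2 in h2; split=> /=.
  - rewrite lt_neqAle; apply/andP; split; last first.
      by have [_ g2 _ _ _] := leg_gaps (odd n) (nondegenerate_spine n) hy; lra.
    apply/eqP => E; have [yE|yN] := eqVneq p.2 (odd n)%:R; last first.
      by have := leg_lt (nondegenerate_spine n) hy yN; lra.
    by apply: nl; rewrite /bend /vertex /point_at -yE E -surjective_pairing.
  - rewrite lt_neqAle; apply/andP; split; last first.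
      by have [_ g2 _ _ _] := leg_gaps (odd n.+1) (nondegenerate_spine n.+1) hy; lra.
    apply/eqP => E; have [yE|yN] := eqVneq p.2 (odd n.+1)%:R; last first.
      by have := leg_lt (nondegenerate_spine n.+1) hy yN; lra.
    by apply: nr; rewrite /bend vertexE /point_at -yE -E -surjective_pairing.
apply: filterS (open_nbhs_nbhs (conj oO pO)) => z [z1 z2] Xz.
split; first exact: X01.
have t1 := @Xtri n z Xz; have t2 := @Xtri n.+1 z Xz.
rewrite cell1 cell2 spineS1; apply/andP; split; rewrite leNgt; apply/negP => z3.
- by apply: t1; apply/andP.
- by apply: t2; apply/andP.
Qed.

Let glue_trunc n p : X p -> cw (glue phi (Mb n)) p.
Proof.
move=> Xp; elim: n => [|n IH].
  have E z : glue phi (Mb 0) z = z by apply: glue_id => k; rewrite /Mb ltn0 andbF.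
  by move=> U; rewrite E => hU; apply: filterS hU => z Uz _; rewrite E.
have [Mn|nMn] := boolP (M n); last first.
  have -> : Mb n.+1 = Mb n; last exact: IH.
  apply: funext => k; rewrite /Mb ltnS leq_eqVlt.
  by have [->|//] := eqVneq k n; rewrite (negbTE nMn).
have Mbn : Mb n.+1 n by rewrite /Mb Mn ltnSn.
have n0 : n = n.-1.+1.
  by case: n Mn {IH Mbn} => // M0; case: sM; rewrite M0.
have off z : ~ in_cell n z -> glue phi (Mb n.+1) z = glue phi (Mb n) z.
  move=> nz; case: (glue_cases phi z (sMb n.+1)) => [[k [/andP [Mk kn] zk ->]]|[h ->]].
    rewrite (glue_cell _ (sMb n) _ zk) // /Mb Mk /=.
    move: kn; rewrite ltnS leq_eqVlt => /orP [/eqP E|//].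
    by move: zk; rewrite E.
  by rewrite glue_id // => k /andP [Mk kn]; apply: h; rewrite /Mb Mk ltnW.
have on z : in_cell n z -> glue phi (Mb n.+1) z = phi n z by exact: glue_cell.
have onp z : in_cell n z -> glue phi (Mb n) z = z.
  move=> zn; apply: glue_id => k /andP [Mk kn] zk.
  by move: kn; rewrite (cell_inj sM Mk Mn zk zn) ltnn.
move=> U; have [pn|npn] := pselect (in_cell n p); last first.
  rewrite off // => /IH hU.
  have := open_nbhs_nbhs (conj (closed_openC (@closed_quad (cell n).1 (cell n).2)) npn).
  move=> hO; apply: (filterS2 _ _ hU hO) => z hz nz Xz.
  by rewrite off //; exact: hz.
rewrite on // => hU.
have near_cell : nbhs p [set z | in_cell n z -> U (glue phi (Mb n.+1) z)].
  have hO : nbhs p [set z | U (phi n z)] by exact: (@cphi n p U hU).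
  by apply: filterS hO => z hz zn; rewrite on.
have [E|NE] := pselect (phi n p = p).
  have := hU; rewrite {1}E -{1}(onp p pn) => /IH.
  move=> hO; apply: (filterS2 _ _ near_cell hO) => z h1 h2 Xz.
  by have [/h1 //|nz] := pselect (in_cell n z); rewrite off //; exact: h2.
have [nl nr] : p <> bend n.-1 /\ p <> bend n.
  split=> E; apply: NE; rewrite E; last exact: phi_right.
  by rewrite [in phi n]n0 phi_left // -n0.
rewrite n0 in Mn pn nr; have := not_corner Mn pn nl nr; rewrite -n0.
by move=> hO; apply: (filterS2 _ _ near_cell hO) => z h1 h2 Xz; apply/h1/h2.
Qed.

(** Mirroring the first [n] cells is continuous by induction on [n], since a cell is
isolated in [X] by the triangles at its sides, except at its corners, which are
fixed.  The remaining cells are moved by small amounts, so the limit is uniform.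
The statement is about any set [X] avoiding the triangles, because it is applied to
the accordion and, for the inverse map, to its image. *)
Lemma glue_continuous : {within X, continuous (glue phi M)}.
Proof.
apply/subspace_continuousP => p Xp U /nbhs_ballP [e /= e0 hU].
have [n hn] : exists n, forall k, (n <= k)%N -> 2 * scale k < e / 3.
  by apply: scale_small; rewrite divr_gt0.
have close z : X z -> ball (glue phi (Mb n) z) (e / 3) (glue phi M z).
  move=> Xz; case: (glue_cases phi z sM) => [[k [Mk zk ->]]|[h ->]]; last first.
    rewrite glue_id; last by move=> k /andP [Mk _]; exact: h.
    by apply: ballxx; rewrite divr_gt0.
  have [kn|nk] := ltnP k n.
    by rewrite (glue_cell _ (sMb n) _ zk) /Mb ?Mk //; apply: ballxx; rewrite divr_gt0.
  rewrite glue_id; last first.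
    move=> l /andP [Ml ln] zl; move: ln.
    by rewrite (cell_inj sM Ml Mk zl zk) ltnNge nk.
  have := hn k nk => small; have [ck ek] := phi_cell Mk Xz zk.
  have /andP [a1 a2] := cell_near_one zk; have /andP [b1 b2] := cell_near_one ck.
  have /andP [s0 _] := scale_bound k.
  apply/ball_plane; split; last by rewrite distrC; lra.
  by rewrite ltr_norml; apply/andP; split; lra.
have : nbhs (glue phi (Mb n) p) (ball (glue phi (Mb n) p) (e / 3)).
  by apply: nbhsx_ballx; rewrite divr_gt0.
move=> /(glue_trunc Xp); apply: filterS => z hz Xz; apply: hU.
have := hz Xz; have /ball_sym h1 := close p Xp; have h2 := close z Xz => h3.
have -> : e = e / 3 + e / 3 + e / 3 by lra.
exact: (ball_triangle (ball_triangle h1 h3) h2).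
Qed.

End Gluing.

End Spine.

(** * Accessible points *)

Section Access.
Context {R : realType}.
Implicit Types (A B U V Y : set (R * R)) (p z : R * R) (t : R).

Lemma within_comp_cont (T1 T2 T3 : topologicalType) (A : set T2) (B : set T1)
  (f : T2 -> T3) (h : T1 -> T2) :
  {within A, continuous f} -> {within B, continuous h} -> (forall x, B x -> A (h x)) ->
  {within B, continuous (f \o h)}.
Proof.
move=> cf ch hBA.
apply/subspace_continuousP => x Bx V hV.
have h1 := (@subspace_continuousP _ A _ f).1 cf _ (hBA _ Bx) V hV.
have h2 := (@subspace_continuousP _ B _ h).1 ch _ Bx _ h1.
have h3 : nbhs x [set z | B z -> A (h z) -> V (f (h z))] by exact: h2.
by apply: filterS h3 => z hz Bz; apply: hz => //; exact: hBA.
Qed.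

Lemma nbhs_planeP z U : nbhs z U <-> exists2 e : R, 0 < e &
  forall z', `|z.1 - z'.1| < e -> `|z.2 - z'.2| < e -> U z'.
Proof.
split=> [/nbhs_ballP [e /= e0 he]|[e e0 he]].
  by exists e => // z' h1 h2; apply/he/ball_plane.
by apply/nbhs_ballP; exists e => //= z' /ball_plane [h1 h2]; exact: he.
Qed.

Definition seg p z t : R * R := ((1 - t) * p.1 + t * z.1, (1 - t) * p.2 + t * z.2).

Lemma continuous_seg p z : continuous (seg p z).
Proof.
by apply: continuous_pair => t; apply: cvgD; apply: cvgM; try exact: cvg_cst;
  try exact: cvg_id; apply: cvgB; [exact: cvg_cst|exact: cvg_id|exact: cvg_cst|exact: cvg_id].
Qed.

Lemma accessible_segment Y p z : Y p -> p <> z ->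
  (forall t, 0 < t <= 1 -> ~ Y (seg p z t)) -> accessible Y p.
Proof.
move=> Yp npz hseg.
have seg0 : seg p z 0 = p by rewrite /seg !subr0 !mul1r !mul0r !addr0 -surjective_pairing.
have inv_ex : exists2 g : R * R -> R, continuous g & forall t, g (seg p z t) = t.
  have [E1|N1] := eqVneq p.1 z.1.
  - have N2 : z.2 - p.2 != 0.
      rewrite subr_eq0; apply/eqP => E2; apply: npz.
      by rewrite (surjective_pairing p) (surjective_pairing z) E1 E2.
    exists (fun w => (w.2 - p.2) / (z.2 - p.2)).
      by move=> w; apply: cvgM; [apply: cvgB; [exact: cvg_snd|exact: cvg_cst]|exact: cvg_cst].
    move=> t; rewrite /seg /= (_ : _ - _ = t * (z.2 - p.2)); last by ring.
    by rewrite mulfK.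
  - have N2 : z.1 - p.1 != 0 by rewrite subr_eq0 eq_sym.
    exists (fun w => (w.1 - p.1) / (z.1 - p.1)).
      by move=> w; apply: cvgM; [apply: cvgB; [exact: cvg_fst|exact: cvg_cst]|exact: cvg_cst].
    move=> t; rewrite /seg /= (_ : _ - _ = t * (z.1 - p.1)); last by ring.
    by rewrite mulfK.
have [g cg gK] := inv_ex.
split=> //; exists (seg p z @` `[0, 1]); split.
  exists (seg p z); split; first by apply: continuous_subspaceT; exact: continuous_seg.
  split=> //; exists g; split; first exact: continuous_subspaceT.
  by move=> t _; exact: gK.
apply/seteqP; split=> w.
- move=> [[t /=]]; rewrite in_itv /= => /andP [t0 t1] <- hY.
  have [->|tn] := eqVneq t 0; first by [].
  by case: (hseg t) => //; rewrite t1 lt_neqAle eq_sym tn t0.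
- by move=> ->; split=> //; exists 0 => //=; rewrite in_itv /= lexx ler01.
Qed.

(** Accessibility is local: a short subarc through the point is still an arc. *)
Lemma accessible_local Y Y' U (G G' : R * R -> R * R) p :
  continuous G -> continuous G' -> cancel G G' -> nbhs p U ->
  (forall z, U z -> (Y z <-> Y' (G z))) -> accessible Y p -> accessible Y' (G p).
Proof.
move=> cG cG' GK hU hY [Yp [A [[f [cf [fA [g [cg gK]]]]] AY]]].
have Up : U p by exact: nbhs_singleton.
split; first by apply/(hY _ Up).
have : (A `&` Y) p by rewrite AY.
rewrite -fA => -[[t0 ht0 ft0] _].
have : nbhs t0 [set t | `[0, 1]%classic t -> U (f t)].
  have hUf : nbhs (f t0) U by rewrite ft0.
  exact: ((@subspace_continuousP R (`[0, 1]%classic : set R) _ f).1 cf t0 ht0 U hUf).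
move=> /nbhs_ballP [e /= e0 he].
have {}he t : 0 <= t <= 1 -> `|t0 - t| < e -> U (f t).
  by move=> ht h; apply: he => //=; rewrite in_itv.
move: ht0; rewrite /= in_itv /= => /andP [t00 t01].
(* an interval of parameters around [t0] that [f] maps into [U] *)
pose c := Num.max 0 (t0 - e / 2); pose d := Num.min 1 (t0 + e / 2).
have c0 : 0 <= c by rewrite le_max lexx.
have d1 : d <= 1 by rewrite ge_min lexx.
have ct : c <= t0 by rewrite ge_max t00; lra.
have td : t0 <= d by rewrite le_min t01; lra.
have ce : t0 - e / 2 <= c by rewrite le_max lexx orbT.
have de : d <= t0 + e / 2 by rewrite ge_min lexx orbT.
have cd : c < d.
  rewrite /c /d gt_max !lt_min ltr01 /=; apply/and3P; split; lra.
pose h t := c + t * (d - c).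
have h01 t : 0 <= t <= 1 -> c <= h t <= d.
  move=> /andP [a0 a1]; rewrite /h.
  have : 0 <= t * (d - c) by apply: mulr_ge0; lra.
  have : 0 <= (1 - t) * (d - c) by apply: mulr_ge0; lra.
  by move=> *; apply/andP; split; lra.
have hU' t : 0 <= t <= 1 -> U (f (h t)).
  move=> /h01 /andP [a0 a1]; apply: he; first by apply/andP; split; lra.
  by rewrite ltr_norml; apply/andP; split; lra.
have ch : continuous h.
  move=> t; apply: cvgD; first exact: cvg_cst.
  by apply: cvgM; [exact: cvg_id|exact: cvg_cst].
have hin t : `[0, 1]%classic t -> `[0, 1]%classic (h t).
  by rewrite /= !in_itv /= => /h01 /andP [? ?]; apply/andP; split; lra.
pose f' := G \o (f \o h).
have f'A z : (f' @` `[0, 1]) z -> A (G' z).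
  by move=> [t ht <-]; rewrite /f' /= GK -fA; exists (h t) => //; exact: hin.
exists (f' @` `[0, 1]); split.
  exists f'; split.
    apply: (@within_comp_cont _ _ _ setT); first exact: continuous_subspaceT.
      apply: (within_comp_cont cf) => //; exact: continuous_subspaceT.
    by [].
  split=> //; exists (fun z => (g (G' z) - c) / (d - c)); split.
    apply: (@within_comp_cont _ _ _ setT _ (fun t => (t - c) / (d - c)) (g \o G')).
    - apply: continuous_subspaceT => t; apply: cvgM; last exact: cvg_cst.
      by apply: cvgB; [exact: cvg_id|exact: cvg_cst].
    - apply: (within_comp_cont cg) => //; exact: continuous_subspaceT.
    - by [].
  move=> t; rewrite inE => ht; rewrite /f' /= GK gK; last by rewrite inE; exact: hin.
  by rewrite /h addrAC subrr add0r mulfK // subr_eq0 gt_eqF.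
apply/seteqP; split=> z.
- move=> [[t ht <-]]; rewrite /f' /= => Y'z.
  have ht' : 0 <= t <= 1 by move: ht; rewrite /= in_itv.
  have /(hY _ (hU' _ ht')) Yf := Y'z.
  have : (A `&` Y) (f (h t)) by split=> //; rewrite -fA; exists (h t) => //; exact: hin.
  by rewrite AY => ->.
- move=> ->; split; last by apply/(hY _ Up).
  have dc : d - c != 0 by rewrite subr_eq0 gt_eqF.
  exists ((t0 - c) / (d - c)); last by rewrite /f' /= /h divfK // subrKC ft0.
  rewrite /= in_itv /= divr_ge0 ?subr_ge0 ?(ltW cd) //=.
  by rewrite ler_pdivrMr ?subr_gt0 // mul1r; lra.
Qed.

End Access.

(** * The embeddings and their accessible points *)

Section Family.
Context {R : realType}.
Implicit Types (k l n : nat) (y : R) (p z : R * R) (M : pred nat).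

Local Notation K := (accordion false (@unit_quad R)).

Lemma open_abscissa (A : set R) : open A -> open [set p : R * R | A p.1].
Proof. by move=> oA; apply: (open_comp (f := fst)) oA => p _; exact: cvg_fst. Qed.

Definition fold k : R * R -> R * R := mirror (~~ odd k) (scale k) (cell k).
Definition unfold k : R * R -> R * R := unmirror (~~ odd k) (scale k) (cell k).

Lemma scale_lt1 k : scale k < 1 :> R.
Proof. by have /andP [? ?] := @scale_bound R k; lra. Qed.

Lemma foldK k : cancel (fold k) (unfold k).
Proof. by apply: mirrorK; [exact: nondegenerate_cell|exact: scale_lt1]. Qed.

Lemma unfoldK k : cancel (unfold k) (fold k).
Proof. by apply: unmirrorK; [exact: nondegenerate_cell|exact: scale_lt1]. Qed.

Lemma continuous_fold k : continuous (fold k).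
Proof. by apply: continuous_mirror; exact: nondegenerate_cell. Qed.

Lemma continuous_unfold k : continuous (unfold k).
Proof. by apply: continuous_unmirror; exact: nondegenerate_cell. Qed.

Lemma fold_bend k : fold k (bend k) = bend k.
Proof.
rewrite /fold bendE -{2 3}[odd k]negbK.
by apply: mirror_right_corner; [exact: nondegenerate_cell|exact: scale_bound].
Qed.

Lemma foldS_bend k : fold k.+1 (bend k) = bend k.
Proof.
rewrite /fold bend_left /= negbK.
by apply: mirror_left_corner; [exact: nondegenerate_cell|exact: scale_bound].
Qed.

Lemma fold_cell k p : in_cell k p ->
  in_cell k (fold k p) /\ `|(fold k p).2 - p.2| <= scale k.
Proof. by apply: mirror_quad; [exact: nondegenerate_cell|exact: scale_bound]. Qed.

Definition embedding M : R * R -> R * R := glue fold M.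
Definition embedding_inv M : R * R -> R * R := glue unfold M.

Section OnePattern.
Variable M : pred nat.
Hypothesis sM : sparse M.
Local Notation Y := (embedding M @` K).

Lemma embedding_cell k p : M k -> in_cell k p -> embedding M p = fold k p.
Proof. exact: glue_cell. Qed.

Lemma embedding_id p : (forall k, M k -> ~ in_cell k p) -> embedding M p = p.
Proof. exact: glue_id. Qed.

Lemma embeddingK : cancel (embedding M) (embedding_inv M).
Proof.
move=> p; have [[k [Mk pk E]]|[h E]] := glue_cases fold p sM; rewrite /embedding E.
  rewrite /embedding_inv (glue_cell _ sM Mk (fold_cell pk).1); exact: foldK.
by rewrite /embedding_inv glue_id.
Qed.

Lemma image_cell k p : M k -> in_cell k p -> Y p -> exists p', [/\ K p', in_cell k p' & p = fold k p'].
Proof.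
move=> Mk pk [p' Kp' E]; exists p'; split=> //.
- have [[l [Ml pl El]]|[h El]] := glue_cases fold p' sM.
    have pl' : in_cell l p by rewrite -E /embedding El; exact: (fold_cell pl).1.
    by rewrite (cell_inj sM Mk Ml pk pl').
  by move: E; rewrite /embedding El => ->.
- have [[l [Ml pl El]]|[h El]] := glue_cases fold p' sM.
    have pl' : in_cell l p by rewrite -E /embedding El; exact: (fold_cell pl).1.
    by rewrite -E /embedding El (cell_inj sM Mk Ml pk pl').
  by case: (h k Mk); rewrite -El -/(embedding M) E.
Qed.

Lemma image_fold k p : M k -> in_cell k p -> Y (fold k p) <-> K p.
Proof.
move=> Mk pk; split; last by move=> Kp; exists p => //; exact: embedding_cell.
move=> /(image_cell Mk (fold_cell pk).1) [p' [Kp' _ /(can_inj (@foldK k)) ->]] //.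
Qed.

Lemma image_off p : (forall k, M k -> ~ in_cell k p) -> Y p <-> K p.
Proof.
move=> h; split; last by move=> Kp; exists p => //; exact: embedding_id.
move=> [p' Kp' E]; have [[l [Ml pl El]]|[_ El]] := glue_cases fold p' sM.
  by case: (h l Ml); rewrite -E /embedding El; exact: (fold_cell pl).1.
by rewrite -E /embedding El.
Qed.

Lemma image_height p : Y p -> 0 <= p.2 <= 1.
Proof.
move=> [p' Kp' <-]; have [[l [Ml pl El]]|[_ El]] := glue_cases fold p' sM; rewrite /embedding El.
  by case: (fold_cell pl).1.
exact: acc_height.
Qed.

Lemma image_tri k p : Y p -> ~ open_triangle (odd k) (spine k) p.
Proof.
move=> Yp; have hy := image_height Yp; case: Yp => p' Kp' E; rewrite -E.
have [[l [Ml pl El]]|[_ El]] := glue_cases fold p' sM; rewrite /embedding El.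
  by apply: (cell_tri (k := l)); [case: (fold_cell pl).1|exact: (fold_cell pl).1].
exact: acc_tri.
Qed.

Lemma acc_right_bound p : K p -> p.1 <= 1.
Proof. by move=> [[_ /andP [_]]]; rewrite side_at11. Qed.

Lemma image_right_bound p : Y p -> p.1 <= 1.
Proof.
move=> [p' Kp' <-]; have [[l [Ml pl El]]|[_ El]] := glue_cases fold p' sM; rewrite /embedding El.
  by case/andP: (cell_near_one (fold_cell pl).1).
exact: acc_right_bound.
Qed.

Lemma embedding_continuous : {within K, continuous (embedding M)}.
Proof.
apply: glue_continuous => //.
- exact: acc_height.
- by move=> k p; exact: acc_tri.
- exact: continuous_fold.
- by move=> k _; exact: foldS_bend.
- by move=> k _; exact: fold_bend.
- by move=> k p _ _; exact: fold_cell.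
Qed.

Lemma embedding_inv_continuous : {within Y, continuous (embedding_inv M)}.
Proof.
apply: glue_continuous => //.
- exact: image_height.
- by move=> k p; exact: image_tri.
- exact: continuous_unfold.
- by move=> k _; rewrite -{1}foldS_bend foldK.
- by move=> k _; rewrite -{1}fold_bend foldK.
- move=> k p Mk Yp pk; have [p' [_ pk' ->]] := image_cell Mk pk Yp.
  by rewrite foldK distrC; split=> //; exact: (fold_cell pk').2.
Qed.

Lemma embedding_planar : is_planar_embedding K (embedding M).
Proof.
exists Y; split; first exact: embedding_continuous.
split=> //; exists (embedding_inv M); split; first exact: embedding_inv_continuous.
by move=> p _; exact: embeddingK.
Qed.

Lemma access_right (Z : set (R * R)) k p :
  (forall z, Z z -> ~ open_triangle (odd k) (spine k) z) ->
  Z p -> in_cell k p -> p.2 != (odd k)%:R ->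
  (forall x, p.1 < x <= side_at (cell k).2 p.2 -> ~ Z (x, p.2)) -> accessible Z p.
Proof.
move=> Ztri Zp pk ny hfree; have [hy /andP [_ hx]] := pk.
have lt := leg_lt (nondegenerate_spine k) hy ny.
set z := (side_at (median (odd k) (spine k)) p.2, p.2).
have pz : p.1 < z.1 by rewrite /z /= medianE; move: hx; rewrite cell2; lra.
apply: (@accessible_segment _ _ _ z) => //.
  by move=> E; move: pz; rewrite -E ltxx.
move=> t /andP [t0 t1]; rewrite /seg (_ : (1 - t) * p.2 + t * z.2 = p.2); last first.
  by rewrite /z /=; ring.
set x := _ + _.
have x1 : p.1 < x.
  have : 0 < t * (z.1 - p.1) by apply: mulr_gt0; lra.
  by rewrite /x; lra.
have x2 : x <= z.1.
  have : 0 <= (1 - t) * (z.1 - p.1) by apply: mulr_ge0; lra.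
  by rewrite /x; lra.
have [x3|x3] := leP x (side_at (cell k).2 p.2); first by apply: hfree; rewrite x1.
move=> /Ztri; apply; rewrite /open_triangle /=; move: x3 x2; rewrite cell2 /z /= medianE => *.
by apply/andP; split; lra.
Qed.

Lemma access_left (Z : set (R * R)) k p :
  (forall z, Z z -> ~ open_triangle (odd k) (spine k) z) ->
  Z p -> in_cell k.+1 p -> p.2 != (odd k)%:R ->
  (forall x, side_at (cell k.+1).1 p.2 <= x < p.1 -> ~ Z (x, p.2)) -> accessible Z p.
Proof.
move=> Ztri Zp pk ny hfree; have [hy /andP [hx _]] := pk.
have lt := leg_lt (nondegenerate_spine k) hy ny.
set z := (side_at (median (odd k) (spine k)) p.2, p.2).
have pz : z.1 < p.1 by rewrite /z /= medianE; move: hx; rewrite cell1 spineS1; lra.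
apply: (@accessible_segment _ _ _ z) => //.
  by move=> E; move: pz; rewrite -E ltxx.
move=> t /andP [t0 t1]; rewrite /seg (_ : (1 - t) * p.2 + t * z.2 = p.2); last first.
  by rewrite /z /=; ring.
set x := _ + _.
have x1 : x < p.1.
  have : 0 < t * (p.1 - z.1) by apply: mulr_gt0; lra.
  by rewrite /x; lra.
have x2 : z.1 <= x.
  have : 0 <= (1 - t) * (p.1 - z.1) by apply: mulr_ge0; lra.
  by rewrite /x; lra.
have [x3|x3] := leP (side_at (cell k.+1).1 p.2) x; first by apply: hfree; rewrite x1 x3.
move=> /Ztri; apply; rewrite /open_triangle /=; move: x3 x2; rewrite cell1 spineS1 /z /= medianE => *.
by apply/andP; split; lra.
Qed.

Lemma access_end p : K p -> p.2 = 0 \/ p.2 = 1 -> accessible K p.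
Proof.
move=> Kp [E|E].
- apply: (@accessible_segment _ _ _ (p.1, -1)) => // [h|t /andP [t0 t1] /acc_height].
    by move: E; rewrite h /=; lra.
  by rewrite /= E => /andP [? ?]; lra.
- apply: (@accessible_segment _ _ _ (p.1, 2)) => // [h|t /andP [t0 t1] /acc_height].
    by move: E; rewrite h /=; lra.
  by rewrite /= E => /andP [? ?]; lra.
Qed.

Definition on_boundary k p : Prop :=
  p.1 = side_at (cell k).1 p.2 \/ p.1 = side_at (cell k).2 p.2 \/ p.2 = 0 \/ p.2 = 1.

(** Sides are reached horizontally from the triangle next to them, ends vertically from
outside of the square. *)
Lemma access_boundary k p : K p -> in_cell k.+1 p -> on_boundary k.+1 p -> accessible K p.
Proof.
move=> Kp pk; have Ktri j z : K z -> ~ open_triangle (odd j) (spine j) z by exact: acc_tri.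
have [E|N0] := eqVneq p.2 0; first by move=> _; apply: access_end => //; left.
have [E|N1] := eqVneq p.2 1; first by move=> _; apply: access_end => //; right.
have nb (b : bool) : p.2 != b%:R by case: b.
move=> [E|[E|[E|E]]]; last 2 first.
- by rewrite E eqxx in N0.
- by rewrite E eqxx in N1.
- apply: (@access_left K k) => //; first exact: Ktri.
  by move=> x /andP [h1 h2]; lra.
- apply: (@access_right K k.+1) => //; first exact: Ktri.
  by move=> x /andP [h1 h2]; lra.
Qed.

Lemma access_image_boundary k p : M k.+1 -> K p -> in_cell k.+1 p -> on_boundary k.+1 p ->
  accessible Y (embedding M p).
Proof.
move=> Mk Kp pk bp; have [hy /andP [h1 h2]] := pk.
rewrite (embedding_cell Mk pk).
have Yp : Y (fold k.+1 p) by apply/image_fold.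
have fk := (fold_cell pk).1.
have Ytri j z : Y z -> ~ open_triangle (odd j) (spine j) z by exact: image_tri.
have free x p' : in_cell k.+1 (x, (fold k.+1 p).2) -> Y (x, (fold k.+1 p).2) ->
    exists2 p', in_cell k.+1 p' & fold k.+1 p' = (x, (fold k.+1 p).2).
  by move=> hx /(image_cell Mk hx) [p'' [_ pk'' ->]]; exists p''.
have hr : p.1 = side_at (cell k.+1).1 p.2 \/
    (flip (~~ odd k.+1) p.2 = 1 /\ p.1 < side_at (cell k.+1).2 p.2) ->
    accessible Y (fold k.+1 p).
  move=> h; have [n1 n2] := mirror_free_right (nondegenerate_cell k.+1) (@scale_bound R k.+1) pk h.
  rewrite negbK in n1; apply: (@access_right Y k.+1 _ (Ytri k.+1) Yp fk n1).
  move=> x /andP [x1 x2] Yx; have [|p' pk' E] := free x p _ Yx.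
    by case: fk => hy' /andP [l1 l2]; split=> //=; apply/andP; split; lra.
  exact: (n2 x p' x1 pk' E).
have hl : p.1 = side_at (cell k.+1).2 p.2 \/
    (flip (~~ odd k.+1) p.2 = 0 /\ side_at (cell k.+1).1 p.2 < p.1) ->
    accessible Y (fold k.+1 p).
  move=> h; have [n1 n2] := mirror_free_left (nondegenerate_cell k.+1) (@scale_bound R k.+1) pk h.
  have n1' : (fold k.+1 p).2 != (odd k)%:R.
    by move: n1; rewrite -/(fold k.+1 p); have -> : ~~ odd k.+1 = odd k by rewrite /= negbK.
  apply: (@access_left Y k _ (Ytri k) Yp fk n1').
  move=> x /andP [x1 x2] Yx; have [|p' pk' E] := free x p _ Yx.
    by case: fk => hy' /andP [l1 l2]; split=> //=; apply/andP; split; lra.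
  exact: (n2 x p' x2 pk' E).
have ends : flip (~~ odd k.+1) p.2 = 0 \/ flip (~~ odd k.+1) p.2 = 1 ->
    accessible Y (fold k.+1 p).
  have [E|N] := eqVneq p.1 (side_at (cell k.+1).1 p.2); first by move=> _; apply: hr; left.
  have [E|N'] := eqVneq p.1 (side_at (cell k.+1).2 p.2); first by move=> _; apply: hl; left.
  move=> [E|E]; [apply: hl|apply: hr]; right; split=> //.
    by rewrite lt_neqAle eq_sym N.
  by rewrite lt_neqAle N'.
case: bp => [E|[E|E]]; [by apply: hr; left|by apply: hl; left|apply: ends].
by rewrite /flip; case: (~~ odd k.+1); case: E => ->; [right|left|left|right]; rewrite ?subrr ?subr0.
Qed.

(** Boundary points of mirrored cells are accessible on both sides of the equivalence,
as are those of the right side of the square.  At all other points the embedding is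
locally the restriction of a homeomorphism of the plane: [fold k] inside of a
mirrored cell, and the identity elsewhere. *)
Lemma access_iff p : K p -> accessible Y (embedding M p) <-> accessible K p.
Proof.
move=> Kp; have [[k [Mk pk]]|hout] := pselect (exists k, M k /\ in_cell k p).
- have [k0 E] : exists k0, k = k0.+1.
    by case: k Mk {pk} => [M0|k0]; [case: sM; rewrite M0|exists k0].
  have [hb|nb] := pselect (on_boundary k p).
    rewrite E in Mk pk hb.
    by split=> _; [exact: (access_boundary Kp pk)|exact: (access_image_boundary Mk)].
  have [hy /andP [h1 h2]] := pk.
  pose U := [set z : R * R | side_at (cell k).1 z.2 < z.1] `&`
    [set z | z.1 < side_at (cell k).2 z.2] `&`
    ([set z | 0 < z.2] `&` [set z | z.2 < 1]).
  have oU : open U.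
    apply: openI; first by apply: openI; [exact: open_right_of|exact: open_left_of].
    by apply: openI; [exact: (open_height (@open_gt _ 0))|exact: (open_height (@open_lt _ 1))].
  have Up : U p.
    split; split=> /=; rewrite lt_neqAle; apply/andP; split=> //; try by case/andP: hy.
    - by apply/eqP => e; apply: nb; left.
    - by apply/eqP => e; apply: nb; right; left.
    - by apply/eqP => e; apply: nb; right; right; left.
    - by apply/eqP => e; apply: nb; right; right; right.
  have Uk z : U z -> in_cell k z.
    by move=> [[/= z1 z2] [z3 z4]]; split; apply/andP; split; exact: ltW.
  rewrite (embedding_cell Mk pk); split.
  + rewrite -{2}(@foldK k p); apply: (@accessible_local _ _ _ (unfold k @^-1` U) (unfold k) (fold k)).
    * exact: continuous_unfold.
    * exact: continuous_fold.
    * exact: unfoldK.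
    * apply: open_nbhs_nbhs; split; last by rewrite /= foldK.
      by apply: open_comp oU => z _; exact: continuous_unfold.
    * by move=> z /= Uz; rewrite -(image_fold Mk (Uk _ Uz)) unfoldK.
  + apply: (@accessible_local _ _ _ U (fold k) (unfold k)).
    * exact: continuous_fold.
    * exact: continuous_unfold.
    * exact: foldK.
    * by apply: open_nbhs_nbhs; split.
    * by move=> z Uz; rewrite (image_fold Mk (Uk _ Uz)).
- have {}hout k : M k -> ~ in_cell k p by move=> Mk pk; apply: hout; exists k.
  rewrite embedding_id //.
  have Yp : Y p by apply/image_off.
  have [p1|p1] := eqVneq p.1 1.
    have far (Z : set (R * R)) : Z p -> (forall z, Z z -> z.1 <= 1) -> accessible Z p.
      move=> Zp hZ; apply: (@accessible_segment _ _ _ (2, p.2)) => // [e|t /andP [t0 t1] /hZ].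
        by move: p1; rewrite e /=; lra.
      by rewrite /= p1; lra.
    by split=> _; [exact: (far _ Kp acc_right_bound)|exact: (far _ Yp image_right_bound)].
  have {}p1 : p.1 < 1 by rewrite lt_neqAle p1 acc_right_bound.
  have hU : nbhs p [set z | forall k, M k -> ~ in_cell k z].
    have e0 : 0 < (1 - p.1) / 2 by apply: divr_gt0; lra.
    have [n hn] := scale_small e0.
    have near_n m : nbhs p [set z | forall k, (k < m)%N -> M k -> ~ in_cell k z].
      elim: m => [|m IH]; first by apply: filterS filterT => z _ k.
      have hm : nbhs p [set z | M m -> ~ in_cell m z].
        have [Mm|nM] := boolP (M m); last by apply: filterS filterT => z _ /negP; case/negP.
        have := open_nbhs_nbhs (conj (closed_openC (@closed_quad R (cell m).1 (cell m).2))
          (hout m Mm)).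
        by apply: filterS => z hz _.
      apply: (filterS2 _ _ IH hm) => z z1 z2 k; rewrite ltnS leq_eqVlt => /orP [/eqP ->|] //.
      exact: z1.
    have hx : nbhs p [set z : R * R | z.1 < 1 - (1 - p.1) / 2].
      apply: open_nbhs_nbhs; split; last by rewrite /=; lra.
      exact: (open_abscissa (@open_lt _ (1 - (1 - p.1) / 2))).
    apply: (filterS2 _ _ (near_n n) hx) => z z1 /= z2 k Mk zk.
    have [kn|nk] := ltnP k n; first exact: (z1 k kn Mk zk).
    have := hn k nk; have /andP [] := cell_near_one zk; lra.
  have loc (Z Z' : set (R * R)) : (forall z, (forall k, M k -> ~ in_cell k z) -> Z z <-> Z' z) ->
      accessible Z p -> accessible Z' p.
    have cid' : continuous (id : R * R -> R * R) by move=> z; exact: cvg_id.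
    by move=> h; apply: (@accessible_local R Z Z' _ id id p cid' cid' _ hU h).
  by split; apply: loc => z /image_off // [? ?]; split.
Qed.

End OnePattern.

End Family.

(** * Arcs from one leg to the other, near a vertex *)

Section Crossing.
Context {R : realType}.
Local Notation side := (@side R).
Implicit Types (b c : bool) (q : side * side) (w u : seq bool) (s : side) (k l j n : nat)
  (t y : R) (p z : R * R) (M : pred nat).

Local Notation K := (accordion false (@unit_quad R)).

(** The two legs at the vertex [p] can be joined outside of the image, arbitrarily
close to [p]. *)
Definition legs_joined (f : R * R -> R * R) p : Prop :=
  forall U : set (R * R), open U -> U (f p) -> exists x x' (g : R -> R * R),
    [/\ layer K p x, layer K p x', x <> p, x' <> p & ~ linked K p x x'] /\
    [/\ continuous g, g 0 = f x, g 1 = f x',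
        forall t, 0 <= t <= 1 -> U (g t) & forall t, 0 < t < 1 -> ~ (f @` K) (g t)].

Lemma zero_between (f : R -> R) t0 t1 : continuous f -> t0 <= t1 ->
  (f t0 < 0 < f t1) || (f t1 < 0 < f t0) -> exists2 t, t0 <= t <= t1 & f t = 0.
Proof.
move=> cf le01 h; have [||t] := @IVT R f t0 t1 0 le01; last by rewrite in_itv /=; exists t.
  exact: continuous_subspaceT.
by rewrite ge_min le_max; case/orP: h => /andP [h1 h2]; rewrite !(ltW h1) !(ltW h2) ?orbT.
Qed.

Lemma pick_small (P : set R) (e : R) : nbhs 0 P -> 0 < e -> exists t, [/\ 0 < t, t < e & P t].
Proof.
move=> /nbhs_ballP [d /= d0 hd] e0.
have m0 : 0 < Num.min d e by rewrite lt_min d0.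
have m1 : Num.min d e <= d by rewrite ge_min lexx.
have m2 : Num.min d e <= e by rewrite ge_min lexx orbT.
exists (Num.min d e / 2); split; [lra|lra|].
by apply: hd; rewrite -ball_normE /= sub0r normrN gtr0_norm; lra.
Qed.

Lemma near_positive (f : R -> R) t : continuous f -> 0 < f t -> nbhs t [set x | 0 < f x].
Proof.
move=> cf h; apply: open_nbhs_nbhs; split=> //.
by apply: (open_comp (f := f)) (open_gt (y := 0)) => x _; exact: cf.
Qed.

Lemma continuous_path2 (g : R -> R * R) : continuous g -> continuous (fun t => (g t).2).
Proof. by move=> cg t; apply: (@continuous_comp _ _ _ g snd); [exact: cg|exact: cvg_snd]. Qed.

Lemma continuous_path1 (g : R -> R * R) : continuous g -> continuous (fun t => (g t).1).
Proof. by move=> cg t; apply: (@continuous_comp _ _ _ g fst); [exact: cg|exact: cvg_fst]. Qed.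

Lemma near_height (g : R -> R * R) : continuous g -> 0 < (g 0).2 < 1 ->
  nbhs 0 [set t | 0 < (g t).2 < 1].
Proof.
move=> cg /andP [h0 h1].
have n0 := near_positive (continuous_path2 cg) h0.
have n1 : nbhs 0 [set t | 0 < 1 - (g t).2].
  apply: (@near_positive (fun t => 1 - (g t).2)); last by rewrite subr_gt0.
  by move=> t; apply: cvgB; [exact: cvg_cst|exact: continuous_path2].
by apply: (filterS2 _ _ n0 n1) => t /= t0 t1; apply/andP; split; lra.
Qed.

(** The side is the limit of segments of the accordion, which a path coming from inside
would have to cross, by the intermediate value theorem. *)
Lemma approach b q c (g : R -> R * R) (e : R) : nondegenerate q -> continuous g -> 0 < e ->
  (g 0).1 = side_at (if c then q.2 else q.1) (g 0).2 -> 0 < (g 0).2 < 1 ->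
  (forall t, 0 < t < e -> ~ accordion b q (g t)) ->
  exists2 d : R, 0 < d & forall t, 0 < t < d -> 0 < (g t).2 < 1 /\
    (if c then side_at q.2 (g t).2 < (g t).1 else (g t).1 < side_at q.1 (g t).2).
Proof.
move=> wq cg e0 g0 hy hacc.
have /nbhs_ballP [d /= d0 hd] := near_height cg hy.
exists (Num.min d e); first by rewrite lt_min d0.
move=> t1; rewrite lt_min => /and3P [t10 t1d t1e].
have inh t : 0 <= t <= t1 -> 0 < (g t).2 < 1.
  move=> /andP [a0 a1]; apply: hd; rewrite -ball_normE /= sub0r normrN ger0_norm //; lra.
have hh t : 0 <= t <= t1 -> 0 <= (g t).2 <= 1.
  by move=> /inh /andP [? ?]; apply/andP; split; exact: ltW.
have t11 : 0 <= t1 <= t1 by apply/andP; split; lra.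
have t00 : 0 <= (0 : R) <= t1 by apply/andP; split; lra.
split; first exact: inh.
have off s t : (forall y, 0 <= y <= 1 -> accordion b q (point_at s y)) -> 0 < t <= t1 ->
    (g t).1 <> side_at s (g t).2.
  move=> hs /andP [a0 a1] E; apply: (hacc t); first by apply/andP; split; lra.
  rewrite (_ : g t = point_at s (g t).2); first by apply/hs/hh; apply/andP; split; lra.
  by rewrite /point_at -E -surjective_pairing.
have cross s : (forall y, 0 <= y <= 1 -> accordion b q (point_at s y)) ->
    ~ ((g 0).1 < side_at s (g 0).2 /\ side_at s (g t1).2 < (g t1).1) /\
    ~ (side_at s (g 0).2 < (g 0).1 /\ (g t1).1 < side_at s (g t1).2).
  move=> hs; pose f t := (g t).1 - side_at s (g t).2.
  have cf : continuous f.
    by move=> t; apply: (@continuous_comp _ _ _ g (fun p => p.1 - side_at s p.2));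
      [exact: cg|exact: continuous_offset].
  have nz : ~ exists2 t, 0 <= t <= t1 & f t = 0 /\ t <> 0.
    move=> [t /andP [a0 a1] [ft nt]]; apply: (off s t hs); last by move: ft; rewrite /f; lra.
    by rewrite a1 andbT lt_neqAle a0 andbT eq_sym; apply/eqP.
  split=> -[h1 h2]; apply: nz; have [||t ht ft] := @zero_between f 0 t1 cf; try exact: ltW.
  - by rewrite /f; apply/orP; left; apply/andP; split; lra.
  - by exists t => //; split=> // E; move: ft; rewrite E /f; lra.
  - by rewrite /f; apply/orP; right; apply/andP; split; lra.
  - by exists t => //; split=> // E; move: ft; rewrite E /f; lra.
case: c g0 => g0; rewrite ltNge; apply/negP => le1.
- (* otherwise some segment lies between [g t1] and the side *)
  have lt1 : (g t1).1 < side_at q.2 (g t1).2.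
    rewrite lt_neqAle le1 andbT; apply/eqP; apply: (off q.2); last by rewrite t10 lexx.
    by move=> y hy'; exact: acc_right.
  have e1 : 0 < side_at q.2 (g t1).2 - (g t1).1 by rewrite subr_gt0.
  have [s hs] := side_approx b [::] true wq e1.
  have := (cross s _).2; apply; first by move=> y /hs []; rewrite /kind addbF.
  have [_ /= /andP [s1 s2]] := hs _ (hh _ t11); have [_ /= /andP [s3 s4]] := hs _ (hh _ t00).
  by split; lra.
- have lt1 : side_at q.1 (g t1).2 < (g t1).1.
    rewrite lt_neqAle le1 andbT eq_sym; apply/eqP; apply: (off q.1); last by rewrite t10 lexx.
    by move=> y hy'; exact: acc_left.
  have e1 : 0 < (g t1).1 - side_at q.1 (g t1).2 by rewrite subr_gt0.
  have [s hs] := side_approx b [::] false wq e1.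
  have := (cross s _).1; apply; first by move=> y /hs []; rewrite /kind addbF.
  have [_ /= /andP [s1 s2]] := hs _ (hh _ t11); have [_ /= /andP [s3 s4]] := hs _ (hh _ t00).
  by split; lra.
Qed.

Section OnePattern.
Variable M : pred nat.
Hypothesis sM : sparse M.
Local Notation Y := (embedding M @` K).

Lemma layer_sub w : layer K (vertex (kind false w) (subquad false unit_quad w)) =
  zig_points (kind false w) (subquad false unit_quad w).
Proof. by apply: layer_vertex; exact: nondegenerate_unit_quad. Qed.

Lemma layer_bend j : layer K (bend j) = zig_points (odd j) (spine j).
Proof. by have := layer_sub (nseq j true); rewrite kind_spine. Qed.

Lemma not_linked_sub w p p' :
  p.1 < side_at (median (kind false w) (subquad false unit_quad w)) p.2 ->
  side_at (median (kind false w) (subquad false unit_quad w)) p'.2 < p'.1 ->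
  ~ linked K (vertex (kind false w) (subquad false unit_quad w)) p p'.
Proof. by apply: not_linked; exact: nondegenerate_unit_quad. Qed.

(** A short horizontal segment through the triangle joins the legs near the vertex; its
image under [F] is the required path. *)
Lemma legs_joined_via (F : R * R -> R * R) w : continuous F ->
  let b := kind false w in let q := subquad false unit_quad w in
  (forall p, zig_points b q p -> embedding M p = F p) ->
  (forall z, open_triangle b q z -> 0 < z.2 < 1 -> ~ Y (F z)) ->
  legs_joined (embedding M) (vertex b q).
Proof.
move=> cF b q hF htri U oU Uv; have wq : nondegenerate q by apply: nondegenerate_subquad; exact: nondegenerate_unit_quad.
have vz : zig_points b q (vertex b q) by exists b%:R; [exact: bool01|left].
have hU : nbhs (vertex b q) (F @^-1` U).
  apply: open_nbhs_nbhs; split; first by apply: open_comp oU => z _; exact: cF.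
  by rewrite /= -hF.
have /nbhs_planeP [e e0 he] := hU.
have nearb (s : side) : side_at s b%:R = (vertex b q).1 ->
    nbhs (b%:R : R) [set y | `|(vertex b q).1 - side_at s y| < e].
  move=> E; have := @continuous_side_at R s b%:R (ball (side_at s b%:R) e).
  by rewrite E => /(_ (nbhsx_ballx _ _ e0)).
have n1 := nearb (left_leg b q) erefl.
have n2 := nearb (right_leg b q) (esym (leg_eq b q)).
have /nbhs_ballP [d /= d0 hd] : nbhs (b%:R : R) ([set y | `|(vertex b q).1 - side_at (left_leg b q) y| < e]
   `&` [set y | `|(vertex b q).1 - side_at (right_leg b q) y| < e]) by exact: filterI.
(* a height close to that of the vertex, but different from it *)
have [y [hy yb yd ye]] : exists y, [/\ 0 < y < 1, y != b%:R, `|b%:R - y| < d & `|b%:R - y| < e].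
  pose m := Num.min (Num.min d e) 1 / 2.
  have mm : 0 < Num.min (Num.min d e) 1 by rewrite !lt_min d0 e0 ltr01.
  have [m1 [m2 m3]] : Num.min (Num.min d e) 1 <= d /\ Num.min (Num.min d e) 1 <= e /\
      Num.min (Num.min d e) 1 <= 1 by rewrite !ge_min !lexx ?orbT.
  have [m4 m5] : 0 < m /\ m < Num.min (Num.min d e) 1 by rewrite /m; split; lra.
  have M1 : `|b%:R - flip b m| = m.
    by rewrite -{1}flip0 norm_flip sub0r normrN gtr0_norm.
  have m01 : 0 < flip b m < 1 by rewrite /flip; case: (b); apply/andP; split; lra.
  exists (flip b m); split=> //; try by rewrite M1; lra.
  by apply/eqP => E; move: M1; rewrite E subrr normr0; lra.
have hy' : 0 <= y <= 1 by case/andP: hy => *; apply/andP; split; exact: ltW.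
have lt := leg_lt wq hy' yb.
exists (point_at (left_leg b q) y), (point_at (right_leg b q) y),
  (F \o seg (point_at (left_leg b q) y) (point_at (right_leg b q) y)).
have za : zig_points b q (point_at (left_leg b q) y) by exists y => //; left.
have zb : zig_points b q (point_at (right_leg b q) y) by exists y => //; right.
split; split.
- by rewrite layer_sub.
- by rewrite layer_sub.
- by case=> _ /eqP; exact/negP.
- by case=> _ /eqP; exact/negP.
- by apply: not_linked_sub; rewrite medianE /= -/b -/q; lra.
- by move=> t; apply: continuous_comp; [exact: continuous_seg|exact: cF].
- by rewrite hF // /seg /= !subr0 !mul1r !mul0r !addr0.
- by rewrite hF // /seg /= !subrr !mul1r !mul0r !add0r.
- move=> t /andP [t0 t1].
  have [h1 h2] : `|(vertex b q).1 - side_at (left_leg b q) y| < e /\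
      `|(vertex b q).1 - side_at (right_leg b q) y| < e by apply: hd.
  apply: he => /=; last by rewrite (_ : (1 - t) * y + t * y = y) //; ring.
  move: h1 h2; rewrite !ltr_norml => /andP [a1 a2] /andP [a3 a4].
  set A := side_at (left_leg b q) y in a1 a2 *; set B := side_at (right_leg b q) y in a3 a4 *.
  set V := (vertex b q).1 in a1 a2 a3 a4 *.
  rewrite (_ : V - _ = (1 - t) * (V - A) + t * (V - B)); last by rewrite /vertex /=; ring.
  have u1 : (1 - t) * (V - A) <= (1 - t) * Num.max (V - A) (V - B).
    by rewrite ler_wpM2l ?subr_ge0 // le_max lexx.
  have u2 : t * (V - B) <= t * Num.max (V - A) (V - B).
    by rewrite ler_wpM2l // le_max lexx orbT.
  have u3 : (1 - t) * Num.min (V - A) (V - B) <= (1 - t) * (V - A).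
    by rewrite ler_wpM2l ?subr_ge0 // ge_min lexx.
  have u4 : t * Num.min (V - A) (V - B) <= t * (V - B).
    by rewrite ler_wpM2l // ge_min lexx orbT.
  have u5 : Num.max (V - A) (V - B) < e by rewrite gt_max; apply/andP; split; lra.
  have u6 : - e < Num.min (V - A) (V - B) by rewrite lt_min; apply/andP; split; lra.
  by apply/andP; split; lra.
- move=> t /andP [t0 t1] /=; apply: htri; rewrite /open_triangle /seg /= (_ : (1 - t) * y + t * y = y) //; try ring.
  have : 0 < t * (side_at (right_leg b q) y - side_at (left_leg b q) y).
    by apply: mulr_gt0; lra.
  have : 0 < (1 - t) * (side_at (right_leg b q) y - side_at (left_leg b q) y).
    by apply: mulr_gt0; lra.
  by move=> *; apply/andP; split; lra.
Qed.

End OnePattern.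

End Crossing.

(** * Arcs exist at the vertices that are not flipped *)

Section Flipped.
Context {R : realType}.
Local Notation side := (@side R).
Implicit Types (b c : bool) (q : side * side) (w u : seq bool) (s : side) (k l j n : nat)
  (t y : R) (p z : R * R) (M : pred nat).

Local Notation K := (accordion false (@unit_quad R)).

Lemma strictly_in_cell k l p : 0 <= p.2 <= 1 ->
  side_at (cell k).1 p.2 < p.1 < side_at (cell k).2 p.2 -> in_cell l p -> l = k.
Proof.
move=> hy /andP [h1 h2] [_ /andP [h3 h4]]; apply/eqP; rewrite eqn_leq.
rewrite cell1 in h1 h3; rewrite cell2 in h2 h4.
have [_ g2 _ _ _] := leg_gaps (odd l) (nondegenerate_spine l) hy.
have [_ g2' _ _ _] := leg_gaps (odd k) (nondegenerate_spine k) hy.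
apply/andP; split; rewrite leqNgt; apply/negP => kl.
  by have := spine_left_le hy kl; rewrite spineS1; lra.
by have := spine_left_le hy kl; rewrite spineS1; lra.
Qed.

Lemma bend_cells j l p : zig_points (odd j) (spine j) p -> in_cell l p -> l = j \/ l = j.+1.
Proof.
move=> [y hy hp] [_ /andP [h3 h4]]; rewrite cell1 in h3; rewrite cell2 in h4.
have [f1 f2 _ _ _] := leg_gaps (odd j) (nondegenerate_spine j) hy.
have [g1 g2 g3 _ _] := leg_gaps (odd l) (nondegenerate_spine l) hy.
have py : p.2 = y by case: hp => ->.
have px : side_at (left_leg (odd j) (spine j)) y <= p.1 <=
    side_at (right_leg (odd j) (spine j)) y.
  by case: hp => -> /=; rewrite ?lexx ?andbT.
rewrite py in h3 h4; case/andP: px => p1 p2.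
have [lj|jl] := ltnP l j.
  by exfalso; have := spine_left_le hy lj; rewrite spineS1; lra.
move: jl; rewrite leq_eqVlt => /orP [/eqP ->|]; first by left.
rewrite leq_eqVlt => /orP [/eqP ->|jl]; first by right.
by exfalso; have := spine_left_le hy jl; have := spine_left_lt j.+1 hy; rewrite (spineS1 j); lra.
Qed.

Lemma cells_meet k p : in_cell k p -> in_cell k.+1 p -> p = bend k.
Proof.
move=> [hy /andP [_ h1]] [_ /andP [h2 _]]; rewrite cell2 in h1; rewrite cell1 spineS1 in h2.
have [_ g2 _ _ _] := leg_gaps (odd k) (nondegenerate_spine k) hy.
have E : p.1 = side_at (left_leg (odd k) (spine k)) p.2 by lra.
have [yE|yN] := eqVneq p.2 (odd k)%:R; last first.
  by exfalso; have := leg_lt (nondegenerate_spine k) hy yN; lra.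
by rewrite /bend /vertex /point_at -yE -E -surjective_pairing.
Qed.

Lemma word_cases w : (exists j, w = nseq j true) \/ (exists k u, w = nseq k true ++ false :: u).
Proof.
elim: w => [|[] w IH]; first by left; exists 0%N.
- case: IH => [[j ->]|[k [u ->]]]; [by left; exists j.+1|by right; exists k.+1, u].
- by right; exists 0%N, w.
Qed.

Lemma cell_sub k u :
  subquad false (@unit_quad R) (nseq k true ++ false :: u) = subquad (~~ odd k) (cell k) u /\
  kind false (nseq k true ++ false :: u) = kind (~~ odd k) u.
Proof. by rewrite subquad_cat kind_cat kind_spine kind_cons. Qed.

Lemma acc_cell k p : accordion (~~ odd k) (cell k) p -> K p /\ in_cell k p.
Proof.
move=> h; split; last by case: h.
have [E1 E2] := cell_sub k [::].
apply: (accordion_sub (w := nseq k true ++ [:: false])); first exact: nondegenerate_unit_quad.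
by rewrite E1 E2 /kind addbF.
Qed.

Section OnePattern.
Variable M : pred nat.
Hypothesis sM : sparse M.
Local Notation Y := (embedding M @` K).

Definition flipped j : bool := M j || M j.+1.

Lemma embedding_bend j : embedding M (@bend R j) = bend j.
Proof.
have [[l [Ml pl E]]|[_ E]] := glue_cases fold (@bend R j) sM; rewrite /embedding E //.
have zb : zig_points (odd j) (spine j) (@bend R j) by exists (odd j)%:R; [exact: bool01|left].
by case: (bend_cells zb pl) => ->; [exact: fold_bend|exact: foldS_bend].
Qed.

Lemma embedding_unmirrored k p : ~~ M k -> in_cell k p -> embedding M p = p.
Proof.
move=> nM pk; have [[l [Ml pl E]]|[_ E]] := glue_cases fold p sM; rewrite /embedding E //.
have [kl|kl|kl] := ltngtP k l; last by rewrite kl Ml in nM.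
- move: kl; rewrite leq_eqVlt => /orP [/eqP kl|kl]; last by case: (in_cell_far kl pk).
  by rewrite -kl in pl *; rewrite (cells_meet pk pl) foldS_bend.
- move: kl; rewrite leq_eqVlt => /orP [/eqP kl|kl]; last by case: (in_cell_far kl pl).
  by rewrite -kl in pk; rewrite (cells_meet pl pk) fold_bend.
Qed.

(** At a bend without mirrored cells nothing has changed, and any other vertex lies
inside of a cell with both of its legs, so that both are moved by the same
homeomorphism of the plane. *)
Lemma joined_unflipped w :
  (forall j, w = nseq j true -> ~~ flipped j) ->
  legs_joined (embedding M) (vertex (kind false w) (subquad false (@unit_quad R) w)).
Proof.
have cid' : continuous (id : R * R -> R * R) by move=> z; exact: cvg_id.
move=> hw; case: (word_cases w) => [[j E]|[k [u E]]].
- have := hw j E; rewrite /flipped negb_or => /andP [n1 n2].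
  have H := @legs_joined_via R M id w cid'.
  apply: H => [p|z]; rewrite E kind_spine => hz.
  + apply: embedding_id => l Ml pl.
    by case: (bend_cells hz pl) => El; [rewrite El (negbTE n1) in Ml|rewrite El (negbTE n2) in Ml].
  + by move=> _ Yz; exact: (image_tri sM Yz hz).
- have [Eq Eb] := cell_sub k u; have wc := @nondegenerate_cell R k.
  have strict z : 0 <= z.2 <= 1 ->
      side_at (left_leg (kind (~~ odd k) u) (subquad (~~ odd k) (cell k) u)) z.2 <= z.1 <=
      side_at (right_leg (kind (~~ odd k) u) (subquad (~~ odd k) (cell k) u)) z.2 ->
      side_at (cell k).1 z.2 < z.1 < side_at (cell k).2 z.2.
    move=> hy /andP [z1 z2].
    have [h1 h2] := subquad_le (~~ odd k) u wc hy.
    have [g1 g2 g3 _ _] := leg_gaps (kind (~~ odd k) u) (nondegenerate_subquad (~~ odd k) u wc) hy.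
    by apply/andP; split; lra.
  have inside z : 0 <= z.2 <= 1 -> side_at (cell k).1 z.2 < z.1 < side_at (cell k).2 z.2 ->
      in_cell k z.
    by move=> hy /andP [z1 z2]; split=> //; rewrite !ltW.
  have strict_zig p : zig_points (kind (~~ odd k) u) (subquad (~~ odd k) (cell k) u) p ->
      0 <= p.2 <= 1 /\ side_at (cell k).1 p.2 < p.1 < side_at (cell k).2 p.2.
    move=> [y hy hp]; have -> : p.2 = y by case: hp => ->.
    split=> //; have [_ g2 _ _ _] := leg_gaps (kind (~~ odd k) u) (nondegenerate_subquad (~~ odd k) u wc) hy.
    have py : p.2 = y by case: hp => ->.
    by rewrite -py; apply: strict; rewrite py //; case: hp => -> /=; rewrite lexx ?andbT.
  have strict_tri z : open_triangle (kind (~~ odd k) u) (subquad (~~ odd k) (cell k) u) z -> 0 < z.2 < 1 ->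
      [/\ 0 <= z.2 <= 1, side_at (cell k).1 z.2 < z.1 < side_at (cell k).2 z.2 & ~ K z].
    move=> hz /andP [y0 y1]; have hy : 0 <= z.2 <= 1 by rewrite !ltW.
    split=> //; first by apply: strict => //; case/andP: hz => *; rewrite !ltW.
    by move=> [_ /(_ w)]; rewrite E Eq Eb.
  have [Mk|nMk] := boolP (M k).
  + apply: (legs_joined_via (F := fold k)); first exact: continuous_fold.
      move=> p; rewrite E Eq Eb => /strict_zig [hy hp].
      by apply: embedding_cell => //; exact: inside.
    move=> z; rewrite E Eq Eb => hz /(strict_tri z hz) [hy hx nK].
    by move/(image_fold sM Mk (inside z hy hx)).
  + apply: (legs_joined_via cid').
      move=> p; rewrite E Eq Eb => /strict_zig [hy hp].
      by apply: (@embedding_unmirrored k) => //; exact: inside.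
    move=> z; rewrite E Eq Eb => hz /(strict_tri z hz) [hy hx nK].
    rewrite image_off // => l Ml pl.
    by move: Ml; rewrite (strictly_in_cell hy hx pl) (negbTE nMk).
Qed.

End OnePattern.

End Flipped.

(** * Barriers that are graphs over the height *)

Section NoPath.
Context {R : realType}.
Local Notation side := (@side R).
Implicit Types (b c e : bool) (q : side * side) (w u : seq bool) (s : side) (k l j n : nat)
  (t y X d : R) (p z x : R * R) (g : R -> R * R).

Local Notation K := (accordion false (@unit_quad R)).

(** The vertical line of abscissa [X] in the chart. *)
Definition curve q X y : R := side_at q.1 (clamp y) + X * width q (clamp y).

Lemma continuous_curve q (f : R -> R) : continuous f -> continuous (fun y => curve q (f y) y).
Proof.
move=> cf y; apply: cvgD; first exact: (@continuous_comp _ _ _ clamp _ y (@continuous_clamp R y)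
  (@continuous_side_at R q.1 (clamp y))).
apply: cvgM; first exact: cf.
by apply: cvgB; exact: (@continuous_comp _ _ _ clamp _ y (@continuous_clamp R y)
  (@continuous_side_at R _ (clamp y))).
Qed.

Lemma curve_chart q p : nondegenerate q -> p.1 = curve q (chart q p).1 p.2.
Proof. by move=> wq; rewrite -{1}(chartK wq p). Qed.

Lemma curve_lt q X X' y : nondegenerate q -> X < X' -> curve q X y < curve q X' y.
Proof. by move=> wq h; rewrite /curve ltrD2l ltr_pM2r // width_clamp. Qed.

Lemma curve0 q y : curve q 0 y = side_at q.1 (clamp y).
Proof. by rewrite /curve mul0r addr0. Qed.

Lemma curve1 q y : curve q 1 y = side_at q.2 (clamp y).
Proof. by rewrite /curve mul1r /width addrC subrK. Qed.

(** The curves bound a sector at heights with [0 <= flip e y], where they belong to [Z],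
and are in the wrong order elsewhere.  So the minimum of the signed horizontal
distances to them is positive exactly inside of the sector, and along the path it
vanishes nowhere. *)
Lemma crossing (Z : set (R * R)) e d (al be : R -> R) g :
  continuous al -> continuous be -> continuous g ->
  (forall y, flip e y < 0 -> be y < al y) ->
  (forall y, 0 <= flip e y < d -> Z (al y, y) /\ Z (be y, y)) ->
  (forall t, 0 <= t <= 1 -> flip e (g t).2 < d) ->
  (forall t, 0 < t < 1 -> ~ Z (g t)) ->
  (exists2 t, 0 < t < 1 & al (g t).2 < (g t).1 < be (g t).2) ->
  (exists2 t, 0 < t < 1 & (g t).1 < al (g t).2 \/ be (g t).2 < (g t).1) -> False.
Proof.
move=> cal cbe cg hneg hZ hd hg [t1 ht1 pos] [t0 ht0 neg].
pose m t := Num.min ((g t).1 - al (g t).2) (be (g t).2 - (g t).1).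
have c1 := continuous_path1 cg; have c2 := continuous_path2 cg.
have cm : continuous m.
  move=> t; apply: (@continuous_min _ _ (fun t => (g t).1 - al (g t).2)
    (fun t => be (g t).2 - (g t).1)).
  - apply: cvgB; first exact: c1.
    exact: (@continuous_comp _ _ _ (fun t => (g t).2) al t (c2 t) (cal _)).
  - apply: cvgB; last exact: c1.
    exact: (@continuous_comp _ _ _ (fun t => (g t).2) be t (c2 t) (cbe _)).
have m1 : 0 < m t1 by rewrite /m lt_min !subr_gt0.
have m0 : m t0 < 0 by rewrite /m gt_min !subr_lt0; case: neg => ->; rewrite ?orbT.
have [t ht mt] : exists2 t, 0 < t < 1 & m t = 0.
  move: ht0 ht1 => /andP [a0 a1] /andP [b0 b1].
  have [le01|/ltW le10] := leP t0 t1.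
  - have [|t /andP [u0 u1] mt] := zero_between cm le01; first by rewrite m0 m1.
    by exists t => //; apply/andP; split; lra.
  - have [|t /andP [u0 u1] mt] := zero_between cm le10; first by rewrite m0 m1 orbT.
    by exists t => //; apply/andP; split; lra.
have [A B] : 0 <= (g t).1 - al (g t).2 /\ 0 <= be (g t).2 - (g t).1.
  by split; rewrite -mt /m ge_min lexx ?orbT.
have [neg'|pos'] := ltP (flip e (g t).2) 0.
  by have := hneg _ neg'; lra.
have [|Za Zb] := hZ (g t).2.
  by rewrite pos' hd //; case/andP: ht => *; rewrite !ltW.
have [E|E] : (g t).1 = al (g t).2 \/ (g t).1 = be (g t).2.
  by move: mt; rewrite /m /Num.min; case: ifP => _ h; [left|right]; lra.
- by apply: (hg t ht); rewrite (surjective_pairing (g t)) E.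
- by apply: (hg t ht); rewrite (surjective_pairing (g t)) E.
Qed.

Section OnePattern.
Variable M : pred nat.
Hypothesis sM : sparse M.
Local Notation Y := (embedding M @` K).

Lemma acc_cell_image k z : ~~ M k -> accordion (~~ odd k) (cell k) z -> Y z.
Proof. by move=> nM /acc_cell [Kz zk]; exists z => //; exact: (embedding_unmirrored sM nM zk). Qed.

Lemma acc_cell_fold k z : M k -> accordion (~~ odd k) (cell k) z -> Y (fold k z).
Proof. by move=> Mk /acc_cell [Kz zk]; apply/image_fold. Qed.

Lemma side_in_cell k c y : 0 <= y <= 1 ->
  accordion (~~ odd k) (cell k) (point_at (if c then (cell k).2 else (cell k).1) y).
Proof. by move=> hy; case: c; [apply: acc_right|apply: acc_left] => //; exact: nondegenerate_cell. Qed.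

Lemma flip_open e y d : 0 <= y <= 1 -> y != e%:R -> flip e y < d -> d <= 1 ->
  0 < flip e y /\ 0 < y < 1.
Proof.
move=> hy ne fd d1; have f0 : 0 < flip e y.
  rewrite lt_neqAle; have := flip01 e y; rewrite hy => /andP [-> _]; rewrite andbT eq_sym.
  by apply: contra ne => /eqP E; rewrite -(flipK e y) E flip0.
by split=> //; rewrite -(flip01_strict e) f0; lra.
Qed.

(** This is [approach] for a cell that the embedding leaves in place. *)
Lemma start_unmirrored k c y g : ~~ M k -> continuous g -> 0 < y < 1 ->
  g 0 = point_at (if c then (cell k).2 else (cell k).1) y ->
  (forall t, 0 < t < 1 -> ~ Y (g t)) ->
  exists2 d, 0 < d & forall t, 0 < t < d -> 0 < (g t).2 < 1 /\
    (if c then side_at (cell k).2 (g t).2 < (g t).1 else (g t).1 < side_at (cell k).1 (g t).2).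
Proof.
move=> nM cg hy g0 hg.
apply: (@approach R (~~ odd k) (cell k) c g 1) => //; first exact: nondegenerate_cell.
- by rewrite g0; case: c {g0}.
- by rewrite g0.
- by move=> t ht /(acc_cell_image nM); exact: hg.
Qed.

(** By [approach] the path that is mirrored back stays outside of the cell, on the side
of the original leg; its image therefore stays on the opposite side of the leg. *)
Lemma start_mirrored k c y g : M k -> continuous g -> 0 < y < 1 ->
  g 0 = fold k (point_at (if c then (cell k).2 else (cell k).1) y) ->
  (forall t, 0 < t < 1 -> ~ Y (g t)) ->
  exists2 d, 0 < d & forall t, 0 < t < d ->
    let X := shift_of (scale k) (flip (~~ odd k) (g t).2) in
    if c then (g t).1 < curve (cell k) X (g t).2
    else curve (cell k) (1 + X) (g t).2 < (g t).1.
Proof.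
move=> Mk cg hy g0 hg; have wc := @nondegenerate_cell R k.
pose g' := unfold k \o g.
have cg' : continuous g'.
  by move=> t; apply: continuous_comp; [exact: cg|exact: continuous_unfold].
have g'0 : g' 0 = point_at (if c then (cell k).2 else (cell k).1) y by rewrite /g' /= g0 foldK.
have [|||d d0 hd] := @approach R (~~ odd k) (cell k) c g' 1 wc cg' ltr01.
- by rewrite g'0; case: (c).
- by rewrite g'0.
- by move=> t ht /(acc_cell_fold Mk); rewrite /g' /= unfoldK; exact: hg.
exists d => // t ht; have [h01 hside] := hd t ht.
have hy' : 0 <= (g' t).2 <= 1 by case/andP: h01 => *; rewrite !ltW.
have := mirror_source (~~ odd k) (scale k) (g' t) wc.
rewrite -/(fold k (g' t)) (_ : fold k (g' t) = g t) => [S|]; last exact: unfoldK.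
have E := curve_chart (g t) wc.
move: hside; case: (c) => hside; cbv zeta; rewrite E; apply: curve_lt => //.
- by move: hside; rewrite -chart_gt1 //; lra.
- by move: hside; rewrite -chart_lt0 //; lra.
Qed.

End OnePattern.

End NoPath.

(** * No arcs exist at the flipped bends *)

Section NotJoined.
Context {R : realType}.
Local Notation side := (@side R).
Implicit Types (b c e : bool) (q : side * side) (w u : seq bool) (s : side) (k l j n : nat)
  (t y X d : R) (p z x : R * R) (g : R -> R * R).

Local Notation K := (accordion false (@unit_quad R)).

Lemma continuous_reverse g : continuous g -> continuous (fun t => g (1 - t)).
Proof.
move=> cg t; apply: (@continuous_comp _ _ _ (fun t => 1 - t) g); last exact: cg.
by apply: cvgB; [exact: cvg_cst|exact: cvg_id].
Qed.

Lemma flip_height e y d : 0 <= flip e y < d -> d <= 1 -> 0 <= y <= 1.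
Proof. by move=> /andP [h0 h1] d1; rewrite -(flip01 e) h0; lra. Qed.

Lemma flip_flip e y : flip e (flip (~~ e) y) = 1 - y.
Proof. by case: e; rewrite /flip /=; ring. Qed.

Section OnePattern.
Variable M : pred nat.
Hypothesis sM : sparse M.
Local Notation Y := (embedding M @` K).

(** The path starts at the unmirrored left leg inside of the sector between the legs, since
it cannot come from the left cell, and arrives at the mirrored right leg outside. *)
Lemma no_path_mirrored_right j y y' g : M j.+1 -> continuous g ->
  0 <= y <= 1 -> y != (odd j)%:R -> 0 <= y' <= 1 -> y' != (odd j)%:R ->
  g 0 = embedding M (point_at (cell j).2 y) -> g 1 = embedding M (point_at (cell j.+1).1 y') ->
  (forall t, 0 <= t <= 1 -> flip (odd j) (g t).2 < scale j.+1) ->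
  (forall t, 0 < t < 1 -> ~ Y (g t)) -> False.
Proof.
move=> Mj cg hy ny hy' ny' g0 g1 hU hg.
have nMj : ~~ M j by apply/negP => /sM.2; rewrite Mj.
have ee : ~~ odd j.+1 = odd j by rewrite /= negbK.
have wc := @nondegenerate_cell R j.+1; have hd := @scale_bound R j.+1.
set d := scale j.+1 in hU hd; have /andP [d0 d2] := hd.
have d1 : d <= 1 by lra.
pose al y := side_at (cell j).2 (clamp y) : R.
pose be y := curve (cell j.+1) (1 + shift_of d (flip (odd j) y)) y.
have cal : continuous al.
  by move=> v; exact: (@continuous_comp _ _ _ clamp _ v (@continuous_clamp R v)
    (@continuous_side_at R _ (clamp v))).
have cbe : continuous be.
  apply: continuous_curve => v; apply: cvgD; first exact: cvg_cst.
  exact: (@continuous_comp _ _ _ (flip (odd j)) _ v (@continuous_flip R _ v)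
    (@continuous_shift_of R d _)).
have beE v : flip (odd j) v < d -> be v = curve (cell j.+1) (flip (odd j) v / d) v.
  by move=> h; rewrite /be shift_low ?(ltW h) // subrKC.
have g0' : g 0 = point_at (cell j).2 y.
  by rewrite g0 (@embedding_unmirrored R M sM j) //; have [] := side_in_cell j true hy.
have kl := side_in_cell j.+1 false hy'.
have g1' : g 1 = fold j.+1 (point_at (cell j.+1).1 y').
  by rewrite g1 (embedding_cell sM Mj) //; have [] := kl.
have [fy0 y01] : 0 < flip (odd j) y /\ 0 < y < 1.
  apply: (@flip_open R _ _ d) => //.
  by have := hU 0; rewrite g0' /=; apply; rewrite lexx ler01.
(* on the side through the fixed corner, [mirror] multiplies [flip] by [1 - d] *)
have [fy0' y01'] : 0 < flip (odd j) y' /\ 0 < y' < 1.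
  apply: (@flip_open R _ _ (d / (1 - d))) => //; last by rewrite ler_pdivrMr; lra.
  have := hU 1; rewrite g1' /fold ee mirror_left // unchart2 flipK lexx ler01 => /(_ isT).
  by rewrite -/d ltr_pdivlMr; lra.
have fy : flip (odd j) y < d by have := hU 0; rewrite g0' /=; apply; rewrite lexx ler01.
apply: (@crossing R Y (odd j) d al be g) => //.
- move=> v zneg; rewrite beE; last by lra.
  have : flip (odd j) v / d < 0 by rewrite pmulr_llt0 // invr_gt0.
  move=> /(@curve_lt R (cell j.+1) _ _ v wc) /lt_le_trans; apply.
  by rewrite curve0 /al (clamp_beyond zneg) cell1 spineS1 cell2 leg_eq.
- move=> v hz; have /andP [z0 zd] := hz; have hz01 := flip_height hz d1; split.
    apply: (acc_cell_image sM nMj); rewrite /al clamp_id //.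
    exact: (side_in_cell j true hz01).
  pose z0' := flip (odd j) (flip (odd j) v / (1 - d)).
  have hz0' : 0 <= z0' <= 1.
    rewrite flip01 divr_ge0 ?subr_ge0 //=; rewrite ler_pdivrMr; lra.
  have := acc_cell_fold sM Mj (side_in_cell j.+1 false hz0').
  rewrite /fold ee mirror_left // flipK -/d mulrC divfK ?flipK //.
  by rewrite subr_eq0 gt_eqF //; lra.
- have [d1' d1'0 hd1'] := @start_unmirrored R M sM j true y g nMj cg y01 g0' hg.
  have pos : 0 < be (g 0).2 - (g 0).1.
    rewrite g0' /= beE // subr_gt0.
    apply: lt_le_trans (_ : curve (cell j.+1) 0 y <= _).
      rewrite curve0 clamp_id // cell1 spineS1; apply: leg_lt => //; exact: nondegenerate_spine.
    by apply/ltW/curve_lt => //; rewrite divr_gt0.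
  have cf : continuous (fun t => be (g t).2 - (g t).1).
    move=> t; apply: cvgB; last exact: continuous_path1.
    apply: (@continuous_comp _ _ _ (fun t => (g t).2) be); last exact: cbe.
    exact: continuous_path2.
  have m0 : 0 < Num.min d1' 1 by rewrite lt_min d1'0 ltr01.
  have [t [t0]] := pick_small (near_positive cf pos) m0.
  rewrite lt_min => /andP [td t1] /= tp.
  exists t; first by rewrite t0.
  have [h01 hs] := hd1' t (introT andP (conj t0 td)).
  rewrite /al clamp_id; last by case/andP: h01 => *; rewrite !ltW.
  by rewrite hs -subr_gt0.
- have [d1' d1'0 hd1'] := @start_mirrored R M sM j.+1 false y' (fun t => g (1 - t)) Mj
    (continuous_reverse cg) y01' (etrans (congr1 g (subr0 1)) g1')
    ltac:(by move=> t /andP [? ?]; apply: hg; apply/andP; split; lra).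
  have [m0 m1] : 0 < Num.min d1' 1 /\ Num.min d1' 1 <= 1.
    by rewrite lt_min d1'0 ltr01 ge_min lexx orbT.
  have m2 : Num.min d1' 1 <= d1' by rewrite ge_min lexx.
  pose t := Num.min d1' 1 / 2.
  have tt : 0 < t < d1' by rewrite /t; apply/andP; split; lra.
  have := hd1' t tt; rewrite ee => h.
  by exists (1 - t); [rewrite /t; apply/andP; split; lra|right].
Qed.

(** As before, except that the path now starts outside of the sector and arrives inside. *)
Lemma no_path_mirrored_left j y y' g : M j -> continuous g ->
  0 <= y <= 1 -> y != (odd j)%:R -> 0 <= y' <= 1 -> y' != (odd j)%:R ->
  g 0 = embedding M (point_at (cell j).2 y) -> g 1 = embedding M (point_at (cell j.+1).1 y') ->
  (forall t, 0 <= t <= 1 -> flip (odd j) (g t).2 < scale j) ->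
  (forall t, 0 < t < 1 -> ~ Y (g t)) -> False.
Proof.
move=> Mj cg hy ny hy' ny' g0 g1 hU hg.
have nMj : ~~ M j.+1 by exact: sM.2.
have wc := @nondegenerate_cell R j; have hd := @scale_bound R j.
set d := scale j in hU hd; have /andP [d0 d2] := hd.
have d1 : d <= 1 by lra.
pose al y := curve (cell j) (shift_of d (flip (~~ odd j) y)) y.
pose be y := side_at (cell j.+1).1 (clamp y) : R.
have cbe : continuous be.
  by move=> v; exact: (@continuous_comp _ _ _ clamp _ v (@continuous_clamp R v)
    (@continuous_side_at R _ (clamp v))).
have cal : continuous al.
  apply: continuous_curve => v.
  exact: (@continuous_comp _ _ _ (flip (~~ odd j)) _ v (@continuous_flip R _ v)
    (@continuous_shift_of R d _)).
have alE v : flip (odd j) v < d -> al v = curve (cell j) (1 - flip (odd j) v / d) v.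
  by move=> h; rewrite /al flip_negl shift_of1 // shift_low ?(ltW h) // opprB.
have g1' : g 1 = point_at (cell j.+1).1 y'.
  by rewrite g1 (@embedding_unmirrored R M sM j.+1) //; have [] := side_in_cell j.+1 false hy'.
have kl := side_in_cell j true hy.
have g0' : g 0 = fold j (point_at (cell j).2 y).
  by rewrite g0 (embedding_cell sM Mj) //; have [] := kl.
(* on the side through the fixed corner, [mirror] multiplies [flip] by [1 - d] *)
have [fy0 y01] : 0 < flip (odd j) y /\ 0 < y < 1.
  apply: (@flip_open R _ _ (d / (1 - d))) => //; last by rewrite ler_pdivrMr; lra.
  have := hU 0; rewrite g0' /fold mirror_right // unchart2 lexx ler01 => /(_ isT).
  by rewrite -/d flip_flip flip_negl ltr_pdivlMr; lra.
have fy' : flip (odd j) y' < d by have := hU 1; rewrite g1' /=; apply; rewrite lexx ler01.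
have [fy0' y01'] : 0 < flip (odd j) y' /\ 0 < y' < 1 by exact: (@flip_open R _ _ d).
apply: (@crossing R Y (odd j) d al be g) => //.
- move=> v zneg; rewrite alE; last by lra.
  have : 1 < 1 - flip (odd j) v / d.
    by rewrite ltrDl oppr_gt0 pmulr_llt0 // invr_gt0.
  move=> /(@curve_lt R (cell j) _ _ v wc); apply: le_lt_trans.
  by rewrite curve1 /be (clamp_beyond zneg) cell1 spineS1 cell2 leg_eq.
- move=> v hz; have /andP [z0 zd] := hz; have hz01 := flip_height hz d1; split; last first.
    apply: (acc_cell_image sM nMj); rewrite /be clamp_id //.
    exact: (side_in_cell j.+1 false hz01).
  pose z0' := flip (odd j) (flip (odd j) v / (1 - d)).
  have hz0' : 0 <= z0' <= 1.
    rewrite flip01 divr_ge0 ?subr_ge0 //=; rewrite ler_pdivrMr; lra.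
  have := acc_cell_fold sM Mj (side_in_cell j true hz0').
  rewrite /fold mirror_right // -/d.
  have -> : (1 - d) * flip (~~ odd j) z0' + d = flip (~~ odd j) v.
    rewrite !flip_negl flipK mulrBr mulr1 mulrCA divff ?mulr1; first by ring.
    by rewrite subr_eq0 gt_eqF //; lra.
  by rewrite flipK.
- have [d1' d1'0 hd1'] := @start_unmirrored R M sM j.+1 false y' (fun t => g (1 - t)) nMj
    (continuous_reverse cg) y01' (etrans (congr1 g (subr0 1)) g1')
    ltac:(by move=> t /andP [? ?]; apply: hg; apply/andP; split; lra).
  have pos : 0 < (g (1 - 0)).1 - al (g (1 - 0)).2.
    rewrite subr0 g1' /= alE // subr_gt0.
    apply: (@lt_trans _ _ (curve (cell j) 1 y')).
      by apply: curve_lt => //; rewrite ltrBlDr ltrDl divr_gt0.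
    by rewrite curve1 clamp_id // spineS1; apply: leg_lt => //; exact: nondegenerate_spine.
  have cr := continuous_reverse cg.
  have cf : continuous (fun t => (g (1 - t)).1 - al (g (1 - t)).2).
    move=> t; apply: cvgB; first exact: (continuous_path1 cr).
    apply: (@continuous_comp _ _ _ (fun t => (g (1 - t)).2) al); last exact: cal.
    exact: (continuous_path2 cr).
  have m0 : 0 < Num.min d1' 1 by rewrite lt_min d1'0 ltr01.
  have [t [t0]] := pick_small (near_positive cf pos) m0.
  rewrite lt_min => /andP [td t1] /= tp.
  exists (1 - t); first by apply/andP; split; lra.
  have [h01 hs] := hd1' t (introT andP (conj t0 td)).
  rewrite -subr_gt0 tp /=.
  by rewrite /be clamp_id //; case/andP: h01 => *; rewrite !ltW.
- have [d1' d1'0 hd1'] := @start_mirrored R M sM j true y g Mj cg y01 g0' hg.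
  have [m0 m1] : 0 < Num.min d1' 1 /\ Num.min d1' 1 <= 1.
    by rewrite lt_min d1'0 ltr01 ge_min lexx orbT.
  have m2 : Num.min d1' 1 <= d1' by rewrite ge_min lexx.
  pose t := Num.min d1' 1 / 2.
  have tt : 0 < t < d1' by rewrite /t; apply/andP; split; lra.
  by exists t; [rewrite /t; apply/andP; split; lra|left; exact: (hd1' t tt)].
Qed.

Lemma linked_leg j c y y' : 0 <= y <= 1 -> 0 <= y' <= 1 ->
  let s := if c then (cell j).2 else (cell j.+1).1 in
  point_at s y <> bend j -> point_at s y' <> bend j -> linked K (bend j) (point_at s y) (point_at s y').
Proof.
move=> hy hy'; have [E1 _] := @cell_sub R j [::]; have [E2 _] := @cell_sub R j.+1 [::].
case: c => s n1 n2.
- have := @linked_side R false unit_quad (nseq j true ++ [:: false]) true y y' (bend j)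
    nondegenerate_unit_quad hy hy'.
  by rewrite E1; apply; apply/nesym.
- have := @linked_side R false unit_quad (nseq j.+1 true ++ [:: false]) false y y' (bend j)
    nondegenerate_unit_quad hy hy'.
  by rewrite E2; apply; apply/nesym.
Qed.

(** Two points that the bend separates lie on different legs, so one of the lemmas
[no_path_mirrored_left] and [no_path_mirrored_right] applies, to the path or to its
reverse. *)
Lemma not_joined_flipped j : flipped M j -> ~ legs_joined (embedding M) (@bend R j).
Proof.
move=> fj joined.
pose d : R := if M j then scale j else scale j.+1.
have d0 : 0 < d.
  have /andP [s1 _] := @scale_bound R j; have /andP [s2 _] := @scale_bound R j.+1.
  by rewrite /d; case: ifP.
pose U := [set p : R * R | flip (odd j) p.2 < d].
have oU : open U.
  apply: (@open_height R [set y | flip (odd j) y < d]).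
  have -> : [set y | flip (odd j) y < d] = flip (odd j) @^-1` [set y | y < d] by [].
  by apply: open_comp (@open_lt R d) => y _; exact: continuous_flip.
have Ub : U (embedding M (@bend R j)) by rewrite embedding_bend // /U /= flip_bit.
have [x [x' [g [[lx lx' nx nx' nl] [cg g0 g1 hU hg]]]]] := joined U oU Ub.
have no_path y y' (f : R -> R * R) : 0 <= y <= 1 -> 0 <= y' <= 1 ->
    point_at (left_leg (odd j) (spine j)) y <> bend j ->
    point_at (right_leg (odd j) (spine j)) y' <> bend j ->
    continuous f -> f 0 = embedding M (point_at (left_leg (odd j) (spine j)) y) ->
    f 1 = embedding M (point_at (right_leg (odd j) (spine j)) y') ->
    (forall t, 0 <= t <= 1 -> U (f t)) -> (forall t, 0 < t < 1 -> ~ Y (f t)) -> False.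
  move=> hy hy' n1 n2 cf f0 f1 fU fY.
  have ny : y != (odd j)%:R by apply/eqP => E; apply: n1; rewrite E.
  have ny' : y' != (odd j)%:R by apply/eqP => E; apply: n2; rewrite E /bend vertexE.
  rewrite -spineS1 in f1; move: fU; rewrite /U /d.
  case: ifP => [Mj|nMj] fU; first exact: (@no_path_mirrored_left j y y' f).
  apply: (@no_path_mirrored_right j y y' f) => //.
  by move: fj; rewrite /flipped nMj.
rewrite layer_bend in lx; rewrite layer_bend in lx'.
case: lx lx' => y hy [E|E] [y' hy' [E'|E']]; subst x x'.
- by apply: nl; exact: (@linked_leg j true).
- exact: (no_path y y' g).
- apply: (no_path y' y (fun t => g (1 - t))) => //.
  + exact: continuous_reverse.
  + by rewrite subr0.
  + by rewrite subrr.
  + by move=> t /andP [t0 t1]; apply: hU; apply/andP; split; lra.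
  + by move=> t /andP [t0 t1]; apply: hg; apply/andP; split; lra.
- by apply: nl; rewrite -spineS1 in nx nx' *; exact: (@linked_leg j false).
Qed.

End OnePattern.

End NotJoined.

(** * Homeomorphisms between two of the images *)

Section Transfer.
Context {R : realType}.
Local Notation side := (@side R).
Implicit Types (b c e : bool) (q : side * side) (w u : seq bool) (s : side) (i k l j n : nat)
  (t y d : R) (p z x : R * R) (M : pred nat).

Local Notation K := (accordion false (@unit_quad R)).

Section OneWay.
Variables (X : set (R * R)) (g g' : R * R -> R * R).
Hypothesis cg : {within X, continuous g}.
Hypothesis gX : forall p, X p -> X (g p).
Hypothesis gK : forall p, X p -> g' (g p) = p.

Lemma linked_image x p p' : X x -> linked X x p p' -> linked X (g x) (g p) (g p').
Proof.
move=> Xx [C [cC CX nx Cp Cp']]; exists (g @` C); split.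
- apply: connected_continuous_connected => //; exact: continuous_subspaceW cg.
- by move=> _ [z /CX Xz <-]; exact: gX.
- by move=> [z Cz E]; apply: nx; rewrite -(gK Xx) -E gK //; exact: CX.
- by exists p.
- by exists p'.
Qed.

End OneWay.

Section BothWays.
Variables (X : set (R * R)) (g g' : R * R -> R * R).
Hypothesis cg : {within X, continuous g}.
Hypothesis gX : forall p, X p -> X (g p).
Hypothesis gK : forall p, X p -> g' (g p) = p.
Hypothesis cg' : {within X, continuous g'}.
Hypothesis gX' : forall p, X p -> X (g' p).
Hypothesis gK' : forall p, X p -> g (g' p) = p.

Lemma not_linked_image x p p' : X x -> X p -> X p' ->
  ~ linked X x p p' -> ~ linked X (g x) (g p) (g p').
Proof.
move=> Xx Xp Xp' nl l; apply: nl.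
rewrite -(gK Xx) -(gK Xp) -(gK Xp').
by apply: (linked_image cg' gX' gK') => //; exact: gX.
Qed.

Lemma layer_image p p' : X p -> layer X p p' -> layer X (g p) (g p').
Proof.
move=> Xp [Xp' h]; split; first exact: gX.
move=> x Xx n1 n2; rewrite -(gK' Xx); apply: (linked_image cg gX gK); first exact: gX'.
apply: h; first exact: gX'.
- by move=> E; apply: n1; rewrite -E gK'.
- by move=> E; apply: n2; rewrite -E gK'.
Qed.

Lemma neq_image p p' : X p -> X p' -> p <> p' -> g p <> g p'.
Proof. by move=> Xp Xp' n E; apply: n; rewrite -(gK Xp) E gK. Qed.

Lemma cut_image x : X x -> cut X x -> cut X (g x).
Proof.
move=> Xx [p [p' [Xp Xp' n n' nl]]]; exists (g p), (g p'); split; try exact: gX.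
- exact: neq_image.
- exact: neq_image.
- exact: not_linked_image.
Qed.

End BothWays.

Lemma legs_joined_image (f f' h h' g g' : R * R -> R * R) p :
  continuous h -> cancel h h' ->
  {within K, continuous g} -> (forall p, K p -> K (g p)) -> (forall p, K p -> g' (g p) = p) ->
  {within K, continuous g'} -> (forall p, K p -> K (g' p)) -> (forall p, K p -> g (g' p) = p) ->
  (forall p, K p -> f' (g p) = h (f p)) ->
  K p -> legs_joined f p -> legs_joined f' (g p).
Proof.
move=> ch hK cg gX gK cg' gX' gK' fg Kp joined U oU Up.
have oV : open (h @^-1` U) by apply: open_comp oU => z _; exact: ch.
have Vp : (h @^-1` U) (f p) by rewrite /= -fg.
have [x [x' [a [[lx lx' nx nx' nl] [ca a0 a1 aU aK]]]]] := joined _ oV Vp.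
have [Kx Kx'] : K x /\ K x' by split; [case: lx|case: lx'].
exists (g x), (g x'), (h \o a); split; split.
- exact: (layer_image cg gX gK gX' gK').
- exact: (layer_image cg gX gK gX' gK').
- exact: (neq_image gK).
- exact: (neq_image gK).
- exact: (not_linked_image gX gK cg' gX' gK').
- by move=> t; apply: continuous_comp; [exact: ca|exact: ch].
- by rewrite /= a0 fg.
- by rewrite /= a1 fg.
- by move=> t /aU.
- move=> t ht [z Kz E]; apply: (aK t ht); exists (g' z); first exact: gX'.
  apply: (can_inj hK); rewrite -fg ?gK' //; exact: gX'.
Qed.

Lemma acc_bend j : K (bend j).
Proof. by have := @accordion_vertex R false unit_quad (nseq j true) nondegenerate_unit_quad; rewrite kind_spine. Qed.

(** The property on the left is invariant under homeomorphisms of the plane. *)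
Lemma flipped_bendP M p : sparse M -> K p ->
  (cut K p /\ ~ legs_joined (embedding M) p) <-> exists2 j, flipped M j & p = bend j.
Proof.
move=> sM Kp; have wq := @nondegenerate_unit_quad R; split.
- move=> [/(cut_accordionP wq Kp) [w E] nj].
  have [[j Ew fj]|H] := pselect (exists2 j, w = nseq j true & flipped M j).
    by exists j => //; rewrite E Ew kind_spine.
  exfalso; apply: nj; rewrite E; apply: joined_unflipped => // j Ew.
  by apply/negP => fj; apply: H; exists j.
- move=> [j fj ->]; split; last exact: not_joined_flipped.
  apply/(cut_accordionP wq (acc_bend j)); exists (nseq j true).
  by rewrite kind_spine.
Qed.

Lemma bend_inj i j : @bend R i = bend j -> i = j.
Proof.
wlog ij : i j / (i < j)%N => [H|] E.
  have [ij|ij|//] := ltngtP i j; first exact: H.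
  by apply/esym/H.
have zj : zig_points (odd j) (spine j) (@bend R j) by exists (odd j)%:R; [exact: bool01|left].
have ci : in_cell i (@bend R i).
  by have /acc_cell [] := @side_in_cell R i true (odd i)%:R (bool01 _).
rewrite E in ci; case: (bend_cells zj ci) => // ji.
by move: ij; rewrite ji ltnNge leqnSn.
Qed.

Lemma bend_before i j : (i < j)%N ->
  (@bend R i).1 < side_at (median (odd j) (spine j)) (bend i).2.
Proof.
move=> ij; have hy := bool01 (R := R) (odd i); rewrite medianE /=.
have := spine_left_le hy ij; rewrite spineS1 -leg_eq.
by have [h1 h2 _ _ _] := leg_gaps (odd j) (nondegenerate_spine j) hy; lra.
Qed.

Lemma bend_after j k : (j < k)%N ->
  side_at (median (odd j) (spine j)) (bend k).2 < (@bend R k).1.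
Proof.
move=> jk; have hy := bool01 (R := R) (odd k); rewrite medianE /=.
have := spine_left_le hy jk; rewrite spineS1.
have [_ h2 _ _ _] := leg_gaps (odd j) (nondegenerate_spine j) hy.
by have [h1 _ _ _ _] := leg_gaps (odd k) (nondegenerate_spine k) hy; lra.
Qed.

Lemma bend_separates i j k : (i < j)%N -> (j < k)%N -> ~ linked K (bend j) (bend i) (bend k).
Proof.
move=> ij jk; have := @not_linked R false unit_quad (nseq j true) (bend i) (bend k) nondegenerate_unit_quad.
by rewrite kind_spine; apply; [exact: bend_before|exact: bend_after].
Qed.

(** The accordion to the right of the bend is connected, also without the bend, which is
a corner of it. *)
Lemma bend_same_side i j k : (j < i)%N -> (j < k)%N -> linked K (bend j) (bend i) (bend k).
Proof.
have wq := @nondegenerate_unit_quad R.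
have mem n : (j < n)%N -> accordion (odd j.+1) (spine j.+1) (@bend R n).
  move=> /subnKC E; have := @accordion_vertex R (odd j.+1) (spine j.+1) (nseq (n - j.+1) true) (nondegenerate_spine _).
  have -> : kind (odd j.+1) (nseq (n - j.+1) true) = odd n.
    by rewrite /kind size_nseq -oddD E.
  have -> // : subquad (odd j.+1) (spine j.+1) (nseq (n - j.+1) true) = @spine R n.
  by rewrite -{1}(kind_spine j.+1) -subquad_cat -nseqD E.
move=> ji jk; exists (accordion (odd j.+1) (spine j.+1) `\` [set bend j]); split.
- apply: accordion_connected; first exact: nondegenerate_spine.
  move=> w; rewrite bend_left cell1.
  exact: (@side_not_vertex R (odd j.+1) (spine j.+1) w _ false (nondegenerate_spine _) (bool01 _)).
- by move=> p [h _]; apply: (accordion_sub (w := nseq j.+1 true)) => //; rewrite kind_spine.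
- by move=> [_]; apply.
- by split; [exact: mem|move=> /bend_inj E; rewrite E ltnn in ji].
- by split; [exact: mem|move=> /bend_inj E; rewrite E ltnn in jk].
Qed.

(** If [i < j] but [s j < s i], any [k > j] whose image is beyond [s j] contradicts the
hypothesis; such [k] exists because [s] is onto. *)
Lemma order_rigid (s t : nat -> nat) : cancel s t -> cancel t s ->
  (forall i j k, (i < j)%N -> (j < k)%N -> ~ ((s j < s i)%N /\ (s j < s k)%N)) ->
  forall i j, (i < j)%N -> (s i < s j)%N.
Proof.
move=> sK tK H i j ij; rewrite ltnNge leq_eqVlt; apply/negP => /orP [/eqP E|lt].
  by move: ij; rewrite (can_inj sK E) ltnn.
(* a value beyond [s 0], ..., [s j] *)
pose v := (\max_(l < j.+1) s l).+1.
have big l : (l <= j)%N -> (s l < v)%N.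
  by move=> lj; rewrite ltnS; exact: (@leq_bigmax _ (fun l : 'I_j.+1 => s l) (Ordinal (lj : l < j.+1)%N)).
apply: (H i j (t v)) => //; last by rewrite tK lt big.
rewrite ltnNge; apply/negP => /big; by rewrite tK ltnn.
Qed.

Lemma rigid (s t : nat -> nat) : cancel s t -> cancel t s ->
  (forall i j k, (i < j)%N -> (j < k)%N -> ~ ((s j < s i)%N /\ (s j < s k)%N)) ->
  (forall i j k, (i < j)%N -> (j < k)%N -> ~ ((t j < t i)%N /\ (t j < t k)%N)) ->
  s =1 id.
Proof.
move=> sK tK Hs Ht.
have incr (f : nat -> nat) : (forall i j, (i < j)%N -> (f i < f j)%N) -> forall n, (n <= f n)%N.
  by move=> fI; elim=> // n IH; apply: leq_ltn_trans IH _; exact: fI.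
have is_ := incr _ (order_rigid sK tK Hs); have it := incr _ (order_rigid tK sK Ht).
by move=> n; apply/eqP; rewrite eqn_leq is_ andbT -{2}(sK n) it.
Qed.

End Transfer.

(** * The kinds of vertices are preserved or exchanged *)

Section Heights.
Context {R : realType}.
Local Notation side := (@side R).
Implicit Types (b c e : bool) (q : side * side) (w u : seq bool) (s : side) (i k l j m n : nat)
  (t y d : R) (p z x : R * R) (M : pred nat).

Local Notation K := (accordion false (@unit_quad R)).

(** The kinds alternate towards the side, so there are vertices of both heights close to
it. *)
Lemma vertex_near w c e (eps : R) : 0 < eps ->
  let s := if c then (subquad false unit_quad w).2 else (subquad false unit_quad w).1 in
  exists u, let v := vertex (kind false u) (subquad false unit_quad u) in
    v.2 = e%:R /\ `|side_at s e%:R - v.1| < eps.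
Proof.
move=> eps0 s; have wq := @nondegenerate_unit_quad R.
have ws := nondegenerate_subquad false w wq.
have [n hn] := width_eventually (kind false w) ws eps0.
(* one more step if the kind is wrong after [n] steps *)
pose n' := (n + ((kind false w (+) odd n) != e))%N.
have he := bool01 (R := R) e.
exists (w ++ nseq n' c).
have -> : kind false (w ++ nseq n' c) = e.
  rewrite kind_cat {1}/kind size_nseq /n' oddD addbA oddb.
  by case: (_ (+) odd n); case: (e).
split=> //; rewrite /vertex /=.
have W := hn (nseq n' c) e%:R; rewrite size_nseq leq_addr in W; have {}W := W isT he.
have := leg_gaps e (nondegenerate_subquad (kind false w) (nseq n' c) ws) he.
rewrite subquad_cat; set q' := subquad (kind false w) _ _ in W *; move=> [h1 h2 h3 _ _].
have E : if c then q'.2 = (subquad false unit_quad w).2 else q'.1 = (subquad false unit_quad w).1.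
  by rewrite /q'; case: (c); rewrite ?subquad_nseq_true ?subquad_nseq_false.
move: W E; rewrite /width /s; case: (c) => W <-;
  by rewrite ltr_norml; apply/andP; split; lra.
Qed.

Section Automorphism.
Variables g g' : R * R -> R * R.
Hypothesis cg : {within K, continuous g}.
Hypothesis gX : forall p, K p -> K (g p).
Hypothesis gK : forall p, K p -> g' (g p) = p.
Hypothesis cg' : {within K, continuous g'}.
Hypothesis gX' : forall p, K p -> K (g' p).
Hypothesis gK' : forall p, K p -> g (g' p) = p.

Local Notation vt w := (vertex (kind false w) (subquad false (@unit_quad R) w)).

Let Kv w : K (vt w).
Proof. by apply: accordion_vertex; exact: nondegenerate_unit_quad. Qed.

Lemma vertex_image w : exists w', g (vt w) = vt w'.
Proof.
have wq := @nondegenerate_unit_quad R; apply/(cut_accordionP wq (gX (Kv w))).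
apply: (cut_image gX gK cg' gX' gK') => //.
by apply/(cut_accordionP wq (Kv w)); exists w.
Qed.

Lemma cont_at p (eps : R) : K p -> 0 < eps -> exists2 d, 0 < d & forall z, K z ->
  `|p.1 - z.1| < d -> `|p.2 - z.2| < d -> `|(g p).2 - (g z).2| < eps.
Proof.
move=> Kp e0; have := (@subspace_continuousP _ K _ g).1 cg p Kp (ball (g p) eps)
  (nbhsx_ballx _ _ e0).
move=> /nbhs_planeP [d d0 hd]; exists d => // z Kz h1 h2.
by have /ball_plane [] := hd z h1 h2 Kz.
Qed.

Definition is_end y : Prop := y = 0 \/ y = 1.

Lemma boolr_eq0 e : ((e%:R : R) == 0) = ~~ e.
Proof. by case: e; rewrite ?oner_eq0 ?eqxx. Qed.

Lemma bool_end e : is_end e%:R.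
Proof. by case: e; [right|left]. Qed.

(** Ends of sides are limits of vertices, and vertices go to vertices. *)
Lemma end_image w c e :
  let s := if c then (subquad false unit_quad w).2 else (subquad false unit_quad w).1 in
  is_end (g (point_at s e%:R)).2.
Proof.
move=> s; have wq := @nondegenerate_unit_quad R.
have Ks : K (point_at s e%:R).
  by rewrite /s; case: c {s}; [apply: acc_sub_right|apply: acc_sub_left] => //; exact: bool01.
apply: contrapT => nend; set a := (g _).2 in nend.
have a0 : a != 0 by apply/eqP => E; apply: nend; left.
have a1 : a - 1 != 0 by rewrite subr_eq0; apply/eqP => E; apply: nend; right.
have m0 : 0 < Num.min `|a| `|a - 1| by rewrite lt_min !normr_gt0 a0 a1.
have [d d0 hd] := cont_at Ks m0.
have [u [u2 u1]] := vertex_near w c e d0.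
have := hd _ (Kv u) u1; rewrite u2 subrr normr0 => /(_ d0).
have [w' E] := vertex_image u; rewrite lt_min E -/a /=.
by case: (bool_end (kind false w')) => ->; rewrite ?subr0 ltxx ?andbF.
Qed.

(** The feet of a zigzag go to points of the legs at the image of its vertex.  By
[end_image] they are ends of these legs, and not the vertex. *)
Lemma foot_image w c :
  let s := if c then right_leg true (subquad false unit_quad w) else left_leg true (subquad false unit_quad w) in
  kind false w = true -> forall w', g (vt w) = vt w' ->
  (g (point_at s 0)).2 = (~~ kind false w')%:R.
Proof.
move=> s bw w' E; have wq := @nondegenerate_unit_quad R.
have s_end : is_end (g (point_at s 0)).2.
  have := end_image (rcons w c) (~~ c) false; rewrite subquad_rcons bw /s.
  by case: (c).
have hs : zig_points (kind false w) (subquad false unit_quad w) (point_at s 0).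
  exists 0; first by rewrite lexx ler01.
  by rewrite bw /s; case: (c); [right|left].
have Ks : K (point_at s 0) by exact: (acc_zig_points wq hs).
have hl : layer K (vt w) (point_at s 0) by rewrite layer_sub.
have := layer_image cg gX gK gX' gK' (Kv w) hl; rewrite E layer_sub => -[y hy hp].
have y2 : (g (point_at s 0)).2 = y by case: hp => ->.
rewrite y2 in s_end *.
have ny : y != (kind false w')%:R.
  apply/eqP => Ey; have : g (point_at s 0) = g (vt w).
    by rewrite E; case: hp => ->; rewrite Ey //; rewrite vertexE.
  move=> Eg; have := gK (Kv w); rewrite -Eg gK // => /(congr1 snd) E0.
  have : (0 : R) = (kind false w)%:R by exact: E0.
  by rewrite bw => /eqP; rewrite eq_sym oner_eq0.
by case: s_end ny => ->; case: (kind false w'); rewrite /= ?eqxx.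
Qed.

(** Color a side by the height of the image of its lower end.  By continuity this is
locally constant, and both legs of a zigzag have one color: they share the lower end
or, by [foot_image], their lower ends go to equal heights.  Hence all sides have the
same color. *)
Lemma heights_image : exists e, forall j, (g (bend j)).2 = (e (+) odd j)%:R.
Proof.
have wq := @nondegenerate_unit_quad R; have y01 : 0 <= (0 : R) <= 1 by rewrite lexx ler01.
pose k (s : side) : bool := (g (point_at s 0)).2 == 0.
have kleg w : k (left_leg (kind false w) (subquad false unit_quad w)) =
              k (right_leg (kind false w) (subquad false unit_quad w)).
  case E : (kind false w); last first.
    by rewrite /k; have := leg_eq false (subquad false (@unit_quad R) w); rewrite /point_at /= => ->.
  have [w' Ew'] := vertex_image w.
  have := foot_image (w := w) false E Ew'; have := foot_image (w := w) true E Ew'.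
  by rewrite /k /= => -> ->.
have kloc v : K (v, 0) -> exists2 eps : R, 0 < eps & forall w,
     `|side_at (subquad false unit_quad w).1 0 - v| < eps ->
     `|side_at (subquad false unit_quad w).2 0 - v| < eps ->
     k (subquad false unit_quad w).1 = k (subquad false unit_quad w).2.
  move=> Kz; have h2 : 0 < (1 / 2 : R) by lra.
  have [d d0 hd] := cont_at Kz h2; exists d => // w s1 s2.
  have c1 := hd _ (acc_sub_left false w wq y01); rewrite /= distrC subrr normr0 in c1.
  have c2 := hd _ (acc_sub_right false w wq y01); rewrite /= distrC subrr normr0 in c2.
  have {}c1 := c1 s1 d0; have {}c2 := c2 s2 d0.
  move: c1 c2; rewrite !ltr_norml => /andP [a1 a2] /andP [a3 a4].
  have := end_image w false false; have := end_image w true false; rewrite /= /k.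
  by move=> [E1|E1] [E2|E2]; rewrite E1 E2 ?eqxx // in a1 a2 a3 a4 *; lra.
have kall := nested_color_all wq y01 kleg kloc.
have kL w : k (left_leg (kind false w) (subquad false unit_quad w)) = k (@unit_quad R).1.
  by have [_] := kall (rcons w false); rewrite subquad_rcons.
set k0 := k _ in kL; exists (~~ k0) => j.
have := kL (nseq j true); rewrite kind_spine -/(spine j) => kj.
have [w' Ew'] := vertex_image (nseq j true).
case oj : (odd j) kj => kj.
- have bj : kind false (nseq j true) = true by rewrite kind_spine.
  have := foot_image (w := nseq j true) false bj Ew'; rewrite /= -/(spine j) => F.
  move: kj; rewrite /k F boolr_eq0 negbK => kj.
  have -> : bend j = vt (nseq j true) by rewrite kind_spine.
  have -> : (g (vt (nseq j true))).2 = (kind false w')%:R by rewrite Ew'.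
  by rewrite -kj addbT negbK.
- have E : bend j = point_at (left_leg false (spine j)) 0 by rewrite /bend oj.
  have := end_image (rcons (nseq j true) false) true false.
  rewrite subquad_rcons kind_spine oj /= -/(spine j) -E => H.
  move: kj; rewrite /k -E; case: H => -> <-; rewrite ?eqxx //.
  by rewrite oner_eq0.
Qed.

End Automorphism.

End Heights.

(** * Codes *)

Section Code.
Context {R : realType}.
Implicit Types (k j m n : nat) (r : R).

Local Notation K := (accordion false (@unit_quad R)).

Section Pattern.
Variable be : nat -> bool.

(** Exactly one of the cells [4i+1] and [4i+2] is mirrored, for every [i]. *)
Definition pattern : pred nat := fun k => k == (4 * (k %/ 4) + 1 + be (k %/ 4))%N.

(** The increasing enumeration of the flipped bends, see [flippedP]. *)
Definition flip_index m : nat := (4 * (m./2) + be (m./2) + odd m)%N.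

Lemma patternP k : pattern k <-> exists i, k = (4 * i + 1 + be i)%N.
Proof.
rewrite /pattern; split; first by move=> /eqP E; exists (k %/ 4)%N.
move=> [i ->]; apply/eqP; congr (4 * _ + 1 + be _)%N; case: (be i); lia.
Qed.

Lemma pattern_sparse : sparse pattern.
Proof.
split; first by apply/negP => /patternP [i]; lia.
move=> k /patternP [i ->]; apply/negP => /patternP [i' E].
have ii : i = i' by move: E; case: (be i); case: (be i'); lia.
by move: E; rewrite ii; lia.
Qed.

Lemma flippedP j : flipped pattern j <-> exists m, j = flip_index m.
Proof.
rewrite /flipped; split.
- case/orP => /patternP [i E].
  + exists (i.*2.+1); rewrite /flip_index /= uphalf_double odd_double /=.
    by rewrite E; lia.
  + exists (i.*2); rewrite /flip_index doubleK odd_double /=; lia.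
- move=> [m ->]; rewrite /flip_index; apply/orP; case: (odd m) => /=.
  + by left; apply/patternP; exists (m./2); lia.
  + by right; apply/patternP; exists (m./2); lia.
Qed.

Lemma flip_index_mono m n : (m < n)%N -> (flip_index m < flip_index n)%N.
Proof.
rewrite /flip_index => mn.
have hm := odd_double_half m; have hn := odd_double_half n.
have [E|N] := eqVneq m./2 n./2.
  by rewrite E; move: hm hn; rewrite E; case: (odd m); case: (odd n); lia.
have : (m./2 < n./2)%N by move: hm hn N; case: (odd m); case: (odd n); lia.
by case: (be m./2); case: (be n./2); case: (odd m); case: (odd n); lia.
Qed.

Lemma odd_flip_index i : odd (flip_index i.*2) = be i.
Proof. by rewrite /flip_index doubleK odd_double addn0 oddD oddM /= oddb. Qed.

Lemma flip_index0 : be 0%N = false -> flip_index 0 = 0%N.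
Proof. by rewrite /flip_index /= => ->. Qed.

End Pattern.

Lemma flip_index_inj be m n : flip_index be m = flip_index be n -> m = n.
Proof.
by move=> E; case: (ltngtP m n) => // /(flip_index_mono be); rewrite E ltnn.
Qed.

Lemma boolr_inj (e e' : bool) : (e%:R : R) = e'%:R -> e = e'.
Proof. by move=> /(congr1 (fun x : R => x == 0)); rewrite !boolr_eq0 => /negb_inj. Qed.

(** If the images of two bends were both to the right of that of a bend between them, they
would be linked. *)
Lemma bends_order (g g' : R * R -> R * R) (J J' s : nat -> nat) :
  (forall p, K p -> K (g p)) -> (forall p, K p -> g' (g p) = p) ->
  {within K, continuous g'} -> (forall p, K p -> K (g' p)) -> (forall p, K p -> g (g' p) = p) ->
  (forall m n, (m < n)%N -> (J m < J n)%N) ->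
  (forall m n, (m < n)%N -> (J' m < J' n)%N) ->
  (forall m, g (bend (J m)) = bend (J' (s m))) ->
  forall i j k, (i < j)%N -> (j < k)%N -> ~ ((s j < s i)%N /\ (s j < s k)%N).
Proof.
move=> gX gK cg' gX' gK' Jm Jm' gs i j k ij jk [/Jm' ji /Jm' jk'].
have := bend_separates (R := R) (Jm _ _ ij) (Jm _ _ jk).
have Kb n := @acc_bend R n.
move/(not_linked_image gX gK cg' gX' gK' (Kb _) (Kb _) (Kb _)); apply.
by rewrite !gs; exact: bend_same_side.
Qed.

(** Even members of the sequence of flipped bends carry the bits as their kinds, by
[odd_flip_index]; the first one is a V-vertex for all codes, which excludes that the
kinds are exchanged. *)
Lemma equivalent_codes be be' : be 0%N = false -> be' 0%N = false ->
  equivalent_embeddings K (embedding (pattern be)) (embedding (pattern be')) -> be =1 be'.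
Proof.
move=> b0 b0' [h [[ch [hT [h' [ch' hK]]]] hY]].
have sM := pattern_sparse be; have sM' := pattern_sparse be'.
move: ch ch'; rewrite -!continuous_subspace_setT => ch ch'.
have {}hK : cancel h h' by move=> p; apply: hK; rewrite inE.
have hK' : cancel h' h.
  by move=> p; have : [set: R * R] p by []; rewrite -hT => -[z _ <-]; rewrite hK.
set f := embedding (pattern be) in hY; set f' := embedding (pattern be') in hY.
pose g := embedding_inv (pattern be') \o (h \o f).
pose g' := embedding_inv (pattern be) \o (h' \o f').
have gP p : K p -> K (g p) /\ f' (g p) = h (f p).
  move=> Kp; have : (h @` (f @` K)) (h (f p)) by exists (f p) => //; exists p.
  by rewrite hY => -[q Kq E]; rewrite /g /= -E /f' embeddingK.
have gP' p : K p -> K (g' p) /\ f (g' p) = h' (f' p).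
  move=> Kp; have : (f' @` K) (f' p) by exists p.
  by rewrite -hY => -[_ [q Kq <-] E]; rewrite /g' /= -E hK /f embeddingK.
have gX p : K p -> K (g p) by case/gP.
have gX' p : K p -> K (g' p) by case/gP'.
have gK p : K p -> g' (g p) = p.
  by move=> Kp; rewrite {1}/g' /= (gP p Kp).2 hK /f embeddingK.
have gK' p : K p -> g (g' p) = p.
  by move=> Kp; rewrite {1}/g /= (gP' p Kp).2 hK' /f' embeddingK.
have cg : {within K, continuous g}.
  apply: (within_comp_cont (embedding_inv_continuous sM')).
    apply: (@within_comp_cont _ _ _ setT _ h f) => //.
      exact: continuous_subspaceT.
    exact: embedding_continuous.
  by move=> p Kp; rewrite /= -(gP p Kp).2; exists (g p) => //; exact: gX.
have cg' : {within K, continuous g'}.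
  apply: (within_comp_cont (embedding_inv_continuous sM)).
    apply: (@within_comp_cont _ _ _ setT _ h' f') => //.
      exact: continuous_subspaceT.
    exact: embedding_continuous.
  by move=> p Kp; rewrite /= -(gP' p Kp).2; exists (g' p) => //; exact: gX'.
have Kb n := @acc_bend R n.
have image m : exists n, g (bend (flip_index be m)) = bend (flip_index be' n).
  have fl : flipped (pattern be) (flip_index be m) by apply/flippedP; exists m.
  have [ct nj] : cut K (bend (flip_index be m)) /\ ~ legs_joined f (bend (flip_index be m)).
    by apply/(flipped_bendP sM (Kb _)); exists (flip_index be m).
  have [j' /flippedP [n ->] ->] : exists2 j, flipped (pattern be') j &
      g (bend (flip_index be m)) = bend j; last by exists n.
    apply/(flipped_bendP sM' (gX _ (Kb _))); split.
      exact: (cut_image gX gK cg' gX' gK').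
    move=> jn; apply: nj; rewrite -(gK _ (Kb _)).
    apply: (legs_joined_image ch' hK' cg' gX' gK' cg gX gK) jn; last exact: gX.
    by move=> p Kp; rewrite -/f (gP' p Kp).2.
have image' m : exists n, g' (bend (flip_index be' m)) = bend (flip_index be n).
  have fl : flipped (pattern be') (flip_index be' m) by apply/flippedP; exists m.
  have [ct nj] : cut K (bend (flip_index be' m)) /\ ~ legs_joined f' (bend (flip_index be' m)).
    by apply/(flipped_bendP sM' (Kb _)); exists (flip_index be' m).
  have [j' /flippedP [n ->] ->] : exists2 j, flipped (pattern be) j &
      g' (bend (flip_index be' m)) = bend j; last by exists n.
    apply/(flipped_bendP sM (gX' _ (Kb _))); split.
      exact: (cut_image gX' gK' cg gX gK).
    move=> jn; apply: nj; rewrite -(gK' _ (Kb _)).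
    apply: (legs_joined_image ch hK cg gX gK cg' gX' gK') jn; last exact: gX'.
    by move=> p Kp; rewrite -/f' (gP p Kp).2.
have [s hs] := choice image; have [t ht] := choice image'.
have sK : cancel s t.
  move=> m; apply: (@flip_index_inj be); apply: (@bend_inj R).
  by rewrite -ht -hs gK.
have tK : cancel t s.
  move=> m; apply: (@flip_index_inj be'); apply: (@bend_inj R).
  by rewrite -hs -ht gK'.
have s_id : s =1 id.
  apply: (rigid sK tK).
  - exact: (bends_order gX gK cg' gX' gK' (flip_index_mono be) (flip_index_mono be') hs).
  - exact: (bends_order gX' gK' cg gX gK (flip_index_mono be') (flip_index_mono be) ht).
have [e he] := heights_image cg gX gK cg' gX' gK'.
have odds m : e (+) odd (flip_index be m) = odd (flip_index be' m).
  by apply: boolr_inj; rewrite -he hs s_id.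
have e0 : e = false.
  by have := odds 0%N; rewrite !flip_index0 // addbF.
by move=> i; have := odds i.*2; rewrite e0 !odd_flip_index.
Qed.

(** The bit [0] is [false] for all codes, as [equivalent_codes] requires; the others tell which
rational numbers are less than [r]. *)
Definition code r i : bool :=
  if i is i'.+1 then
    if @unpickle rat i' is Some q then ratr q < r else false
  else false.

Lemma code_inj r r' : code r =1 code r' -> r = r'.
Proof.
wlog lt : r r' / r < r' => [H E|E].
  have [lt|lt|//] := ltgtP r r'; first exact: H.
  by apply/esym/H => // i; rewrite E.
have [q /= ] := rat_in_itvoo lt; rewrite in_itv /= => /andP [q1 q2].
have := E (pickle q).+1; rewrite /= pickleK q2.
by rewrite ltNge (ltW q1).
Qed.

End Code.

Unset Implicit Arguments.

Theorem corollary3p27 (R : realType) :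
  exists Psi : set (R * R -> R * R),
    (Psi #= [set: R])%card /\
    (forall psi, Psi psi -> is_planar_embedding (knaster_accordion R) psi) /\
    (forall phi psi, Psi phi -> Psi psi -> phi <> psi ->
       ~ equivalent_embeddings (knaster_accordion R) phi psi) /\
    (forall psi, Psi psi -> forall x, knaster_accordion R x ->
       (accessible (psi @` knaster_accordion R) (psi x) <->
        accessible (knaster_accordion R) x)).
Proof.
rewrite knaster_accordionE.
pose F (r : R) : R * R -> R * R := embedding (pattern (code r)).
have ineq r r' : equivalent_embeddings (accordion false unit_quad) (F r) (F r') -> r = r'.
  by move=> /equivalent_codes E; apply: code_inj; exact: E.
exists (range F); split; [|split; [|split]].
- apply: inj_card_eq => r r' _ _ E; apply: ineq; rewrite E.
  exists id; split; last by rewrite image_id.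
  split; first by apply: continuous_subspaceT => p; exact: cvg_id.
  split; first by rewrite image_id.
  by exists id; split => //; apply: continuous_subspaceT => p; exact: cvg_id.
- by move=> _ [r _ <-]; apply: embedding_planar; exact: pattern_sparse.
- by move=> _ _ [r _ <-] [r' _ <-] ne /ineq E; apply: ne; rewrite E.
- by move=> _ [r _ <-] x Kx; apply: access_iff => //; exact: pattern_sparse.
Qed.
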